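(* If a set of functions $\{Z^{(n)}(u_n,\ldots,u_1;v_n,\ldots,v_1;\lambda)\}_{n\ge1}$ satisfies the following conditions: (1) for each $n$, $Z^{(n)}$ is a symmetric function in both sets of variables, $u_1,\ldots,u_n$ and $v_1,\ldots,v_n$; (2) for each $n$, $Z^{(n)}$ is an elliptic polynomial of degree $n$ with character $\chi$ in each variable $u_i$, where $\chi(1)=(-1)^n$ and $\chi(\tau)=(-1)^n\exp\big(2\pi i(\lambda+\sum_{j=1}^nv_j)\big)$; (3) for each $n\ge2$, under the condition $u_n=v_n-\hbar$, the $n$-th function is expressed through the $(n-1)$-st one by $$Z^{(n)}(v_n-\hbar,u_{n-1},\ldots,u_1;v_n,v_{n-1},\ldots,v_1;\lambda)=\frac{\theta(\lambda+n\hbar)\theta(\hbar)}{\theta(\lambda+(n-1)\hbar)}\prod_{m=1}^{n-1}\big(\theta(v_n-v_m-\hbar)\theta(u_m-v_n)\big)\,Z^{(n-1)}(u_{n-1},\ldots,u_1;v_{n-1},\ldots,v_1;\lambda);$$ (4) (initial condition) $Z^{(1)}(u_1;v_1;\lambda)=\dfrac{\theta(u_1-v_1-\lambda)\theta(\hbar)}{\theta(-\lambda)}$; then $$Z^{+-}_{-+}(u_n,\ldots,u_1;v_n,\ldots,v_1;\lambda)=Z^{(n)}(u_n,\ldots,u_1;v_n,\ldots,v_1;\lambda)$$ for every $n\ge1$, where $Z^{+-}_{-+}$ is the partition function of the SOS model on the $n\times n$ lattice with domain-wall boundary conditions.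
   Context: Let $\Gamma=\mathbb Z+\tau\mathbb Z$, where $\tau$ ($\mathrm{Im}\,\tau>0$) is the modulus of the ordinary odd theta-function $\theta$, defined by $\theta(u+1)=-\theta(u)$, $\theta(u+\tau)=-e^{-2\pi iu-\pi i\tau}\theta(u)$, $\theta'(0)=1$. The anisotropy parameter $\hbar$ is a nonzero complex number, and $\lambda$ is a complex parameter. **Elliptic polynomials.** A character is a group homomorphism $\chi:\Gamma\to\mathbb C^\times$. For a character $\chi$ and an integer $n$, an elliptic polynomial of degree $n$ with character $\chi$ is a holomorphic function $\phi$ on $\mathbb C$ with $\phi(u+1)=\chi(1)\phi(u)$ and $\phi(u+\tau)=\chi(\tau)e^{-2\pi inu-\pi in\tau}\phi(u)$. **SOS model with domain-wall boundary conditions (DWBC).** Consider an $n\times n$ square lattice with vertices $(i,j)$, $1\le i,j\le n$ (columns $i$ numbered from right to left, rows $j$ from bottom to top) and faces $(i,j)$, $0\le i,j\le n$, the face $(i,j)$ with $i,j\ge1$ being to the upper left of the vertex $(i,j)$. The variable $u_i$ is attached to the $i$-th column and $v_j$ to the $j$-th row. A configuration assigns to each face a complex number $d_{ij}$, its height, with $d_{ij}-d_{i-1,j}=\pm1$ ($1\le i\le n$, $0\le j\le n$) and $d_{ij}-d_{i,j-1}=\pm1$ ($0\le i\le n$, $1\le j\le n$). DWBC means: $d_{i-1,n}-d_{in}=+1$ and $d_{i-1,0}-d_{i0}=-1$ for $1\le i\le n$; $d_{0,j-1}-d_{0j}=-1$ and $d_{n,j-1}-d_{nj}=+1$ for $1\le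 j\le n$; and the height $d_{nn}$ is fixed by $\hbar d_{nn}=\lambda$. The partition function is $$Z^{+-}_{-+}(u_n,\ldots,u_1;v_n,\ldots,v_1;\lambda)=\sum_C\prod_{i,j=1}^nW_{ij}(d_{i,j-1},d_{i-1,j-1},d_{i-1,j},d_{ij}),$$ the sum being over all configurations $C$ satisfying DWBC, with Boltzmann weights $W_{ij}(d+1,d+2,d+1,d)=W_{ij}(d-1,d-2,d-1,d)=\theta(u_i-v_j+\hbar)$, $W_{ij}(d-1,d,d+1,d)=\frac{\theta(u_i-v_j)\theta(\hbar d+\hbar)}{\theta(\hbar d)}$, $W_{ij}(d+1,d,d-1,d)=\frac{\theta(u_i-v_j)\theta(\hbar d-\hbar)}{\theta(\hbar d)}$, $W_{ij}(d-1,d,d-1,d)=\frac{\theta(u_i-v_j+\hbar d)\theta(\hbar)}{\theta(\hbar d)}$, $W_{ij}(d+1,d,d+1,d)=\frac{\theta(u_i-v_j-\hbar d)\theta(\hbar)}{\theta(-\hbar d)}$.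
   Formalization: The equality is claimed at v_1,…,v_n pairwise distinct mod Γ, or where Z^(n)(u;·) is continuous in v (for arbitrary functions it can fail at coinciding v_j); all θ(λ+kħ), k≥0, are assumed nonzero so that the formulas are defined. *)

(* Defs.v *)
(* The complex numbers are R[i] for an arbitrary R : realType. *)
From HB Require Import structures.
From mathcomp Require Import all_boot all_order all_algebra all_fingroup.
From mathcomp Require Import all_classical all_reals all_analysis.
From mathcomp Require Import complex.

Set Implicit Arguments.
Unset Strict Implicit.
Unset Printing Implicit Defensive.

Import Order.TTheory GRing.Theory Num.Theory.
Import numFieldNormedType.Exports.

Local Open Scope classical_set_scope.
Local Open Scope ring_scope.
Local Open Scope complex_scope.

Definition cexp (R : realType) (z : R[i]) : R[i] :=
  (expR (complex.Re z))%:C * (cos (complex.Im z) +i* sin (complex.Im z)).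

Definition pii (R : realType) : R[i] := 0 +i* pi.

(* Differentiability over the field R[i]: both source and target carry the
   regular normed module structure R[i]^o, so [derivable] is complex
   differentiability. *)
Definition holomorphic (R : realType) (f : R[i] -> R[i]) : Prop :=
  forall z : R[i], derivable (f : R[i]^o -> R[i]^o) z 1.

Definition lattice (R : realType) (tau : R[i]) : set R[i] :=
  [set z | exists a b : int, z = a%:~R + b%:~R * tau].

(* The properties determine theta (oddness already follows from the others). *)
Definition odd_theta (R : realType) (tau : R[i]) (theta : R[i] -> R[i]) : Prop :=
  [/\ holomorphic theta,
      forall u, theta (- u) = - theta u,
      forall u, theta (u + 1) = - theta u,
      forall u, theta (u + tau)
                = - cexp (- (2 * pii R * u) - pii R * tau) * theta u
    & is_derive (0 : R[i]^o) (1 : R[i]^o) (theta : R[i]^o -> R[i]^o) 1].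

(* Only the values of chi on the lattice are meaningful. *)
Definition character (R : realType) (tau : R[i]) (chi : R[i] -> R[i]) : Prop :=
  (forall z, lattice tau z -> chi z != 0) /\
  (forall z w, lattice tau z -> lattice tau w -> chi (z + w) = chi z * chi w).

Definition elliptic_poly (R : realType) (tau : R[i]) (n : int)
    (chi : R[i] -> R[i]) (phi : R[i] -> R[i]) : Prop :=
  [/\ holomorphic phi,
      forall u, phi (u + 1) = chi 1 * phi u
    & forall u, phi (u + tau)
        = chi tau * cexp (- (2 * pii R * n%:~R * u) - pii R * n%:~R * tau)
          * phi u].

(* Row vectors hold the spectral variables: the entry of index i is u_{i+1}. *)
Definition set_var (K : Type) (n : nat) (u : 'rV[K]_n) (i : 'I_n) (x : K) :
  'rV[K]_n := \row_k (if k == i then x else u 0 k).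

(* Boltzmann weight as a function of x = u_i - v_j and of the heights
   a = d_{i,j-1}, b = d_{i-1,j-1}, c = d_{i-1,j}, d = d_{ij}.  The six patterns
   are mutually exclusive, and are the only ones occurring in a configuration;
   the final 0 is never used. *)
Definition weight (R : realType) (theta : R[i] -> R[i]) (hbar : R[i])
    (x a b c d : R[i]) : R[i] :=
  if [&& a == d + 1, b == d + 2 & c == d + 1]
     || [&& a == d - 1, b == d - 2 & c == d - 1] then
    theta (x + hbar)
  else if [&& a == d - 1, b == d & c == d + 1] then
    theta x * theta (hbar * d + hbar) / theta (hbar * d)
  else if [&& a == d + 1, b == d & c == d - 1] then
    theta x * theta (hbar * d - hbar) / theta (hbar * d)
  else if [&& a == d - 1, b == d & c == d - 1] then
    theta (x + hbar * d) * theta hbar / theta (hbar * d)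
  else if [&& a == d + 1, b == d & c == d + 1] then
    theta (x - hbar * d) * theta hbar / theta (- (hbar * d))
  else 0.

(* The vertex with column (or row) number i + 1, i : 'I_n, lies between the
   faces with coordinates i and i + 1, both in 'I_n.+1. *)
Definition face_before (n : nat) (i : 'I_n) : 'I_n.+1 := widen_ord (leqnSn n) i.
Definition face_after (n : nat) (i : 'I_n) : 'I_n.+1 := lift ord0 i.

(* Heights are stored as a matrix, d i j being the height of the face (i, j);
   the first index numbers the columns of the lattice, from right to left. *)
Definition configuration (R : realType) (n : nat) (d : 'M[R[i]]_n.+1) : Prop :=
  (forall (i : 'I_n) (j : 'I_n.+1),
     d (face_after i) j - d (face_before i) j = 1 \/
     d (face_after i) j - d (face_before i) j = -1) /\
  (forall (i : 'I_n.+1) (j : 'I_n),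
     d i (face_after j) - d i (face_before j) = 1 \/
     d i (face_after j) - d i (face_before j) = -1).

Definition DWBC (R : realType) (n : nat) (hbar lambda : R[i])
    (d : 'M[R[i]]_n.+1) : Prop :=
  [/\ forall i : 'I_n,
        d (face_before i) ord_max - d (face_after i) ord_max = 1,
      forall i : 'I_n,
        d (face_before i) ord0 - d (face_after i) ord0 = -1,
      forall j : 'I_n,
        d ord0 (face_before j) - d ord0 (face_after j) = -1,
      forall j : 'I_n,
        d ord_max (face_before j) - d ord_max (face_after j) = 1
    & hbar * d ord_max ord_max = lambda].

(* A sum over a set of complex matrices; only finitely many configurations
   satisfy the boundary conditions (hbar being nonzero). *)
Definition partition_function (R : realType) (theta : R[i] -> R[i])
    (hbar : R[i]) (n : nat) (u v : 'rV[R[i]]_n) (lambda : R[i]) : R[i] :=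
  \sum_(d \in [set d : 'M[R[i]]_n.+1 | configuration d /\ DWBC hbar lambda d])
    \prod_(i < n) \prod_(j < n)
      weight theta hbar (u 0 i - v 0 j)
        (d (face_after i) (face_before j)) (d (face_before i) (face_before j))
        (d (face_before i) (face_after j)) (d (face_after i) (face_after j)).

(* Main.v *)
(* As functions of u_n, both sides are elliptic polynomials of degree n with the
   same character. Fourier expansion shows that these form a space of dimension at
   most n, so that their difference is 0 as soon as it vanishes at n points in
   general position, here u_n = v_j - hbar. By symmetry in v one may take j = n,
   where the recursion (3) and induction apply: for the partition function
   it holds because the weight theta (u_n - v_n + hbar) vanishes and freezes the
   last row and the last column. The symmetry of the partition function in v
   follows from the star-triangle relation, i.e. from the three-term identity for
   theta, which is proved by the same interpolation argument. Points v that are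
   not generic are reached as limits along v + t (0, 1, ..., n - 1). *)

Require Import Defs.
From HB Require Import structures.
From mathcomp Require Import all_boot all_order all_algebra all_fingroup.
From mathcomp Require Import all_classical all_reals all_analysis.
From mathcomp Require Import complex ring lra zify.

Set Implicit Arguments.
Unset Strict Implicit.
Unset Printing Implicit Defensive.

Import Order.TTheory GRing.Theory Num.Theory.
Import numFieldNormedType.Exports.

Local Open Scope classical_set_scope.
Local Open Scope ring_scope.
Local Open Scope complex_scope.

(** * Primitives and Goursat's theorem *)

(** General position of the points [v_j - hbar] means two things: the [v_j] are distinct modulo the
    lattice, and [theta (lambda + n * hbar)] is nonzero, since [lambda + n * hbar] is what remains
    of the sum of zeros prescribed by the character once the points are subtracted. The latter is
    one of the nonvanishing denominators. The former is useful only once the zeros of theta are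
    known to be lattice points, and this is proved without counting zeros: a doubling argument
    excludes vanishing on a disc, and a comparison of Fourier coefficients excludes zeros off the
    lattice. Holomorphic means only complex differentiable, so Fourier expansion rests on Goursat's
    theorem (the mean over a period does not depend on the segment chosen) and on a uniqueness
    argument in the style of Fejer; integrals are handled as increments of primitives. On the
    combinatorial side, heights relative to the upper left face are integers between 0 and 2n.
    Configurations thus become paths in a finite set, and the partition function an entry of a
    product of transfer matrices. *)

Lemma eq_of_is_derive (R : realType) (f g df : R -> R) (a b : R) :
  (forall x, Num.min a b <= x <= Num.max a b -> is_derive x 1 f (df x)) ->
  (forall x, Num.min a b <= x <= Num.max a b -> is_derive x 1 g (df x)) ->
  f b - f a = g b - g a.
Proof.
wlog ab : a b / a <= b => [H|].
  case/orP: (le_total a b) => [/H//|ba] hf hg.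
  suff: f a - f b = g a - g b by lra.
  by apply: H => [|x|x]; [by []|rewrite minC maxC; exact: hf|rewrite minC maxC; exact: hg].
rewrite min_l// max_r// => hf hg.
have hd x : a <= x <= b -> is_derive x 1 (f - g) 0.
  by move=> xab; have := is_deriveB (hf x xab) (hg x xab); rewrite subrr.
have [] := @MVT_segment R (f - g) (cst 0) a b ab.
- by move=> x; rewrite in_itv/= => /andP[/ltW ? /ltW ?]; apply: hd; apply/andP.
- apply: derivable_within_continuous => x; rewrite in_itv/= => xab.
  by have := hd x xab => -[].
- by move=> c _; rewrite mul0r !fctE; lra.
Qed.

(** The integral over [[- n, y]] is a primitive only for [y > - n]. Normalised to vanish at 0, these
    primitives agree wherever two of them are available, so a global one is obtained by letting the
    index grow with [|x|]. *)
Lemma continuous_primitive (R : realType) (f : R -> R) : continuous f ->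
  exists F : R -> R, forall x : R, is_derive x 1 F (f x).
Proof.
move=> cf; pose I (n : nat) (y : R) := Rintegral (@lebesgue_measure R) `[- n%:R, y] f.
pose F n (y : R) := I n y - I n 0.
have dF n (y : R) : - n%:R < y -> is_derive y 1 (F n) (f y).
  move=> ny; rewrite -(subr0 (f y)); apply: is_deriveB.
  have yy : y < y + 1 by rewrite ltrDl.
  have itg : (@lebesgue_measure R).-integrable `[- n%:R, y + 1] (EFin \o f).
    apply: continuous_compact_integrable; first exact: segment_compact.
    exact: continuous_subspaceT.
  have [d e] : derivable (I n) y 1 /\ derive1 (I n) y = f y.
    exact: (continuous_FTC1_closed yy itg ny (cf y)).
  split; first exact: d.
  by rewrite -e; exact/esym/derive1E.
have F0 n : F n 0 = 0 by rewrite /F subrr.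
have FE m n (y : R) : - m.+1%:R < y -> - n.+1%:R < y -> F m.+1 y = F n.+1 y.
  move=> my ny.
  have := @eq_of_is_derive R (F m.+1) (F n.+1) f 0 y; rewrite !F0 !subr0; apply.
  - move=> x /andP[xy _]; apply: dF; apply: lt_le_trans xy.
    by rewrite lt_min my oppr_lt0 ltr0n.
  - move=> x /andP[xy _]; apply: dF; apply: lt_le_trans xy.
    by rewrite lt_min ny oppr_lt0 ltr0n.
pose k (x : R) := (Num.truncn `|x|).+1.
have kx x : - (k x).+1%:R < x - 1.
  have := truncnS_gt `|x|; rewrite -/(k x) => h.
  have := ler_norm (- x); rewrite normrN -natr1; lra.
exists (fun x => F (k x).+1 x) => x.
apply: (@near_eq_is_derive _ _ _ (F (k x).+1)); last first.
  by apply: dF; have := kx x; lra.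
near=> y; apply: FE; last by have := kx y; lra.
have : x - 1 < y by near: y; apply: lt_nbhsr; lra.
by have := kx x; lra.
Unshelve. all: by end_near.
Qed.

(** Mean value inequality for [F - G]; it plays the part of the usual estimate for the integral of
    [f - g]. *)
Lemma primitive_diff_le (R : realType) (F G f g : R -> R) (a b M : R) :
  a <= b ->
  (forall x, a <= x <= b -> is_derive x 1 F (f x)) ->
  (forall x, a <= x <= b -> is_derive x 1 G (g x)) ->
  (forall x, a <= x <= b -> `|f x - g x| <= M) ->
  `|(F b - F a) - (G b - G a)| <= M * (b - a).
Proof.
move=> ab hF hG fgM.
have hd x : a <= x <= b -> is_derive x 1 (F - G) (f x - g x).
  by move=> xab; have := is_deriveB (hF x xab) (hG x xab).
have [] := @MVT_segment R (F - G) (f - g) a b ab.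
- by move=> x; rewrite in_itv/= => /andP[/ltW ? /ltW ?]; apply: hd; apply/andP.
- apply: derivable_within_continuous => x; rewrite in_itv/= => xab.
  by have := hd x xab => -[].
- move=> c; rewrite in_itv/= => cab; rewrite !fctE => e.
  have -> : F b - F a - (G b - G a) = (f c - g c) * (b - a) by rewrite -e; ring.
  by rewrite normrM (ger0_norm (x := b - a)) ?subr_ge0// ler_wpM2r ?subr_ge0// fgM.
Qed.

Section Goursat.
Variable R : realType.
Variables P Q A B : R -> R -> R.
Hypothesis hA : forall x y : R, is_derive x 1 (A ^~ y) (P x y).
Hypothesis hB : forall x y : R, is_derive y 1 (B x) (Q x y).
(* The field (P, Q) is differentiable with a symmetric Jacobian matrix. *)
Hypothesis hPQ : forall x0 y0 : R, exists b c d : R, forall e, 0 < e ->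
  exists2 eta : R, 0 < eta & forall x y, `|x - x0| <= eta -> `|y - y0| <= eta ->
    `|P x y - (P x0 y0 + b * (x - x0) + c * (y - y0))|
        <= e * (`|x - x0| + `|y - y0|) /\
    `|Q x y - (Q x0 y0 + c * (x - x0) + d * (y - y0))|
        <= e * (`|x - x0| + `|y - y0|).

(** The integral of [P dx + Q dy] counterclockwise around the rectangle, with increments of the
    primitives [A] and [B] in place of integrals along the sides. *)
Definition circulation x1 x2 y1 y2 :=
  (A x2 y1 - A x1 y1) + (B x2 y2 - B x2 y1)
  - (A x2 y2 - A x1 y2) - (B x1 y2 - B x1 y1).
Local Notation J := circulation.

(** The affine part of the field has the explicit quadratic primitives [GA] and [GB], and its
    circulation is 0 because the Jacobian is symmetric. The remainder is at most [e * (w + k)] on a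
    boundary of length [2 * (w + k)]. *)
Lemma circulation_local x0 y0 e : 0 < e -> exists2 eta : R, 0 < eta &
  forall x1 x2 y1 y2, x1 <= x0 <= x2 -> y1 <= y0 <= y2 ->
    x2 - x1 <= eta -> y2 - y1 <= eta ->
    `|J x1 x2 y1 y2| <= 2 * e * ((x2 - x1) + (y2 - y1)) ^+ 2.
Proof.
move=> e0; have [b [c [d /(_ e e0)[eta eta0 h]]]] := hPQ x0 y0.
exists eta => // x1 x2 y1 y2 /andP[x10 x02] /andP[y10 y02] wx wy.
pose GA y x := P x0 y0 * (x - x0) + b * (x - x0) ^+ 2 / 2 + c * (x - x0) * (y - y0).
pose GB x y := Q x0 y0 * (y - y0) + c * (x - x0) * (y - y0) + d * (y - y0) ^+ 2 / 2.
have dGA (y x : R) : is_derive x 1 (GA y) (P x0 y0 + b * (x - x0) + c * (y - y0)).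
  by rewrite /GA; apply: is_derive_eq; rewrite /GRing.scale/=; field.
have dGB (x y : R) : is_derive y 1 (GB x) (Q x0 y0 + c * (x - x0) + d * (y - y0)).
  by rewrite /GB; apply: is_derive_eq; rewrite /GRing.scale/=; field.
set w := x2 - x1; set k := y2 - y1.
have bnd x y : x1 <= x <= x2 -> y1 <= y <= y2 ->
    [/\ `|x - x0| <= eta, `|y - y0| <= eta & `|x - x0| + `|y - y0| <= w + k].
  move=> /andP[? ?] /andP[? ?].
  have hx : `|x - x0| <= w by rewrite ler_norml /w; lra.
  have hy : `|y - y0| <= k by rewrite ler_norml /k; lra.
  by split; [exact: le_trans wx|exact: le_trans wy|exact: lerD].
have e1 x y : x1 <= x <= x2 -> y1 <= y <= y2 ->
    `|P x y - (P x0 y0 + b * (x - x0) + c * (y - y0))| <= e * (w + k).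
  move=> hx hy; have [a1 a2 a3] := bnd x y hx hy; have [le1 _] := h x y a1 a2.
  by apply: (le_trans le1); rewrite ler_pM2l.
have e2 x y : x1 <= x <= x2 -> y1 <= y <= y2 ->
    `|Q x y - (Q x0 y0 + c * (x - x0) + d * (y - y0))| <= e * (w + k).
  move=> hx hy; have [a1 a2 a3] := bnd x y hx hy; have [_ le1] := h x y a1 a2.
  by apply: (le_trans le1); rewrite ler_pM2l.
have x12 : x1 <= x2 by lra.
have y12 : y1 <= y2 by lra.
have HA y : y1 <= y <= y2 ->
    `|(A x2 y - A x1 y) - (GA y x2 - GA y x1)| <= e * (w + k) * w.
  move=> hy; apply: (primitive_diff_le x12 (f := P ^~ y)) => x hx //.
  exact: e1.
have HB x : x1 <= x <= x2 ->
    `|(B x y2 - B x y1) - (GB x y2 - GB x y1)| <= e * (w + k) * k.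
  move=> hx; apply: (primitive_diff_le y12 (f := Q x)) => y hy //.
  exact: e2.
have GJ : (GA y1 x2 - GA y1 x1) + (GB x2 y2 - GB x2 y1)
  - (GA y2 x2 - GA y2 x1) - (GB x1 y2 - GB x1 y1) = 0.
  by rewrite /GA /GB; field.
have r1 : y1 <= y1 <= y2 by lra.
have r2 : y1 <= y2 <= y2 by lra.
have r3 : x1 <= x1 <= x2 by lra.
have r4 : x1 <= x2 <= x2 by lra.
move: (HA _ r1) (HA _ r2) (HB _ r3) (HB _ r4); rewrite /J.
have -> : 2 * e * (w + k) ^+ 2 = (e * (w + k) * w) *+ 2 + (e * (w + k) * k) *+ 2.
  by ring.
set a := e * _ * w; set a' := e * _ * k.
move: GJ; move: (GA y1 x2) (GA y1 x1) (GA y2 x2) (GA y2 x1) (GB x2 y2) (GB x2 y1) (GB x1 y2) (GB x1 y1).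
by move=> > ?; rewrite !ler_norml; lra.
Qed.

Lemma circulation_split x1 x2 x3 y1 y2 y3 :
  J x1 x3 y1 y3 = J x1 x2 y1 y2 + J x2 x3 y1 y2 + (J x1 x2 y2 y3 + J x2 x3 y2 y3).
Proof. by rewrite /J; ring. Qed.

(* Goursat's argument: some quarter of the rectangle carries at least a quarter
   of the circulation, whereas near the limit point of the nested rectangles the
   circulation is negligible compared with the area. *)
Lemma circulation_eq0 x1 x2 y1 y2 : x1 <= x2 -> y1 <= y2 -> J x1 x2 y1 y2 = 0.
Proof.
move=> x12 y12; apply/eqP/negPn/negP => J0.
set w := x2 - x1; set k := y2 - y1.
have w0 : 0 <= w by rewrite subr_ge0.
have k0 : 0 <= k by rewrite subr_ge0.
pose W n := w / 2 ^+ n; pose K n := k / 2 ^+ n.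
have Wh n : W n = W n.+1 + W n.+1 by rewrite /W exprS; field; rewrite expf_neq0//; lra.
have Kh n : K n = K n.+1 + K n.+1 by rewrite /K exprS; field; rewrite expf_neq0//; lra.
have W0 n : 0 <= W n by rewrite divr_ge0 ?exprn_ge0.
have K0 n : 0 <= K n by rewrite divr_ge0 ?exprn_ge0.
pose S n x y := J x (x + W n) y (y + K n).
have step (t : nat * (R * R)) : exists q : R * R,
    [/\ q.1 = t.2.1 \/ q.1 = t.2.1 + W t.1.+1,
        q.2 = t.2.2 \/ q.2 = t.2.2 + K t.1.+1 &
        `|S t.1 t.2.1 t.2.2| <= 4 * `|S t.1.+1 q.1 q.2|].
  case: t => n [x y] /=; set a := W n.+1; set b := K n.+1.
  have e : S n x y = S n.+1 x y + S n.+1 (x + a) y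
                   + (S n.+1 x (y + b) + S n.+1 (x + a) (y + b)).
    by rewrite /S (Wh n) (Kh n) (addrA x) (addrA y); exact: circulation_split.
  have : `|S n x y| <= `|S n.+1 x y| + `|S n.+1 (x + a) y|
                     + (`|S n.+1 x (y + b)| + `|S n.+1 (x + a) (y + b)|).
    rewrite e; apply: (le_trans (ler_normD _ _)).
    by apply: lerD; exact: ler_normD.
  set s := `|S n x y| => hs.
  have [h1|h1] := leP s (4 * `|S n.+1 x y|); first by exists (x, y); split; auto.
  have [h2|h2] := leP s (4 * `|S n.+1 (x + a) y|).
    by exists (x + a, y); split; auto.
  have [h3|h3] := leP s (4 * `|S n.+1 x (y + b)|).
    by exists (x, y + b); split; auto.
  by exists (x + a, y + b); split; auto; lra.
have [g gP] := choice step.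
pose s := fix s n := if n is m.+1 then g (m, s m) else (x1, y1).
have sS n : s n.+1 = g (n, s n) by [].
have sJ n : `|J x1 x2 y1 y2| <= 4 ^+ n * `|S n (s n).1 (s n).2|.
  elim: n => [|n IH].
    rewrite mul1r /S /W /K /= !divr1 /w /k.
    by rewrite [x1 + _]addrC [y1 + _]addrC !subrK.
  apply: (le_trans IH); rewrite exprSr -mulrA ler_wpM2l ?exprn_ge0//.
  by rewrite sS; have [_ _] := gP (n, s n).
(* Nested intervals: the common point is the supremum of the left endpoints. It is used once for
   each coordinate. *)
have loc (u : nat -> R) (L : nat -> R) : (forall n, 0 <= L n) ->
    (forall n, L n = L n.+1 + L n.+1) ->
    (forall n, u n.+1 = u n \/ u n.+1 = u n + L n.+1) ->
    exists z, forall n, u n <= z <= u n + L n.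
  move=> L0 Lh uS.
  have up m n : u n <= u (m + n)%N /\ u (m + n)%N + L (m + n)%N <= u n + L n.
    elim: m => [//|m [i1 i2]]; rewrite addSn.
    have := L0 (m + n).+1; have := Lh (m + n)%N.
    by case: (uS (m + n)%N) => ->; split; lra.
  have ub n : ubound (range u) (u n + L n).
    move=> _ [m _ <-]; case: (leqP m n) => mn.
      have [+ _] := up (n - m)%N m; rewrite subnK// => um.
      by apply: (le_trans um); rewrite lerDl.
    have [_ +] := up (m - n)%N n; rewrite subnK; last exact: ltnW.
    by move=> um; apply: le_trans um; rewrite lerDl.
  exists (sup (range u)) => n; apply/andP; split.
    by apply: ub_le_sup; [exists (u 0%N + L 0%N)|exists n].
  by apply: ge_sup; [exists (u 0%N), 0%N|].
have [z1 hz1] : exists z, forall n, (s n).1 <= z <= (s n).1 + W n.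
  by apply: loc => // n; rewrite sS; have [] := gP (n, s n).
have [z2 hz2] : exists z, forall n, (s n).2 <= z <= (s n).2 + K n.
  by apply: loc => // n; rewrite sS; have [] := gP (n, s n).
set D := `|J x1 x2 y1 y2|.
have D0 : 0 < D by rewrite normr_gt0.
(* Chosen so that [2 * e * (w + k) ^+ 2 < D]; the summand 1 covers a rectangle reduced to a
   point. *)
pose e := D / (4 * ((w + k) ^+ 2 + 1)).
have q0 : 0 < (w + k) ^+ 2 + 1 by rewrite ltr_wpDl ?sqr_ge0.
have e0 : 0 < e by rewrite divr_gt0// mulr_gt0.
have [eta eta0 heta] := circulation_local z1 z2 e0.
have [n hn] : exists n, (w + k) / 2 ^+ n <= eta.
  exists (Num.truncn ((w + k) / eta)).+1.
  rewrite ler_pdivrMr ?exprn_gt0// mulrC -ler_pdivrMr//.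
  apply: (le_trans (ltW (truncnS_gt _))).
  by rewrite -natrX ler_nat; exact/ltnW/ltn_expl.
have WKn : W n + K n = (w + k) / 2 ^+ n by rewrite /W /K (mulrDl w k).
have := heta (s n).1 ((s n).1 + W n) (s n).2 ((s n).2 + K n) (hz1 n) (hz2 n).
have -> x y : x + y - x = y :> R by ring.
have -> x y : x + y - x = y :> R by ring.
have Wn := W0 n; have Kn := K0 n.
have l1 : W n <= eta by rewrite -WKn in hn; lra.
have l2 : K n <= eta by rewrite -WKn in hn; lra.
move=> /(_ l1 l2); rewrite -/(S _ _ _) WKn => hS.
have := sJ n; rewrite -/D => hD.
have : D <= 4 ^+ n * (2 * e * ((w + k) / 2 ^+ n) ^+ 2).
  by apply: (le_trans hD); rewrite ler_wpM2l// exprn_ge0.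
have -> : 4 ^+ n * (2 * e * ((w + k) / 2 ^+ n) ^+ 2) = 2 * e * (w + k) ^+ 2.
  have -> : 4 ^+ n = (2 ^+ n) ^+ 2 :> R by rewrite -exprM mulnC exprM; congr (_ ^+ _); ring.
  by field; rewrite expf_neq0//; lra.
have : e * (4 * ((w + k) ^+ 2 + 1)) = D by rewrite /e; field; lra.
by nra.
Qed.

End Goursat.

(** * Holomorphic functions and their Fourier coefficients *)

Section Holomorphic.
Variable R : realType.
Implicit Types (f g : R[i] -> R[i]) (z w c : R[i]).

(** Positive elements of [R[i]] are real, so the radii can be taken in [R]; multiplying the
    difference quotient by [h] gives a form that also holds at [h = 0]. *)
Lemma holoP f z : derivable (f : R[i]^o -> R[i]^o) z 1 ->
  exists l : R[i], forall e : R, 0 < e -> exists2 d : R, 0 < d &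
  forall h, `|h| < d%:C -> `|f (h + z) - f z - l * h| <= e%:C * `|h|.
Proof.
move=> /cvg_ex[l /cvgrPdist_le hl]; exists l => e e0.
have e0' : (0 : R[i]) < e%:C by rewrite ltcR.
have [d /= d0 hd] := hl _ e0'.
have dE : d = (complex.Re d)%:C.
  by case: d d0 {hd} => a b; rewrite ltcE/= => /andP[/eqP->].
exists (complex.Re d); first by rewrite dE ltcR in d0.
move=> h; rewrite -dE => hdlt.
have [->|h0] := eqVneq h 0; first by rewrite add0r mulr0 !subrr normr0 mulr0.
have := hd h; rewrite /ball_/= sub0r normrN => /(_ hdlt h0).
rewrite /GRing.scale/= mulr1 => le1.
have -> : f (h + z) - f z - l * h = - ((l - h^-1 * (f (h + z) - f z)) * h).
  by field.
by rewrite normrN normrM ler_pM2r// normr_gt0.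
Qed.

Lemma holo_derivable f z l : (forall e : R, 0 < e -> exists2 d : R, 0 < d &
  forall h, `|h| < d%:C -> `|f (h + z) - f z - l * h| <= e%:C * `|h|) ->
  derivable (f : R[i]^o -> R[i]^o) z 1.
Proof.
move=> hf; apply/cvg_ex; exists l; apply/cvgrPdist_le => e e0.
have eE : e = (complex.Re e)%:C.
  by case: e e0 => a b; rewrite ltcE/= => /andP[/eqP->].
rewrite eE ltcR in e0; have [d d0 hd] := hf _ e0.
exists d%:C => /=; first by rewrite ltcR.
move=> h; rewrite /ball_/= sub0r normrN => hdlt h0.
rewrite /GRing.scale/= mulr1 eE -(ler_pM2r (x := `|h|)) ?normr_gt0// -normrM.
have -> : (l - h^-1 * (f (h + z) - f z)) * h = - (f (h + z) - f z - l * h).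
  by field.
by rewrite normrN hd.
Qed.

Lemma holo_cst c : holomorphic (fun=> c).
Proof. by move=> z; exact: derivable_cst. Qed.

Lemma holoD f g : holomorphic f -> holomorphic g ->
  holomorphic (fun z => f z + g z).
Proof. by move=> hf hg z; exact: (derivableD (hf z) (hg z)). Qed.

Lemma holoM f g : holomorphic f -> holomorphic g ->
  holomorphic (fun z => f z * g z).
Proof. by move=> hf hg z; exact: (derivableM (hf z) (hg z)). Qed.

Lemma holo_sum (I : Type) (r : seq I) (F : I -> R[i] -> R[i]) :
  (forall i, holomorphic (F i)) -> holomorphic (fun z => \sum_(i <- r) F i z).
Proof.
move=> hF; elim: r => [|i r IH].
  by rewrite (_ : (fun _ => _) = fun=> 0); [exact: holo_cst|apply/funext => z; rewrite big_nil].
rewrite (_ : (fun _ => _) = fun z => F i z + \sum_(j <- r) F j z); first exact: (holoD (hF i) IH).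
by apply/funext => z; rewrite big_cons.
Qed.

Lemma holo_prod (I : Type) (r : seq I) (F : I -> R[i] -> R[i]) :
  (forall i, holomorphic (F i)) -> holomorphic (fun z => \prod_(i <- r) F i z).
Proof.
move=> hF; elim: r => [|i r IH].
  by rewrite (_ : (fun _ => _) = fun=> 1); [exact: holo_cst|apply/funext => z; rewrite big_nil].
rewrite (_ : (fun _ => _) = fun z => F i z * \prod_(j <- r) F j z); first exact: (holoM (hF i) IH).
by apply/funext => z; rewrite big_cons.
Qed.

Lemma derivable_shift f c z :
  derivable (f : R[i]^o -> R[i]^o) (z + c) 1 ->
  derivable ((fun z => f (z + c)) : R[i]^o -> R[i]^o) z 1.
Proof.
move=> hf; rewrite /derivable.
rewrite (_ : (fun h => _) = fun h : R[i]^o => h^-1 *: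
  ((((f : R[i]^o -> R[i]^o) \o shift (z + c)) (h *: (1 : R[i]^o))) - f (z + c)))//.
by apply/funext => h /=; rewrite addrA.
Qed.

Lemma holo_shift f c : holomorphic f -> holomorphic (fun z => f (z + c)).
Proof. by move=> hf z; exact: derivable_shift. Qed.

Lemma ler_normc_Re z : `|complex.Re z|%:C <= `|z|.
Proof. exact: normc_ge_Re. Qed.

Lemma ler_normc_Im z : `|complex.Im z|%:C <= `|z|.
Proof.
have := ler_normc_Re (z * 'i%C); rewrite normrM.
have -> : complex.Re (z * 'i%C) = - complex.Im z by case: z => a b /=; ring.
have -> : `|'i%C : R[i]| = 1.
  by rewrite normc_def /= expr0n/= add0r expr1n sqrtr1.
by rewrite normrN mulr1.
Qed.

Lemma ler_normc_sum z : `|z| <= (`|complex.Re z| + `|complex.Im z|)%:C.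
Proof.
case: z => a b /=; rewrite normc_def lecR /=.
rewrite -(ler_pXn2r (n := 2))// ?nnegrE ?sqrtr_ge0 ?addr_ge0//.
rewrite sqr_sqrtr ?addr_ge0 ?sqr_ge0// sqrrD !real_normK ?num_real//.
by rewrite lerD2r lerDl mulrn_wge0// mulr_ge0.
Qed.

(** The Cauchy-Riemann equations: if the derivative is [a +i* b], the Jacobian of the real and
    imaginary parts has rows [(a, - b)] and [(b, a)]. The form is the one required of the field in
    Goursat's theorem. *)
Lemma holo_real f : holomorphic f -> forall x0 y0 : R, exists a b : R,
  forall e, 0 < e -> exists2 eta : R, 0 < eta & forall x y,
    `|x - x0| <= eta -> `|y - y0| <= eta ->
    `|complex.Re (f (x +i* y)) - (complex.Re (f (x0 +i* y0)) + a * (x - x0) - b * (y - y0))|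
       <= e * (`|x - x0| + `|y - y0|) /\
    `|complex.Im (f (x +i* y)) - (complex.Im (f (x0 +i* y0)) + b * (x - x0) + a * (y - y0))|
       <= e * (`|x - x0| + `|y - y0|).
Proof.
move=> hf x0 y0; have [[a b] hl] := holoP (hf (x0 +i* y0)).
exists a, b => e e0; have [d d0 hd] := hl e e0.
exists (d / 4); first by rewrite divr_gt0.
move=> x y hx hy; pose h : R[i] := (x - x0) +i* (y - y0).
have hh : `|h| < d%:C.
  by apply: (le_lt_trans (ler_normc_sum _)); rewrite ltcR /=; lra.
have := hd h hh.
have -> : h + x0 +i* y0 = x +i* y by rewrite /h; simpc; congr (_ +i* _); ring.
set E := _ - _ - _ => hE.
have {}hE : `|E| <= (e * (`|x - x0| + `|y - y0|))%:C.
  apply: (le_trans hE); rewrite rmorphM; apply: ler_wpM2l.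
    by rewrite lecR ltW.
  exact: (ler_normc_sum h).
have := le_trans (ler_normc_Re E) hE; have := le_trans (ler_normc_Im E) hE.
rewrite !lecR /E /h; case: (f (x +i* y)) => p q; case: (f (x0 +i* y0)) => p0 q0.
simpc => /= h1 h2; split.
  apply: le_trans h2; rewrite le_eqVlt; apply/orP; left; apply/eqP.
  by congr `|_|; ring.
apply: le_trans h1; rewrite le_eqVlt; apply/orP; left; apply/eqP.
by congr `|_|; ring.
Qed.

End Holomorphic.

(** * The complex exponential *)

Section ComplexExponential.
Variable R : realType.
Implicit Types (f : R[i] -> R[i]) (z w c : R[i]).

Lemma cexpD z w : cexp (z + w) = cexp z * cexp w.
Proof.
case: z => a b; case: w => c d; rewrite /cexp /= expRD cosD sinD.
by apply/eqP; rewrite eq_complex /=; apply/andP; split; apply/eqP; ring.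
Qed.

Lemma cexp0 : cexp (0 : R[i]) = 1.
Proof. by rewrite /cexp /= expR0 cos0 sin0 mul1r. Qed.

Lemma cexp_neq0 z : cexp z != 0.
Proof.
apply/eqP => h; have := cexpD z (- z); rewrite h mul0r subrr cexp0.
by move/eqP; rewrite oner_eq0.
Qed.

Lemma cexpN z : cexp (- z) = (cexp z)^-1.
Proof.
by apply: (mulfI (cexp_neq0 z)); rewrite -cexpD subrr cexp0 divff// cexp_neq0.
Qed.

Lemma cexp_sum (I : Type) (r : seq I) (P : pred I) (F : I -> R[i]) :
  cexp (\sum_(i <- r | P i) F i) = \prod_(i <- r | P i) cexp (F i).
Proof.
by apply: (big_morph (fun z => cexp z)); [exact: cexpD|exact: cexp0].
Qed.

Lemma is_derive_approx (g : R -> R) (l : R) : is_derive (0 : R) 1 g l ->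
  forall e : R, 0 < e -> exists2 d : R, 0 < d &
  forall x, `|x| < d -> `|g x - g 0 - l * x| <= e * `|x|.
Proof.
move=> [/cvg_ex[l' hl'] ll'] e e0.
have El : l' = l.
  by rewrite -ll'; apply/esym/cvg_lim => //; exact: Rhausdorff.
move: hl'; rewrite El => /cvgrPdist_le /(_ e e0)[d /= d0 hd].
exists d => // x xd.
have [->|x0] := eqVneq x 0; first by rewrite mulr0 !subrr normr0 mulr0.
have := hd x; rewrite /ball_/= sub0r normrN => /(_ xd x0).
rewrite /GRing.scale/= mulr1 addr0 => le1.
have -> : g x - g 0 - l * x = - ((l - x^-1 * (g x - g 0)) * x) by field.
by rewrite normrN normrM ler_pM2r// normr_gt0.
Qed.

Lemma cexp_approx (e : R) : 0 < e -> exists2 d : R, 0 < d &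
  forall h : R[i], `|h| < d%:C -> `|cexp h - 1 - h| <= e%:C * `|h|.
Proof.
move=> e0; pose e' := Num.min e 1 / 16.
have m0 : 0 < Num.min e 1 by rewrite lt_min e0 ltr01.
have e'0 : 0 < e' by rewrite divr_gt0.
have e'1 : e' <= 1 / 16 by rewrite /e' ler_pM2r ?ge_min ?lexx ?orbT// invr_gt0.
have e'e : 16 * e' <= e.
  by rewrite /e' mulrC mulfVK ?ge_min ?lexx//; lra.
have [d1 d10 h1] := is_derive_approx (is_derive_expR 0) e'0.
have [d2 d20 h2] := is_derive_approx (is_derive_cos 0) e'0.
have [d3 d30 h3] := is_derive_approx (is_derive_sin 0) e'0.
exists (Num.min (Num.min d1 e') (Num.min d2 d3)).
  by rewrite !lt_min d10 e'0 d20.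
case=> x y hlt.
have lex : `|x| <= complex.Re `|x +i* y|.
  by have := ler_normc_Re (x +i* y); rewrite normc_def lecR.
have ley : `|y| <= complex.Re `|x +i* y|.
  by have := ler_normc_Im (x +i* y); rewrite normc_def lecR.
have hE : `|x +i* y| = (complex.Re `|x +i* y|)%:C by rewrite normc_def.
move: hlt; rewrite hE ltcR; set r := complex.Re _ in lex ley *.
rewrite !lt_min => /andP[/andP[r1 r2] /andP[r3 r4]].
have := h1 x (le_lt_trans lex r1); rewrite expR0 mul1r.
have := h2 y (le_lt_trans ley r3); rewrite cos0 sin0 oppr0 mul0r subr0.
have := h3 y (le_lt_trans ley r4); rewrite sin0 cos0 mul1r subr0.
have c1 := cos_le1 y; have c2 := cos_geN1 y.
rewrite -rmorphM/=.
have -> : cexp (x +i* y) - 1 - x +i* y =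
  (expR x * cos y - 1 - x) +i* (expR x * sin y - y).
  by rewrite /cexp /=; simpc.
move=> hs hc hx; apply: (le_trans (ler_normc_sum _)); rewrite lecR /=.
have xr : `|x| < e' by exact: le_lt_trans r2.
have x0 := normr_ge0 x; have y0 := normr_ge0 y.
have B1 : `|(expR x - 1 - x) * cos y| <= e' * `|x|.
  rewrite normrM; apply: le_trans hx.
  by rewrite ler_piMr// ler_norml c1 c2.
have B2 : `|x * (cos y - 1)| <= e' * `|y|.
  rewrite normrM; apply: le_trans hc.
  by rewrite ler_piMl//; lra.
have B3 : `|expR x - 1| <= 2 * `|x|.
  have : `|expR x - 1| <= `|expR x - 1 - x| + `|x|.
    by apply: le_trans (ler_normD _ _); rewrite subrK.
  by nra.
have B4 : `|sin y| <= 2 * `|y|.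
  have : `|sin y| <= `|sin y - y| + `|y|.
    by apply: le_trans (ler_normD _ _); rewrite subrK.
  by nra.
have B5 : `|(expR x - 1) * sin y| <= 4 * e' * `|y|.
  rewrite normrM; apply: (le_trans (ler_pM _ _ B3 B4)) => //.
  by nra.
have -> : expR x * cos y - 1 - x
  = (expR x - 1 - x) * cos y + x * (cos y - 1) + (cos y - 1) by ring.
have -> : expR x * sin y - y = (expR x - 1) * sin y + (sin y - y) by ring.
have T1 := ler_normD ((expR x - 1 - x) * cos y + x * (cos y - 1)) (cos y - 1).
have T2 := ler_normD ((expR x - 1 - x) * cos y) (x * (cos y - 1)).
have T3 := ler_normD ((expR x - 1) * sin y) (sin y - y).
have T4 : e' * `|x| <= e' * r by rewrite ler_pM2l.
have T5 : e' * `|y| <= e' * r by rewrite ler_pM2l.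
have T6 : 16 * e' * r <= e * r by apply: ler_wpM2r => //; exact: le_trans x0 lex.
have T7 : 0 <= e' * r by apply: mulr_ge0; [exact: ltW|exact: le_trans x0 lex].
by lra.
Qed.

Lemma normc_real z : z != 0 -> exists2 r : R, 0 < r & `|z| = r%:C.
Proof.
move=> z0; exists (complex.Re `|z|); last by rewrite normc_def.
by move: z0; rewrite -normr_gt0 normc_def ltcR.
Qed.

Lemma holo_cexp : holomorphic (@cexp R).
Proof.
move=> z; apply: (holo_derivable (l := cexp z)) => e e0.
have [r r0 nE] := normc_real (cexp_neq0 z).
have [d d0 hd] := cexp_approx (divr_gt0 e0 r0).
exists d => // h /hd; rewrite cexpD => le1.
have -> : cexp h * cexp z - cexp z - cexp z * h = cexp z * (cexp h - 1 - h) by ring.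
rewrite normrM; apply: (le_trans (ler_wpM2l (normr_ge0 _) le1)).
by rewrite nE mulrA -rmorphM/= (mulrC r) divfK// gt_eqF.
Qed.

Lemma holo_scale f c : holomorphic f -> holomorphic (fun z => f (c * z)).
Proof.
move=> hf z; have [->|c0] := eqVneq c 0.
  rewrite (_ : (fun _ => _) = fun=> f 0); first exact: derivable_cst.
  by apply/funext => w; rewrite mul0r.
have [r r0 nE] := normc_real c0.
have [l hl] := holoP (hf (c * z)).
apply: (holo_derivable (l := l * c)) => e e0.
have [d d0 hd] := hl _ (divr_gt0 e0 r0).
exists (d / r); first exact: divr_gt0.
move=> h hh; have := hd (c * h); rewrite normrM nE.
have -> : r%:C * `|h| < d%:C.
  rewrite -[d](divfK (lt0r_neq0 r0)) mulrC rmorphM /=.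
  by rewrite ltr_pM2r// ltcR.
move=> /(_ isT); rewrite -mulrDr -mulrA => le1; apply: (le_trans le1).
by rewrite mulrA -rmorphM/= divfK// gt_eqF.
Qed.

Lemma holo_cexp_lin (a b : R[i]) : holomorphic (fun z => cexp (a * z + b)).
Proof. by apply: (@holo_scale (fun z => cexp (z + b))); exact/holo_shift/holo_cexp. Qed.

End ComplexExponential.

(** * Means over a period *)

Lemma line_integral_primitive (R : realType) (F f : R -> R) : continuous f ->
  (forall x : R, is_derive x 1 F (f x)) ->
  Rintegral (@lebesgue_measure R) `[0, 1] f = F 1 - F 0.
Proof.
move=> cf dF; rewrite /Rintegral (@continuous_FTC2 R f F 0 1)//.
- exact: continuous_subspaceT.
- split; first by move=> x _; have := dF x => -[].
    apply: cvg_at_right_filter; apply: differentiable_continuous.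
    by apply/derivable1_diffP; have := dF 0 => -[].
  apply: cvg_at_left_filter; apply: differentiable_continuous.
  by apply/derivable1_diffP; have := dF 1 => -[].
- by move=> x _; rewrite derive1E; have := dF x => -[].
Qed.

Lemma is_derive_shift (R : realType) (F : R -> R) (s x df : R) :
  is_derive (x + s) 1 F df -> is_derive x 1 (fun x => F (x + s)) df.
Proof.
move=> [dF <-].
have E : (fun h : R => h^-1 *: (((fun x => F (x + s)) \o shift x) (h *: (1 : R)) - F (x + s)))
  = (fun h : R => h^-1 *: ((F \o shift (x + s)) (h *: (1 : R)) - F (x + s))).
  by apply/funext => h /=; rewrite addrA.
by split; rewrite /derivable /derive E.
Qed.

(** By periodicity of [Q] the two vertical sides of the rectangle over [[0, 1]] cancel, so the
    horizontal increment does not depend on [t]; periodicity of [P] then frees the starting point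
    [s]. *)
Lemma circulation_periodic (R : realType) (P Q A B : R -> R -> R)
  (hA : forall x y : R, is_derive x 1 (A ^~ y) (P x y))
  (hB : forall x y : R, is_derive y 1 (B x) (Q x y)) :
  (forall x1 x2 y1 y2, x1 <= x2 -> y1 <= y2 -> circulation A B x1 x2 y1 y2 = 0) ->
  (forall x y, P (x + 1) y = P x y) -> (forall x y, Q (x + 1) y = Q x y) ->
  forall s t, A (s + 1) t - A s t = A 1 0 - A 0 0.
Proof.
move=> J0 P1 Q1 s t.
have -> : A (s + 1) t - A s t = A 1 t - A 0 t.
  have := @eq_of_is_derive R (fun x => A (x + 1) t) (A ^~ t) (P ^~ t) 0 s.
  rewrite add0r => e; suff : A (s + 1) t - A 1 t = A s t - A 0 t by lra.
  by apply: e => // x _; rewrite -P1; apply: (is_derive_shift (F := A ^~ t)); exact: hA.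
have eB : B 1 t - B 1 0 = B 0 t - B 0 0.
  apply: (@eq_of_is_derive R (B 1) (B 0) (Q 0)) => // y _.
  by rewrite -(Q1 0 y) add0r; exact: hB.
case/orP: (le_total 0 t) => t0.
  by have := J0 0 1 0 t ler01 t0; rewrite /circulation; lra.
by have := J0 0 1 t 0 ler01 t0; rewrite /circulation; lra.
Qed.

Section PeriodMean.
Variable R : realType.
Implicit Types (f g : R[i] -> R[i]) (z w c : R[i]).

Lemma continuous_of_approx (g : R -> R) :
  (forall x0 : R, exists c : R, forall e, 0 < e -> exists2 eta : R, 0 < eta &
    forall x, `|x - x0| <= eta -> `|g x - (g x0 + c * (x - x0))| <= e * `|x - x0|) ->
  continuous g.
Proof.
move=> h x0; have [c hc] := h x0; have [eta eta0 he] := hc 1 ltr01.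
apply/cvgrPdist_le => e e0.
have q0 : 0 < `|c| + 1 by rewrite ltr_wpDl.
have near_le d : 0 < d -> \forall x \near x0, `|x0 - x| <= d.
  by move=> d0; apply/nbhs_ballP; exists d => //= y; rewrite /ball/= => /ltW.
near=> x.
have xe : `|x0 - x| <= e / (`|c| + 1).
  by near: x; apply: near_le; exact: divr_gt0.
have xeta : `|x - x0| <= eta.
  by rewrite distrC; near: x; exact: near_le.
have := he x xeta; rewrite mul1r => h1.
have -> : g x0 - g x = - ((g x - (g x0 + c * (x - x0))) + c * (x - x0)) by ring.
rewrite normrN; apply: (le_trans (ler_normD _ _)); rewrite normrM.
rewrite distrC ler_pdivlMr// in xe.
by lra.
Unshelve. all: by end_near.
Qed.

Lemma holo_continuous_lines f : holomorphic f -> forall a : R,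
  [/\ continuous (fun x : R => complex.Re (f (x +i* a))),
      continuous (fun x : R => complex.Im (f (x +i* a))),
      continuous (fun y : R => complex.Re (f (a +i* y))) &
      continuous (fun y : R => complex.Im (f (a +i* y)))].
Proof.
move=> /holo_real hf a; split; apply: continuous_of_approx => x0.
- have [b [c h]] := hf x0 a; exists b => e /h[eta eta0 he]; exists eta => // x hx.
  have [] := he x a hx; first by rewrite subrr normr0 ltW.
  by rewrite subrr mulr0 subr0 normr0 addr0.
- have [b [c h]] := hf x0 a; exists c => e /h[eta eta0 he]; exists eta => // x hx.
  have [] := he x a hx; first by rewrite subrr normr0 ltW.
  by rewrite subrr !mulr0 !addr0 normr0 addr0.
- have [b [c h]] := hf a x0; exists (- c) => e /h[eta eta0 he]; exists eta => // x hx.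
  have [] := he a x _ hx; first by rewrite subrr normr0 ltW.
  by rewrite subrr mulr0 addr0 normr0 add0r mulNr.
- have [b [c h]] := hf a x0; exists b => e /h[eta eta0 he]; exists eta => // x hx.
  have [] := he a x _ hx; first by rewrite subrr normr0 ltW.
  by rewrite subrr !mulr0 !addr0 normr0 add0r.
Qed.

(** The integral of [f] over [[0, 1]]; for a function of period 1, its Fourier coefficient of index
    0. *)
Definition mean f : R[i] :=
  Rintegral (@lebesgue_measure R) `[0, 1] (fun x => complex.Re (f x%:C)) +i*
  Rintegral (@lebesgue_measure R) `[0, 1] (fun x => complex.Im (f x%:C)).

(** Reduces linearity of [mean] to linearity of primitives. *)
Lemma meanE f (F G : R -> R) : holomorphic f ->
  (forall x : R, is_derive x 1 F (complex.Re (f x%:C))) ->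
  (forall x : R, is_derive x 1 G (complex.Im (f x%:C))) ->
  mean f = (F 1 - F 0) +i* (G 1 - G 0).
Proof.
move=> hf dF dG; have [c1 c2 _ _] := holo_continuous_lines hf 0.
by rewrite /mean (line_integral_primitive c1 dF) (line_integral_primitive c2 dG).
Qed.

Lemma real_primitives f : holomorphic f -> exists F G : R -> R,
  (forall x : R, is_derive x 1 F (complex.Re (f x%:C))) /\
  (forall x : R, is_derive x 1 G (complex.Im (f x%:C))).
Proof.
move=> hf; have [c1 c2 _ _] := holo_continuous_lines hf 0.
have [F hF] := continuous_primitive c1; have [G hG] := continuous_primitive c2.
by exists F, G.
Qed.

Lemma meanD f g : holomorphic f -> holomorphic g ->
  mean (fun z => f z + g z) = mean f + mean g.
Proof.
move=> hf hg; have [F [G [dF dG]]] := real_primitives hf.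
have [F' [G' [dF' dG']]] := real_primitives hg.
rewrite (meanE hf dF dG) (meanE hg dF' dG').
rewrite (_ : mean _ = ((F + F') 1 - (F + F') 0) +i* ((G + G') 1 - (G + G') 0)).
  by simpc; rewrite !fctE; congr (_ +i* _); ring.
apply: (@meanE _ (F + F') (G + G')).
- exact: (holoD hf hg).
- move=> x; have := is_deriveD (dF x) (dF' x).
  by case: (f _) => ? ?; case: (g _).
- move=> x; have := is_deriveD (dG x) (dG' x).
  by case: (f _) => ? ?; case: (g _).
Qed.

Lemma holoZ c f : holomorphic f -> holomorphic (fun z => c * f z).
Proof. by move=> hf; exact: (holoM (@holo_cst R c) hf). Qed.

Lemma meanZ c f : holomorphic f -> mean (fun z => c * f z) = c * mean f.
Proof.
move=> hf; have [F [G [dF dG]]] := real_primitives hf.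
rewrite (meanE hf dF dG); case: c => a b.
pose F' x := a * F x - b * G x; pose G' x := a * G x + b * F x.
have dF' (x : R) : is_derive x 1 F' (complex.Re ((a +i* b) * f x%:C)).
  have := is_deriveB (is_deriveZ a (dF x)) (is_deriveZ b (dG x)).
  by case: (f _) => p q.
have dG' (x : R) : is_derive x 1 G' (complex.Im ((a +i* b) * f x%:C)).
  have := is_deriveD (is_deriveZ a (dG x)) (is_deriveZ b (dF x)).
  by case: (f _) => p q.
have hcf : holomorphic (fun z => (a +i* b) * f z).
  exact: holoZ.
by rewrite (meanE hcf dF' dG') /F' /G'; simpc; congr (_ +i* _); ring.
Qed.

Lemma mean_sum (I : Type) (r : seq I) (F : I -> R[i] -> R[i]) :
  (forall i, holomorphic (F i)) ->
  mean (fun z => \sum_(i <- r) F i z) = \sum_(i <- r) mean (F i).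
Proof.
move=> hF; elim: r => [|i r IH].
  rewrite big_nil -[RHS](mul0r (mean (fun=> 0))) -meanZ; last exact: holo_cst.
  by congr mean; apply/funext => z; rewrite big_nil mul0r.
rewrite big_cons -IH -meanD//; last exact: holo_sum.
by congr mean; apply/funext => z; rewrite big_cons.
Qed.

(** Cauchy's theorem on a period strip. With [f = p + i q], the form [f dz] is
    [(p dx - q dy) + i (q dx + p dy)], and by the Cauchy-Riemann equations both real fields have
    symmetric Jacobians, hence no circulation. *)
Lemma mean_shift f w : holomorphic f -> (forall z, f (z + 1) = f z) ->
  mean (fun z => f (z + w)) = mean f.
Proof.
move=> hf f1; have hr := holo_real hf; have cl := holo_continuous_lines hf.
pose p x y : R := complex.Re (f (x +i* y)); pose q x y : R := complex.Im (f (x +i* y)).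
have /choice[A1 hA1] : forall y, exists F : R -> R, forall x : R, is_derive x 1 F (p x y).
  by move=> y; apply: continuous_primitive; have [] := cl y.
have /choice[A2 hA2] : forall y, exists F : R -> R, forall x : R, is_derive x 1 F (q x y).
  by move=> y; apply: continuous_primitive; have [] := cl y.
have /choice[B1 hB1] : forall x, exists F : R -> R, forall y : R, is_derive y 1 F (p x y).
  by move=> y; apply: continuous_primitive; have [] := cl y.
have /choice[B2 hB2] : forall x, exists F : R -> R, forall y : R, is_derive y 1 F (q x y).
  by move=> y; apply: continuous_primitive; have [] := cl y.
have per x y : f ((x + 1) +i* y) = f (x +i* y).
  by rewrite -[RHS]f1; congr f; simpc.
have p1 x y : p (x + 1) y = p x y by rewrite /p per.
have q1 x y : q (x + 1) y = q x y by rewrite /q per.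
have hA (x y : R) : is_derive x 1 ((fun x y => A1 y x) ^~ y) (p x y) by exact: hA1.
have hA' (x y : R) : is_derive x 1 ((fun x y => A2 y x) ^~ y) (q x y) by exact: hA2.
have hB (x y : R) : is_derive y 1 ((fun x => - B2 x) x) (- q x y) by exact: (is_deriveN (hB2 x y)).
have E1 s t : A1 t (s + 1) - A1 t s = A1 0 1 - A1 0 0.
  apply: (circulation_periodic (A := fun x y => A1 y x) hA hB) => //.
    apply: (circulation_eq0 hA hB) => x0 y0.
    have [a [b hab]] := hr x0 y0; exists a, (- b), (- a) => e /hab[eta eta0 he].
    exists eta => // x y hx hy; have [h1 h2] := he x y hx hy; split.
      by rewrite mulNr; exact: h1.
    rewrite -normrN; apply: le_trans h2; rewrite /q le_eqVlt; apply/orP; left; apply/eqP.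
    by congr `|_|; ring.
  by move=> x y; rewrite q1.
have E2 s t : A2 t (s + 1) - A2 t s = A2 0 1 - A2 0 0.
  apply: (circulation_periodic (A := fun x y => A2 y x) hA' hB1) => //.
  apply: (circulation_eq0 hA' hB1) => x0 y0.
  have [a [b hab]] := hr x0 y0; exists b, a, (- b) => e /hab[eta eta0 he].
  exists eta => // x y hx hy; have [h1 h2] := he x y hx hy; split; first exact: h2.
  by rewrite mulNr; exact: h1.
case: w => s t.
have sh x : x%:C + s +i* t = (x + s) +i* t by simpc.
rewrite (_ : mean _ = (A1 t (1 + s) - A1 t (0 + s)) +i* (A2 t (1 + s) - A2 t (0 + s))).
  rewrite add0r (addrC 1) E1 E2; apply/esym; apply: (@meanE _ (A1 0) (A2 0)) => //.
apply: (meanE (F := fun x => A1 t (x + s)) (G := fun x => A2 t (x + s))).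
- exact: holo_shift.
- by move=> x; rewrite sh; apply: (is_derive_shift (F := A1 t)); exact: hA1.
- by move=> x; rewrite sh; apply: (is_derive_shift (F := A2 t)); exact: hA2.
Qed.

End PeriodMean.

(** * Uniqueness of Fourier coefficients *)

Lemma primitive_ge (R : realType) (F f : R -> R) (a b m : R) : a <= b ->
  (forall x : R, is_derive x 1 F (f x)) -> (forall x, a <= x <= b -> m <= f x) ->
  m * (b - a) <= F b - F a.
Proof.
move=> ab dF fm; have [] := @MVT_segment R F f a b ab.
- apply: derivable_within_continuous => x _; have dFx := dF x.
  by case: dFx.
- move=> c; rewrite in_itv/= => cab ->.
  by apply: ler_wpM2r; [rewrite subr_ge0|exact: fm].
Qed.

Section Peak.
Variable R : realType.

(** This is the square of [sin (pi * x)]: a trigonometric polynomial with values in [[0, 1]] whose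
    only maximum in the period is at 1/2. *)
Definition peak (x : R) : R := (1 - cos (2 * pi * x)) / 2.

Lemma peak_ge0 x : 0 <= peak x.
Proof. by have := cos_le1 (2 * pi * x); rewrite /peak; lra. Qed.

Lemma peakE y : peak (1 / 2 + y) = (1 + cos (2 * pi * y)) / 2.
Proof.
rewrite /peak (_ : 2 * pi * (1 / 2 + y) = 2 * pi * y + pi) ?cosDpi ?opprK//.
by field.
Qed.

Lemma peak_lt y z : 0 <= y -> y < z -> z <= 1 / 2 -> peak (1 / 2 + z) < peak (1 / 2 + y).
Proof.
move=> y0 yz z1; have p0 := pi_gt0 R.
have : cos (2 * pi * z) < cos (2 * pi * y).
  by rewrite ltr_cos ?in_itv/=; nra.
by rewrite !peakE; lra.
Qed.

Lemma peak_sym y : peak (1 / 2 - y) = peak (1 / 2 + y).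
Proof. by rewrite !peakE mulrN cosN. Qed.

Lemma peak_le y z : 0 <= y -> y <= `|z| -> `|z| <= 1 / 2 ->
  peak (1 / 2 + z) <= peak (1 / 2 + y).
Proof.
move=> y0 yz z1.
have -> : peak (1 / 2 + z) = peak (1 / 2 + `|z|).
  by case: (ger0P z) => // _; rewrite peak_sym.
have [->//|ne] := eqVneq y `|z|.
by apply/ltW/peak_lt => //; rewrite lt_neqAle ne.
Qed.

(* The powers of [peak] concentrate at 1/2, as in the proof of Fejer's theorem:
   their integrals against a function positive near 1/2 cannot all vanish. *)
Lemma peak_concentration (r : R -> R) (H : nat -> R -> R) : continuous r ->
  r (1 / 2) = 1 -> (forall n (x : R), is_derive x 1 (H n) (r x * peak x ^+ n)) ->
  (forall n, H n 1 = H n 0) -> False.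
Proof.
move=> cr r1 dH H01.
have [d d0 hd] : exists2 d : R, 0 < d < 1 / 2 & forall y, `|y| <= d -> 1 / 2 <= r (1 / 2 + y).
  have /cvgrPdist_le /(_ (1 / 2)) := cr (1 / 2); rewrite r1 => /(_ _)[]; first by lra.
  move=> e /= e0 he; exists (Num.min (e / 2) (1 / 4)).
    by rewrite lt_min gt_min; apply/andP; split; [apply/andP; split|apply/orP; right]; lra.
  move=> y; rewrite le_min => /andP[y1 y2].
  have := he (1 / 2 + y); rewrite /ball_/=.
  have -> : 1 / 2 - (1 / 2 + y) = - y by ring.
  have ye : `|y| < e by lra.
  by rewrite normrN => /(_ ye); rewrite ler_norml; lra.
have [M M1 hM] : exists2 M : R, 0 <= M & forall x, 0 <= x <= 1 -> - M <= r x.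
  have [|c _ hc] := @EVT_min R r 0 1 ler01; first exact: continuous_subspaceT.
  exists `|r c| => // x x01; apply: (le_trans _ (hc x _)); last by rewrite in_itv.
  by have := ler_norm (- r c); rewrite normrN; lra.
case/andP: d0 => d0 d1.
(* [p] bounds [peak] from below within [d / 2] of 1/2, and [q] from above at distance at least [d];
   the term [p / 2] makes [q] visibly positive, so that [p / q] can be formed. *)
pose p := peak (1 / 2 + d / 2).
pose q := Num.max (peak (1 / 2 + d)) (p / 2).
have p0 : 0 < p by apply: le_lt_trans (peak_ge0 (1 / 2 + d)) _; apply: peak_lt; lra.
have q0 : 0 < q by rewrite /q lt_max; apply/orP; right; rewrite divr_gt0.
have qp : q < p.
  rewrite /q gt_max; apply/andP; split; last by lra.
  by apply: peak_lt; lra.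
(* The interval of length [d] around 1/2 contributes at least [p ^+ n / 2] per unit length, the
   parts beyond distance [d] together at least [- M * q ^+ n], the rest is nonnegative, and the
   total is 0. *)
have main n : p ^+ n * (d / 2) <= M * q ^+ n.
  have seg x y m : x <= y -> (forall z, x <= z <= y -> m <= r z * peak z ^+ n) ->
      m * (y - x) <= H n y - H n x.
    by move=> xy hm; exact: (primitive_ge xy (dH n)).
  have pn0 : 0 <= p ^+ n by rewrite exprn_ge0// ltW.
  have qn0 : 0 <= q ^+ n by rewrite exprn_ge0// ltW.
  have out z : 0 <= z <= 1 -> d <= `|z - 1 / 2| -> - (M * q ^+ n) <= r z * peak z ^+ n.
    move=> z01 zd.
    have pq : peak z ^+ n <= q ^+ n.
      apply: lerXn2r; rewrite ?nnegrE ?peak_ge0 ?(ltW q0)//.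
      rewrite le_max -[z](subrKC (1 / 2)); apply/orP; left.
      by apply: peak_le => //; [exact: ltW|rewrite ler_norml; lra].
    have pk0 : 0 <= peak z ^+ n by rewrite exprn_ge0// peak_ge0.
    have := hM z z01.
    have h1 : 0 <= M * (q ^+ n - peak z ^+ n) by rewrite mulr_ge0 ?subr_ge0.
    move=> h2; have h3 : 0 <= (r z + M) * peak z ^+ n by rewrite mulr_ge0//; lra.
    by nra.
  have mid z : `|z - 1 / 2| <= d -> 0 <= r z * peak z ^+ n.
    move=> zd; have := hd _ zd; rewrite subrKC => rz.
    by rewrite mulr_ge0 ?exprn_ge0 ?peak_ge0//; lra.
  have ctr z : `|z - 1 / 2| <= d / 2 -> p ^+ n / 2 <= r z * peak z ^+ n.
    move=> zd; have zd' : `|z - 1 / 2| <= d by apply: le_trans zd _; lra.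
    have := hd _ zd'; rewrite subrKC => rz.
    have : p ^+ n <= peak z ^+ n.
      apply: lerXn2r; rewrite ?nnegrE ?peak_ge0 ?(ltW p0)//.
      rewrite -[z in leRHS](subrKC (1 / 2)).
      have -> : peak (1 / 2 + (z - 1 / 2)) = peak (1 / 2 + `|z - 1 / 2|).
        by case: (ger0P (z - 1 / 2)) => // _; rewrite peak_sym.
      have dE : `|d / 2| = d / 2 by rewrite ger0_norm//; lra.
      by apply: peak_le; rewrite ?dE ?normr_ge0//; lra.
    by nra.
  have s1 := seg 0 (1 / 2 - d) (- (M * q ^+ n)).
  have s2 := seg (1 / 2 - d) (1 / 2 - d / 2) 0.
  have s3 := seg (1 / 2 - d / 2) (1 / 2 + d / 2) (p ^+ n / 2).
  have s4 := seg (1 / 2 + d / 2) (1 / 2 + d) 0.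
  have s5 := seg (1 / 2 + d) 1 (- (M * q ^+ n)).
  have {}s1 : - (M * q ^+ n) * (1 / 2 - d - 0) <= H n (1 / 2 - d) - H n 0.
    by apply: s1; [lra|move=> z hz; apply: out; rewrite ?ler0_norm; lra].
  have {}s2 : 0 * (1 / 2 - d / 2 - (1 / 2 - d)) <= H n (1 / 2 - d / 2) - H n (1 / 2 - d).
    by apply: s2; [lra|move=> z hz; apply: mid; rewrite ler_norml; lra].
  have {}s3 : p ^+ n / 2 * (1 / 2 + d / 2 - (1 / 2 - d / 2))
      <= H n (1 / 2 + d / 2) - H n (1 / 2 - d / 2).
    by apply: s3; [lra|move=> z hz; apply: ctr; rewrite ler_norml; lra].
  have {}s4 : 0 * (1 / 2 + d - (1 / 2 + d / 2)) <= H n (1 / 2 + d) - H n (1 / 2 + d / 2).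
    by apply: s4; [lra|move=> z hz; apply: mid; rewrite ler_norml; lra].
  have {}s5 : - (M * q ^+ n) * (1 - (1 / 2 + d)) <= H n 1 - H n (1 / 2 + d).
    by apply: s5; [lra|move=> z hz; apply: out; rewrite ?ger0_norm; lra].
  have := H01 n.
  have Mq : 0 <= M * q ^+ n by rewrite mulr_ge0.
  have Mqd : 0 <= M * q ^+ n * d by rewrite mulr_ge0// ltW.
  by move=> e; nra.
(* Since [p / q = 1 + s > 1], Bernoulli's inequality makes [(p / q) ^+ n] exceed [2 * M / d],
   against [main]. *)
pose s := p / q - 1.
have s0 : 0 < s by rewrite /s subr_gt0 ltr_pdivlMr// mul1r.
have [n hn] : exists n : nat, 2 * M / (d * s) < n%:R.
  by exists (Num.truncn (2 * M / (d * s))).+1; exact: truncnS_gt.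
have := main n; apply/negP; rewrite -ltNge.
have bern (m : nat) : 1 + m%:R * s <= (p / q) ^+ m.
  elim: m => [|m IH]; first by rewrite mul0r addr0.
  have -> : p / q = 1 + s by rewrite /s; ring.
  rewrite exprS; have -> : (1 + s) ^+ m = (p / q) ^+ m by congr (_ ^+ _); rewrite /s; ring.
  have m0 : 0 <= m%:R :> R by [].
  rewrite -natr1; have : (1 + s) * (1 + m%:R * s) <= (1 + s) * (p / q) ^+ m.
    by rewrite ler_pM2l//; lra.
  have : 0 <= m%:R * s * s by rewrite !mulr_ge0// ltW.
  by nra.
have -> : p ^+ n = (p / q) ^+ n * q ^+ n by rewrite -exprMn divfK// gt_eqF.
rewrite mulrAC ltr_pM2r ?exprn_gt0//.
rewrite ltr_pdivrMr ?mulr_gt0// in hn.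
have := bern n; have := mulr_gt0 d0 s0.
by nra.
Qed.

End Peak.

Section Fourier.
Variable R : realType.
Implicit Types (f g : R[i] -> R[i]) (z w c : R[i]) (k l : int).

Lemma cexp_2pii : cexp (2 * pii R) = 1.
Proof.
rewrite /cexp /pii (_ : 2 * (0 +i* pi) = 0 +i* (pi *+ 2)) /=.
  by rewrite expR0 cos2pi sin2pi mul1r.
by rewrite mulrDl mul1r; simpc; rewrite mulr2n.
Qed.

Lemma cexp_pii : cexp (pii R) = -1.
Proof. by rewrite /cexp /pii /= expR0 cospi sinpi mul1r; simpc. Qed.

Lemma cexp_2pii_int k : cexp (2 * pii R * k%:~R) = 1.
Proof.
have nat_case (n : nat) : cexp (2 * pii R * n%:~R) = 1.
  elim: n => [|n IH]; first by rewrite mulr0 cexp0.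
  by rewrite intS rmorphD/= mulrDr cexpD IH mulr1 mulr1 cexp_2pii.
case: k => n; first exact: nat_case.
by rewrite NegzE rmorphN/= mulrN cexpN nat_case invr1.
Qed.

Definition fexp k z : R[i] := cexp (2 * pii R * k%:~R * z).

Lemma holo_fexp k : holomorphic (fexp k).
Proof.
rewrite (_ : fexp k = fun z => cexp (2 * pii R * k%:~R * z + 0)).
  exact: holo_cexp_lin.
by apply/funext => z; rewrite addr0.
Qed.

Lemma fexp0 z : fexp 0 z = 1.
Proof. by rewrite /fexp mulr0 mul0r cexp0. Qed.

Lemma fexpM k l z : fexp k z * fexp l z = fexp (k + l) z.
Proof. by rewrite /fexp -cexpD rmorphD/=; congr cexp; ring. Qed.

Lemma fexpD k z w : fexp k (z + w) = fexp k z * fexp k w.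
Proof. by rewrite /fexp -cexpD; congr cexp; ring. Qed.

Lemma fexp_shift1 k z : fexp k (z + 1) = fexp k z.
Proof. by rewrite fexpD [fexp k 1]/fexp mulr1 cexp_2pii_int mulr1. Qed.

Lemma fexp_peak (x : R) : (2 - fexp 1 x%:C - fexp (-1) x%:C) / 4 = (peak x)%:C.
Proof.
have -> : fexp 1 x%:C = cos (2 * pi * x) +i* sin (2 * pi * x).
  rewrite /fexp mulr1 /cexp (_ : 2 * pii R * x%:C = 0 +i* (2 * pi * x)) /=.
    by rewrite expR0 mul1r.
  by rewrite /pii mulrDl mul1r; simpc; congr (_ +i* _); ring.
have -> : fexp (-1) x%:C = cos (2 * pi * x) -i* sin (2 * pi * x).
  rewrite /fexp rmorphN mulrN1 mulNr -mulrN /cexp.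
  rewrite (_ : 2 * pii R * - x%:C = 0 +i* (- (2 * pi * x))) /=.
    by rewrite expR0 mul1r cosN sinN.
  by rewrite /pii mulrDl mul1r; simpc; congr (_ +i* _); ring.
rewrite /peak rmorphM rmorphV/= ?unitfE ?pnatr_eq0//.
rewrite rmorphB/= rmorph_nat rmorph1.
have -> : (cos (2 * pi * x))%:C = ((cos (2 * pi * x) +i* sin (2 * pi * x)) +
   (cos (2 * pi * x) -i* sin (2 * pi * x))) / 2.
  apply: (mulIf (x := 2)); first by rewrite pnatr_eq0.
  rewrite divfK ?pnatr_eq0// (_ : 2 = 1 + 1)// mulrDr mulr1.
  by simpc; congr (_ +i* _); ring.
by field.
Qed.

Definition annihilated f :=
  [/\ holomorphic f, forall z, f (z + 1) = f z
    & forall k, mean (fun z => f z * fexp k z) = 0].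

Lemma holo_fexpM f k : holomorphic f -> holomorphic (fun z => f z * fexp k z).
Proof. by move=> hf; exact: (holoM hf (@holo_fexp k)). Qed.

(** The factor is the entire extension of [peak]. Multiplying by it replaces each Fourier
    coefficient by a combination of three neighbouring ones. *)
Lemma annihilated_peak f :
  annihilated f -> annihilated (fun z => (2 - fexp 1 z - fexp (-1) z) / 4 * f z).
Proof.
move=> [hf f1 fm].
have E (k : int) (z : R[i]) : (2 - fexp 1 z - fexp (-1) z) / 4 * f z * fexp k z =
    2^-1 * (f z * fexp k z) + ((- 4^-1) * (f z * fexp (1 + k) z)
      + (- 4^-1) * (f z * fexp (k - 1) z)).
  rewrite -(fexpM 1 k z) -(fexpM k (-1) z).
  by move: (f z) (fexp k z) (fexp 1 z) (fexp (-1) z) => *; field.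
have hk m : holomorphic (fun z => f z * fexp m z).
  exact: (holo_fexpM (k := m) hf).
have hck a m : holomorphic (fun z => a * (f z * fexp m z)).
  exact: (holoZ (c := a) (hk m)).
split.
- rewrite (_ : (fun _ => _) = fun z => 2^-1 * (f z * fexp 0 z) + ((- 4^-1) * (f z * fexp (1 + 0) z)
      + (- 4^-1) * (f z * fexp (0 - 1) z))).
    have h1 := hck 2^-1 0; have h2 := hck (- 4^-1) (1 + 0).
    have h3 := hck (- 4^-1) (0 - 1); exact: (holoD h1 (holoD h2 h3)).
  by apply/funext => z; rewrite -E fexp0 mulr1.
- by move=> z; rewrite !fexp_shift1 f1.
- move=> k; under [fun _ => _]eq_fun do rewrite E.
  have h1 := hck 2^-1 k; have h2 := hck (- 4^-1) (1 + k).
  have h3 := hck (- 4^-1) (k - 1).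
  rewrite (meanD h1 (holoD h2 h3)) (meanD h2 h3).
  rewrite (meanZ _ (hk k)) (meanZ _ (hk (1 + k))) (meanZ _ (hk (k - 1))).
  by rewrite !fm !mulr0 !addr0.
Qed.

(** A translation multiplies each coefficient by a constant. As [w] may be any complex number, every
    point can be brought to 1/2. *)
Lemma annihilated_shift f w c : annihilated f -> annihilated (fun z => c * f (z + w)).
Proof.
move=> [hf f1 fm]; split.
- exact: (holoZ (c := c) (holo_shift (c := w) hf)).
- by move=> z; rewrite addrAC f1.
- move=> k; have E z : c * f (z + w) * fexp k z =
      (c * fexp k (- w)) * ((fun z => f z * fexp k z) (z + w)).
    have -> : fexp k z = fexp k (z + w) * fexp k (- w) by rewrite -fexpD addrK.
    by move: (f _) (fexp _ _) (fexp _ _) => *; ring.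
  under [fun _ => _]eq_fun do rewrite E.
  have hk : holomorphic (fun z => f z * fexp k z) by exact: holo_fexpM.
  rewrite (meanZ _ (holo_shift (c := w) hk)) (mean_shift _ hk) ?fm ?mulr0//.
  by move=> z; rewrite f1 fexp_shift1.
Qed.

(** If [f w] were nonzero, translation and scaling would give an annihilated function equal to 1 at
    1/2. Its products with all powers of [peak] would have mean 0, which concentration at 1/2
    forbids. *)
Lemma annihilated_eq0 f : annihilated f -> forall z, f z = 0.
Proof.
move=> fa w; apply/eqP/negPn/negP => fw0.
pose g n := iter n
  (fun (h : R[i] -> R[i]) z => (2 - fexp 1 z - fexp (-1) z) / 4 * h z)
  (fun z => (f w)^-1 * f (z + (w - (1 / 2)%:C))).
have gS n z : g n.+1 z = (2 - fexp 1 z - fexp (-1) z) / 4 * g n z by [].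
have ga n : annihilated (g n).
  elim: n => [|n IH]; first exact: annihilated_shift.
  exact: annihilated_peak.
have gr n x : complex.Re (g n x%:C) = complex.Re (g 0%N x%:C) * peak x ^+ n.
  elim: n => [|n IH]; first by rewrite mulr1.
  rewrite gS fexp_peak exprSr mulrA -IH.
  by case: (g n _) => p q; simpc => /=; rewrite mulrC.
have /choice[H hH] : forall n : nat, exists F : R -> R,
    (forall x : R, is_derive x 1 F (complex.Re (g 0%N x%:C) * peak x ^+ n)) /\ F 1 = F 0.
  move=> n; have [hg _ gm] := ga n.
  have [F [G [dF dG]]] := real_primitives hg.
  exists F; split; first by move=> x; rewrite -gr; exact: dF.
  have := gm 0; under [fun _ => _]eq_fun do rewrite fexp0 mulr1.
  by rewrite (meanE hg dF dG) => -[/eqP + _]; rewrite subr_eq0 => /eqP.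
have [hg0 _ _] := ga 0%N; have [cg _ _ _] := holo_continuous_lines hg0 0.
apply: (@peak_concentration R (fun x => complex.Re (g 0%N x%:C)) H) => //.
- by rewrite /g/= addrC subrK mulVf.
- by move=> n x; have [] := hH n.
- by move=> n; have [] := hH n.
Qed.

End Fourier.

(** * Theta functions *)

Section QuasiPeriodic.
Variables (R : realType) (tau : R[i]).
Implicit Types (f g : R[i] -> R[i]) (z w c s : R[i]) (k l : int) (n : nat).

(* Elliptic polynomials of degree n with the character of a product of n theta
   functions whose zeros add up to s. *)
Definition theta_space n s f :=
  [/\ holomorphic f, forall u, f (u + 1) = (-1) ^+ n * f u
    & forall u, f (u + tau) = (-1) ^+ n * cexp (2 * pii R * s)
        * cexp (- (2 * pii R * n%:R * u) - pii R * n%:R * tau) * f u].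

Lemma theta_space_lin n s (I : Type) (r : seq I) (c : I -> R[i])
    (F : I -> R[i] -> R[i]) : (forall i, theta_space n s (F i)) ->
  theta_space n s (fun u => \sum_(i <- r) c i * F i u).
Proof.
move=> hF; split.
- by apply: holo_sum => i; have [hFi _ _] := hF i; exact: (holoZ (c := c i) hFi).
- move=> u; rewrite mulr_sumr; apply: eq_bigr => i _.
  by have [_ -> _] := hF i; rewrite mulrCA.
- move=> u; rewrite mulr_sumr; apply: eq_bigr => i _.
  by have [_ _ ->] := hF i; rewrite mulrCA.
Qed.

(* The untwisted function is 1-periodic, and the behaviour of f under tau relates
   its Fourier coefficients of indices k and k - n; hence n consecutive
   coefficients determine f. *)
Definition untwist n f z := f z * cexp (- (pii R * n%:R * z)).

Lemma holo_untwist n f : holomorphic f -> holomorphic (untwist n f).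
Proof.
move=> hf; have h := @holo_cexp_lin R (- (pii R * n%:R)) 0.
rewrite (_ : untwist n f = fun z => f z * cexp (- (pii R * n%:R) * z + 0)).
  exact: (holoM hf h).
by apply/funext => z; rewrite addr0 mulNr.
Qed.

Lemma untwist_shift1 n s f z : theta_space n s f ->
  untwist n f (z + 1) = untwist n f z.
Proof.
move=> [_ f1 _]; rewrite /untwist f1 mulrDr mulr1 opprD cexpD.
have -> : cexp (- (pii R * n%:R)) = (-1) ^+ n.
  elim: n {f1} => [|n IH]; first by rewrite mulr0 oppr0 cexp0.
  by rewrite -natr1 mulrDr mulr1 opprD cexpD IH cexpN cexp_pii exprSr invrN1.
have := sqrr_sign R[i] n; rewrite expr2.
move: (cexp _) (f z) ((-1) ^+ n) => a b e ee.
by rewrite -[RHS](mul1r) -[in RHS]ee; ring.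
Qed.

Lemma untwist_shift_tau n s f z : theta_space n s f ->
  untwist n f (z + tau) = (-1) ^+ n * cexp (2 * pii R * s)
    * cexp (- (2 * pii R * n%:R * tau)) * (untwist n f z * fexp (- n%:Z) z).
Proof.
move=> [_ _ ft]; rewrite /untwist ft /fexp.
have -> : - (pii R * n%:R * (z + tau)) = - (pii R * n%:R * z) + - (pii R * n%:R * tau).
  by ring.
have -> : - (2 * pii R * n%:R * z) - pii R * n%:R * tau =
  2 * pii R * (- n%:Z)%:~R * z + - (pii R * n%:R * tau) by rewrite rmorphN/=; ring.
have -> : - (2 * pii R * n%:R * tau) = - (pii R * n%:R * tau) + - (pii R * n%:R * tau).
  by ring.
rewrite !cexpD; move: (cexp _) (cexp _) (cexp _) (cexp _) (f z) ((-1) ^+ n).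
by move=> *; ring.
Qed.

Definition fcoef n f k := mean (fun z => untwist n f z * fexp k z).

Lemma fcoef_shift n s f k : theta_space n s f ->
  exists2 c, c != 0 & fcoef n f k = c * fcoef n f (k - n%:Z).
Proof.
move=> hf; have [hf0 _ _] := hf; have hu := @holo_untwist n f hf0.
exists ((-1) ^+ n * cexp (2 * pii R * s) * cexp (- (2 * pii R * n%:R * tau)) * fexp k tau).
  apply: mulf_neq0; last exact: cexp_neq0.
  apply: mulf_neq0; last exact: cexp_neq0.
  by apply: mulf_neq0; rewrite ?signr_eq0//; exact: cexp_neq0.
have hk m : holomorphic (fun z => untwist n f z * fexp m z).
  exact: (holo_fexpM (k := m) hu).
rewrite /fcoef -(@mean_shift _ (fun z => untwist n f z * fexp k z) tau (hk k)); last first.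
  by move=> z; rewrite (untwist_shift1 _ hf) fexp_shift1.
rewrite -(meanZ _ (hk (k - n%:Z))); congr mean; apply/funext => z.
rewrite (untwist_shift_tau _ hf) fexpD -fexpM.
by move: (cexp _) (cexp _) (fexp _ _) (fexp _ _) (fexp _ _) (untwist _ _ _) => *; ring.
Qed.

Lemma theta_space_eq0 n s f : (0 < n)%N -> theta_space n s f ->
  (forall k : 'I_n, fcoef n f k%:Z = 0) -> forall z, f z = 0.
Proof.
move=> n0 hf f0; have [hf0 _ _] := hf.
have up k : fcoef n f k = 0 -> fcoef n f (k + n%:Z) = 0.
  move=> h; have [c _ ->] := fcoef_shift (k + n%:Z) hf.
  by rewrite addrK h mulr0.
have down k : fcoef n f k = 0 -> fcoef n f (k - n%:Z) = 0.
  move=> h; have [c c0 e] := fcoef_shift k hf.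
  by move: h; rewrite e => /eqP; rewrite mulf_eq0 (negPf c0)/= => /eqP.
have all0 (m : nat) k : fcoef n f k = 0 ->
    fcoef n f (m%:Z * n%:Z + k) = 0 /\ fcoef n f (- m%:Z * n%:Z + k) = 0.
  move=> h; elim: m => [|m [h1 h2]]; first by rewrite oppr0 mul0r add0r.
  rewrite intS; split.
    by rewrite (_ : _ + _ = m%:Z * n%:Z + k + n%:Z); [exact: up|ring].
  by rewrite (_ : _ + _ = - m%:Z * n%:Z + k - n%:Z); [exact: down|ring].
have un0 z : untwist n f z = 0.
  apply: annihilated_eq0; split.
  - exact: holo_untwist.
  - by move=> w; exact: (untwist_shift1 _ hf).
  - move=> k; change (fcoef n f k = 0); rewrite (divz_eq k n%:Z).
    have nz : n%:Z != 0 by rewrite -lt0n.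
    have : fcoef n f (k %% n%:Z)%Z = 0.
      have rn : (`|(k %% n%:Z)%Z| < n)%N.
        by have := ltz_pmod k (_ : 0 < n%:Z); have := modz_ge0 k nz; lia.
      have := f0 (Ordinal rn); rewrite /= gez0_abs//; exact: modz_ge0.
    move=> /(all0 `|(k %/ n%:Z)%Z|%N)[h1 h2].
    case: (lerP 0 (k %/ n%:Z)%Z) => q0; first by rewrite gez0_abs in h1.
    by rewrite ltz0_abs ?opprK in h2.
move=> z; have := un0 z; rewrite /untwist => /eqP.
by rewrite mulf_eq0 (negPf (cexp_neq0 _)) orbF => /eqP.
Qed.

Lemma fcoef_lin n s (I : Type) (r : seq I) (c : I -> R[i])
    (F : I -> R[i] -> R[i]) k : (forall i, theta_space n s (F i)) ->
  fcoef n (fun u => \sum_(i <- r) c i * F i u) k = \sum_(i <- r) c i * fcoef n (F i) k.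
Proof.
move=> hF; have h i : holomorphic (fun z => untwist n (F i) z * fexp k z).
  have [hFi _ _] := hF i; have hu := @holo_untwist n _ hFi.
  exact: (holo_fexpM (k := k) hu).
under [RHS]eq_bigr do rewrite -(meanZ _ (h _)).
rewrite /fcoef -mean_sum; last by move=> i; exact: (holoZ (c := c i) (h i)).
congr mean; apply/funext => z; rewrite /untwist !mulr_suml.
by apply: eq_bigr => i _; rewrite !mulrA.
Qed.

(** The [n] coefficients of each of [n + 1] functions form a matrix with a nontrivial left
    kernel. *)
Lemma theta_space_dim n s (F : 'I_n.+1 -> R[i] -> R[i]) : (0 < n)%N ->
  (forall i, theta_space n s (F i)) ->
  exists c : 'I_n.+1 -> R[i], (exists i, c i != 0) /\
    forall u, \sum_i c i * F i u = 0.
Proof.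
move=> n0 hF; pose M := \matrix_(i < n.+1, k < n) fcoef n (F i) k%:Z.
have : kermx M != 0.
  rewrite kermx_eq0 /row_free neq_ltn; apply/orP; left.
  by rewrite ltnS; exact: rank_leq_col.
move=> /rowV0Pn[c /sub_kermxP cM c0]; exists (c 0); split.
  by move: c0 => /rV0Pn.
move=> u; apply: (theta_space_eq0 n0 (theta_space_lin _ _ hF)) => k.
rewrite (fcoef_lin _ _ _ hF); have := congr1 (fun A : 'rV_n => A 0 k) cM.
by rewrite !mxE => {2}<-; apply: eq_bigr => i _; rewrite mxE.
Qed.

End QuasiPeriodic.

(** * Interpolation by products of theta functions, and the zeros of theta *)

Section Theta.
Variables (R : realType) (tau : R[i]) (theta : R[i] -> R[i]).
Hypothesis tau_gt0 : 0 < complex.Im tau.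
Hypothesis theta_odd : odd_theta tau theta.
Implicit Types (f g : R[i] -> R[i]) (z w c s a p q t : R[i]) (n : nat).

Lemma thetaN z : theta (- z) = - theta z.
Proof. by have [_ ->] := theta_odd. Qed.

Lemma theta0 : theta 0 = 0.
Proof.
have := thetaN 0; rewrite oppr0 => /eqP; rewrite -subr_eq0 opprK -mulr2n.
by rewrite -mulr_natr mulf_eq0 pnatr_eq0 orbF => /eqP.
Qed.

Lemma thetaB z w : theta (z - w) = - theta (w - z).
Proof. by rewrite -thetaN opprB. Qed.

Lemma holo_theta : holomorphic theta.
Proof. by have [] := theta_odd. Qed.

Lemma theta_prod_space n (y : 'I_n -> R[i]) :
  theta_space tau n (\sum_i y i) (fun u => \prod_i theta (u - y i)).
Proof.
have [hol _ th1 tht _] := theta_odd; split.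
- by apply: holo_prod => i; exact: (holo_shift (c := - y i) hol).
- move=> u; under eq_bigr do rewrite addrAC th1 -mulN1r.
  by rewrite big_split /= prodr_const card_ord.
- move=> u; pose b := - (2 * pii R * u) - pii R * tau.
  have E i : theta (u + tau - y i) = - cexp (2 * pii R * y i + b) * theta (u - y i).
    by rewrite addrAC tht /b; congr (- cexp _ * _); ring.
  under eq_bigr do rewrite E.
  rewrite big_split prodrN -cexp_sum cardT size_enum_ord -(mulrA ((-1) ^+ n)) -cexpD.
  congr (_ * cexp _ * _); rewrite big_split /= sumr_const card_ord mulr_sumr.
  by rewrite -mulr_natr /b; ring.
Qed.

(** Lagrange interpolation. The [j]-th product vanishes at every [x k] with [k != j]; its [j]-th
    zero is displaced by [s - \sum_i x i], which puts it in the same space and keeps it nonzero at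
    [x j]. Together with [f] these are [n + 1] functions, hence dependent, and evaluation at [x j]
    kills the coefficient of the [j]-th product. *)
Lemma theta_interpolation n s f (x : 'I_n -> R[i]) : (0 < n)%N ->
  theta_space tau n s f -> (forall i j, i != j -> theta (x i - x j) != 0) ->
  theta (s - \sum_i x i) != 0 -> (forall i, f (x i) = 0) -> forall u, f u = 0.
Proof.
move=> n0 hf xne sne fx.
pose y (i k : 'I_n) := if k == i then x i + (s - \sum_j x j) else x k.
pose F (i : 'I_n.+1) u := if unlift ord0 i is Some j then \prod_k theta (u - y j k)
   else f u.
have F0 u : F ord0 u = f u by rewrite /F unlift_none.
have FS j u : F (lift ord0 j) u = \prod_k theta (u - y j k) by rewrite /F liftK.
have hF i : theta_space tau n s (F i).
  case: (unliftP ord0 i) => [j ->|->].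
    rewrite (_ : F _ = fun u => \prod_k theta (u - y j k)); last by apply/funext => u.
    have -> : s = \sum_k y j k; last exact: theta_prod_space.
    have e : \sum_(k | k != j) y j k = \sum_(k | k != j) x k.
      by apply: eq_bigr => k /negPf kj; rewrite /y kj.
    by rewrite (bigD1 j)//= e /y eqxx (bigD1 j (P := predT))//=; ring.
  by rewrite (_ : F _ = f); last by apply/funext => u.
have [c [[i0 ci0] hc]] := theta_space_dim n0 hF.
have cS j : c (lift ord0 j) = 0.
  have := hc (x j); rewrite big_ord_recl F0 fx mulr0 add0r (bigD1 j)//= big1 => [|k kj].
    rewrite addr0 FS => /eqP; rewrite mulf_eq0 => /orP[/eqP//|].
    rewrite prodf_seq_eq0 => /hasP[k _ /=]; rewrite /y; have [_|kj] := eqVneq k j.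
      rewrite opprD addrA subrr sub0r thetaN oppr_eq0 => h.
      by rewrite h in sne.
    by move=> h; have := xne j k; rewrite eq_sym kj => /(_ isT); rewrite h.
  rewrite FS (bigD1 j)//= /y eq_sym (negPf kj) subrr theta0 mul0r mulr0.
  by [].
move=> u; have := hc u; rewrite big_ord_recl big1 => [|j _]; last by rewrite cS mul0r.
rewrite addr0 F0 => /eqP; rewrite mulf_eq0 => /orP[c0|/eqP//].
move: ci0; case: (unliftP ord0 i0) => [j ->|->]; first by rewrite cS eqxx.
by rewrite c0.
Qed.

(** Interpolation for [theta u * theta (u - (2 * w + 2 * e))], which vanishes at [w + e] and
    [w - e]. Its zeros add up to [2 * e] more than these two points, so it is identically 0; its
    value at [2 * e] is then read off. *)
Lemma theta_double w e : theta (w + e) = 0 -> theta (w - e) = 0 ->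
  theta (2 * e) != 0 -> theta (2 * w) = 0.
Proof.
move=> h1 h2 e0.
pose y (i : 'I_2) : R[i] := if i == ord0 then 0 else 2 * w + 2 * e.
pose x (i : 'I_2) : R[i] := if i == ord0 then w + e else w - e.
have sx : \sum_i x i = 2 * w by rewrite big_ord_recl big_ord1 /x /=; ring.
have sy : \sum_i y i = 2 * w + 2 * e by rewrite big_ord_recl big_ord1 /y /=; ring.
have fE u : \prod_i theta (u - y i) = theta u * theta (u - (2 * w + 2 * e)).
  by rewrite big_ord_recl big_ord1 /y /= subr0.
have := @theta_interpolation 2 _ _ x isT (theta_prod_space y) _ _ _ (2 * e).
rewrite fE (_ : 2 * e - (2 * w + 2 * e) = - (2 * w)); last by ring.
move=> H; suff: theta (2 * e) * theta (- (2 * w)) = 0.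
  by move/eqP; rewrite mulf_eq0 (negPf e0)/= thetaN oppr_eq0 => /eqP.
apply: H.
- have d1 : w + e - (w - e) = 2 * e by ring.
  have d2 : w - e - (w + e) = - (2 * e) by ring.
  move=> [[|[|//]] ?] [[|[|//]] ?] //= _; rewrite /x /=; first by rewrite d1.
  by rewrite d2 thetaN oppr_eq0.
- by rewrite sx sy addrAC subrr add0r.
- move=> i; rewrite fE /x; case: ifP => _; first by rewrite h1 mul0r.
  by rewrite h2 mul0r.
Qed.

Lemma theta_continuous z : {for z, continuous (theta : R[i]^o -> R[i]^o)}.
Proof. exact/differentiable_continuous/derivable1_diffP/holo_theta. Qed.

Lemma theta_near_neq0 z c : theta (z + c) != 0 ->
  \forall w \near (z : R[i]^o), theta (w + c) != 0.
Proof.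
move=> h; have ct := @theta_continuous (z + c).
have cs : {for z, continuous (fun w : R[i]^o => (w + c : R[i]^o))}.
  exact: (continuousD (@cvg_id _ _) (@cvg_cst _ _ _ _ _)).
exact: (cvgr_neq0 _ (continuous_comp cs ct) h).
Qed.

Lemma theta_near0_neq0 : \forall h \near (0 : R[i]^o)^', theta h != 0.
Proof.
have [_ _ _ _ [dth th1]] := theta_odd.
have /cvg_ex[l hl] := dth.
have El : l = 1 by rewrite -th1; apply/esym/(cvg_lim _ hl)/norm_hausdorff.
have nz : l != 0 by rewrite El; exact: oner_neq0.
apply: filterS (cvgr_neq0 _ hl nz) => h; apply: contraNneq => h0 /=.
by rewrite /GRing.scale/= mulr1 addr0 theta0 h0 subrr mulr0.
Qed.

Lemma theta_lattice c u : lattice tau c -> (theta (u + c) == 0) = (theta u == 0).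
Proof.
have [_ _ th1 tht _] := theta_odd.
have s1 v : (theta (v + 1) == 0) = (theta v == 0) by rewrite th1 oppr_eq0.
have st v : (theta (v + tau) == 0) = (theta v == 0).
  by rewrite tht mulf_eq0 oppr_eq0 (negPf (cexp_neq0 _)).
have int_shift w : (forall v, (theta (v + w) == 0) = (theta v == 0)) ->
    forall (k : int) v, (theta (v + k%:~R * w) == 0) = (theta v == 0).
  move=> sw; have nat_shift (n : nat) v : (theta (v + n%:R * w) == 0) = (theta v == 0).
    elim: n v => [|n IH] v; first by rewrite mul0r addr0.
    by rewrite -natr1 mulrDl mul1r addrA sw IH.
  case=> n v; first exact: nat_shift.
  by rewrite NegzE rmorphN/= mulNr -[LHS](nat_shift n.+1) subrK.
case=> m [n ->]; rewrite addrA (int_shift tau st).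
by rewrite -[m%:~R]mulr1 (int_shift 1 s1).
Qed.

Lemma gt0_real c : 0 < c -> exists2 r : R, 0 < r & c = r%:C.
Proof.
by case: c => a b; rewrite ltcE/= => /andP[/eqP-> a0]; exists a.
Qed.

Lemma lattice_close z : exists2 c, lattice tau c & `|z - c| <= 1 + `|tau|.
Proof.
have t0 := tau_gt0; pose a := complex.Re tau; pose b := complex.Im tau.
pose x := complex.Re z; pose y := complex.Im z.
pose n := Num.floor (y / b); pose m := Num.floor (x - y / b * a).
have := floor_itv (y / b); rewrite -/n intrD rmorph1 => hn.
have := floor_itv (x - y / b * a); rewrite -/m intrD rmorph1 => hm.
exists (m%:~R + n%:~R * tau); first by exists m, n.
have intC (k : int) : k%:~R = (k%:~R : R)%:C by rewrite rmorph_int.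
have -> : z - (m%:~R + n%:~R * tau) =
    (x - y / b * a - m%:~R)%:C + (y / b - n%:~R)%:C * tau.
  have zE : z = x +i* y by rewrite /x /y; case: (z).
  have tauE : tau = a +i* b by rewrite /a /b; case: (tau).
  rewrite !intC zE tauE; simpc; congr (_ +i* _); first by ring.
  by field; rewrite gt_eqF.
apply: (le_trans (ler_normD _ _)); rewrite normrM; apply: lerD.
  by rewrite ger0_norm ?lecR ?ler0c; lra.
by rewrite ler_piMl// ger0_norm ?lecR ?ler0c; lra.
Qed.

(* If theta vanished on a disc, theta_double would spread the zeros to discs of
   radius multiplied by 2 ^ k, hence to every point modulo the lattice, although
   theta has an isolated zero at 0. *)
Lemma theta_dense p (U : set R[i]) : nbhs (p : R[i]^o) U -> exists2 z, U z & theta z != 0.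
Proof.
move=> /nbhs_ballP[r0 /= /gt0_real[r r_gt0 ->] hU]; apply: contrapT => hno.
have zero z : `|p - z| < r%:C -> theta z = 0.
  move=> hz; apply/eqP/negPn/negP => tz; apply: hno; exists z => //.
  exact: hU.
have [e0 /= /gt0_real[e e_gt0 ->] he] := theta_near0_neq0.
have {}he h : `|h| < e%:C -> h != 0 -> theta h != 0.
  by move=> h1 h2; apply: he => //=; rewrite sub0r normrN.
have dbl (k : nat) z : `|2 ^+ k * p - z| < 2 ^+ k * r%:C -> theta z = 0.
  elim: k z => [|k IH] z; first by rewrite !mul1r; exact: zero.
  rewrite !exprS -!mulrA => hz.
  pose w := z / 2; have zE : z = 2 * w by rewrite /w mulrC divfK// pnatr_eq0.
  move: hz; rewrite zE -mulrBr normrM ger0_norm// ltr_pM2l// -subr_gt0 => hw.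
  have [d d0 dE] := gt0_real hw.
  (* [d] is the distance left between [w] and the boundary of the smaller disc. The step [h] is
     below [d], so that both [w + h] and [w - h] stay in that disc, and [2 * h] is below [e], so
     that [theta (2 * h)] is nonzero. *)
  have m0 : 0 < Num.min d e / 4 by rewrite divr_gt0// lt_min d0.
  have md : Num.min d e / 4 < d.
    have : Num.min d e <= d by rewrite ge_min lexx.
    by move: m0; lra.
  have me : 2 * (Num.min d e / 4) < e.
    have : Num.min d e <= e by rewrite ge_min lexx orbT.
    by move: m0; lra.
  set h := Num.min d e / 4 in m0 md me *.
  have nh : `|h%:C| = h%:C :> R[i] by rewrite ger0_norm// ler0c ltW.
  have close c : `|c| = h%:C -> `|2 ^+ k * p - (w + c)| < 2 ^+ k * r%:C.
    move=> ce; have : `|2 ^+ k * p - (w + c)| <= `|2 ^+ k * p - w| + `|c|.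
      by apply: le_trans (ler_normB _ _); rewrite opprD addrA.
    move=> /le_lt_trans; apply; rewrite ce addrC -ltrBrDr.
    by rewrite dE ltcR.
  apply: (@theta_double w h%:C).
  - exact/IH/close.
  - by apply/IH/close; rewrite normrN.
  - apply: he.
      by rewrite normrM nh ger0_norm// -(rmorph_nat (@real_complex R)) -rmorphM ltcR.
    by rewrite mulf_neq0 ?pnatr_eq0// fmorph_eq0 gt_eqF.
(* Once [2 ^+ k * r] exceeds [1 + |tau| + e / 2], the disc contains a translate by a lattice vector
   of [e / 2], where theta does not vanish. *)
have [c cl] : exists c, lattice tau c /\ exists k, `|2 ^+ k * p - (c + (e / 2)%:C)| < 2 ^+ k * r%:C.
  have [t tE] : exists t : R, `|tau| = t%:C by rewrite normc_def; eexists.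
  pose k := (Num.truncn ((1 + t + e / 2) / r)).+1.
  have [c cl hc] := lattice_close (2 ^+ k * p).
  exists c; split => //; exists k.
  have : `|2 ^+ k * p - (c + (e / 2)%:C)| <= `|2 ^+ k * p - c| + `|(e / 2)%:C|.
    by apply: le_trans (ler_normB _ _); rewrite opprD addrA.
  move=> /le_lt_trans; apply; apply: (@le_lt_trans _ _ ((1 + `|tau|) + (e / 2)%:C)).
    by apply: lerD => //; rewrite ger0_norm// ler0c; lra.
  rewrite tE -(rmorph1 (@real_complex R)) -!rmorphD.
  rewrite -(rmorph_nat (@real_complex R)) -rmorphXn -rmorphM ltcR.
  rewrite -ltr_pdivrMr//; apply: (lt_trans (truncnS_gt _)).
  by rewrite -natrX ltr_nat ltn_expl.
case: cl => hl [k /dbl/eqP]; rewrite addrC (theta_lattice _ hl); apply/negP.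
apply: he; last by rewrite fmorph_eq0 gt_eqF// divr_gt0.
by rewrite ger0_norm ?ltcR ?ler0c; lra.
Qed.

End Theta.

Section ThetaZeros.
Variables (R : realType) (tau : R[i]) (theta : R[i] -> R[i]).
Hypothesis tau_gt0 : 0 < complex.Im tau.
Hypothesis theta_odd : odd_theta tau theta.
Implicit Types (f g : R[i] -> R[i]) (z w c s a b p q t u : R[i]) (n : nat).

(** Nonvanishing of theta is an open condition, and a dense one by [theta_dense], so finitely many
    such conditions can be met in any neighbourhood. *)
Lemma theta_generic (cs : seq R[i]) p (U : set R[i]) : nbhs (p : R[i]^o) U ->
  exists2 t, U t & forall c, c \in cs -> theta (t + c) != 0.
Proof.
elim: cs p U => [|c cs IH] p U hU; first by exists p => //; exact: (nbhs_singleton hU).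
have /nbhs_ballP[r /= r0 hr] := hU.
have r2 : 0 < r / 2 by rewrite divr_gt0.
have [z hz tz] := theta_dense tau_gt0 theta_odd (nbhsx_ballx (p + c : R[i]^o) (r / 2) r2).
have {}hz : nbhs (z - c : R[i]^o) U.
  apply/nbhs_ballP; exists (r / 2) => //= w hw; apply: hr.
  move: hz hw; rewrite /ball/= => h1 h2.
  have -> : p - w = (p + c - z) + (z - c - w) by ring.
  by apply: (le_lt_trans (ler_normD _ _)); rewrite [r]splitr ltrD.
have nz := @theta_near_neq0 _ _ _ theta_odd (z - c) c.
rewrite subrK in nz; have [t [tU tc] tcs] := IH _ _ (filterI hz (nz tz)).
by exists t => // d; rewrite in_cons => /orP[/eqP->|/tcs].
Qed.

Lemma theta_pair_space y1 y2 :
  theta_space tau 2 (y1 + y2) (fun u => theta (u - y1) * theta (u - y2)).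
Proof.
have := theta_prod_space theta_odd (fun i : 'I_2 => if i == ord0 then y1 else y2).
rewrite big_ord_recl big_ord1 /=; congr theta_space.
by apply/funext => u; rewrite big_ord_recl big_ord1.
Qed.

Lemma theta_space2_dep s f0 f1 f2 : theta_space tau 2 s f0 ->
  theta_space tau 2 s f1 -> theta_space tau 2 s f2 ->
  exists c0 c1 c2 : R[i], [|| c0 != 0, c1 != 0 | c2 != 0] /\
    forall u, c0 * f0 u + c1 * f1 u + c2 * f2 u = 0.
Proof.
move=> h0 h1 h2; pose F (i : 'I_3) := nth f0 [:: f0; f1; f2] i.
have hF i : theta_space tau 2 s (F i) by case: i => [[|[|[|//]]] hi].
have [c [[i ci] hc]] := theta_space_dim (n := 2) isT hF.
exists (c ord0), (c (lift ord0 ord0)), (c (lift ord0 (lift ord0 ord0))); split.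
  move: ci; case: (unliftP ord0 i) => [j ->|->]; last by move->.
  case: (unliftP ord0 j) => [k ->|->]; last by move->; rewrite orbT.
  by rewrite (ord1 k) => ->; rewrite !orbT.
by move=> u; have := hc u; rewrite !big_ord_recl big_ord0 addr0 addrA.
Qed.

(** The functions [theta (u + p) * theta (u + q)], [theta (u + p + t) * theta (u + q - t)] and
    [theta u * theta (u + p + q)] lie in a space of dimension 2. The third vanishes at 0 and at [a],
    so a linear relation evaluated there forces the determinant of the first two to be 0. *)
Lemma theta_zero_mul a p q t : theta a = 0 ->
  theta (p + a) * theta (q + a) * (theta (p + t) * theta (q - t)) =
  theta (p + t + a) * theta (q - t + a) * (theta p * theta q).
Proof.
move=> a0.
have h0 := theta_pair_space (- p) (- q); rewrite -opprD in h0.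
have h1 := theta_pair_space (- (p + t)) (- (q - t)).
have e1 : - (p + t) + - (q - t) = - (p + q) by ring.
rewrite e1 in h1.
have h2 := theta_pair_space 0 (- (p + q)); rewrite add0r in h2.
have [c0 [c1 [c2 [cne E]]]] := theta_space2_dep h0 h1 h2.
have E0 : c0 * (theta p * theta q) + c1 * (theta (p + t) * theta (q - t)) = 0.
  by have := E 0; rewrite !opprK !subr0 !add0r (theta0 theta_odd) mul0r mulr0 addr0.
have Ea : c0 * (theta (p + a) * theta (q + a)) +
    c1 * (theta (p + t + a) * theta (q - t + a)) = 0.
  by have := E a; rewrite !opprK !subr0 a0 mul0r mulr0 addr0 !(addrC a).
have det (A B A' B' : R[i]) : c0 * A + c1 * B = 0 -> c0 * A' + c1 * B' = 0 ->
    (c0 != 0) || (c1 != 0) -> A' * B = B' * A.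
  move=> e0 ea /orP[] cnz; apply: (mulfI cnz); apply/eqP; rewrite -subr_eq0; apply/eqP.
    transitivity ((c0 * A' + c1 * B') * B - B' * (c0 * A + c1 * B)); first by ring.
    by rewrite e0 ea mul0r mulr0 subrr.
  transitivity (A' * (c0 * A + c1 * B) - (c0 * A' + c1 * B') * A); first by ring.
  by rewrite e0 ea mul0r mulr0 subrr.
have [c01|/norP[/negPn/eqP c0z /negPn/eqP c1z]] := boolP ((c0 != 0) || (c1 != 0)).
  exact: det E0 Ea c01.
move: cne; rewrite c0z c1z eqxx /= => c2nz.
have [z _ hz] := @theta_generic [:: 0; p + q] 0 setT filterT.
have := E z; rewrite c0z c1z !mul0r !add0r subr0 opprK => /eqP.
rewrite !mulf_eq0 (negPf c2nz)/=; have := hz 0; rewrite addr0 mem_head => /(_ isT)/negPf->.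
by have := hz (p + q); rewrite !inE eqxx orbT => /(_ isT)/negPf->.
Qed.

(** After subtracting the nearest integer, the modulus gives imaginary part 0, and strict
    monotonicity of [peak] away from 1/2 leaves 0 as the only real part. *)
Lemma cexp_eq1 z : cexp (2 * pii R * z) = 1 -> exists m : int, z = m%:~R.
Proof.
pose m := Num.floor (complex.Re z + 1 / 2).
have := floor_itv (complex.Re z + 1 / 2); rewrite -/m intrD rmorph1 => hm.
have zE : z = (z - m%:~R) + m%:~R by rewrite subrK.
move=> h; exists m; rewrite zE.
have : cexp (2 * pii R * (z - m%:~R)) = 1.
  by rewrite mulrBr cexpD cexpN cexp_2pii_int invr1 mulr1.
have : - (1 / 2) <= complex.Re (z - m%:~R) <= 1 / 2.
  have -> : complex.Re (z - m%:~R) = complex.Re z - m%:~R.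
    by rewrite -(rmorph_int (@real_complex R)); case: (z) => x y.
  by lra.
suff H w : - (1 / 2) <= complex.Re w <= 1 / 2 -> cexp (2 * pii R * w) = 1 -> w = 0.
  by move=> h1 h2; rewrite (H _ h1 h2) add0r.
case: w => x y /= hx.
rewrite /cexp /pii (_ : 2 * (0 +i* pi) * (x +i* y) = (- (2 * pi * y)) +i* (2 * pi * x)) /=; last first.
  by rewrite mulrDl mul1r; simpc; congr (_ +i* _); ring.
set E := expR _; have E0 : 0 < E by exact: expR_gt0.
simpc => -[e1 e2].
have sc := cos2Dsin2 (2 * pi * x).
have EE : E = 1.
  have : E ^+ 2 * (cos (2 * pi * x) ^+ 2 + sin (2 * pi * x) ^+ 2) = 1.
    by rewrite mulrDr -!exprMn e1 e2; ring.
  by rewrite sc mulr1 => h2; nra.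
have y0 : y = 0.
  have : - (2 * pi * y) = 0 by apply: expR_inj; rewrite expR0.
  move/eqP; rewrite oppr_eq0 !mulf_eq0 pnatr_eq0/= => /orP[/eqP p0|/eqP//].
  by have := pi_gt0 R; rewrite p0 ltxx.
have x0 : x = 0.
  rewrite EE mul1r in e1; apply/eqP/negPn/negP => x0.
  have := @peak_lt R 0 `|x| (lexx _) _ _; rewrite normr_gt0 => /(_ x0).
  rewrite ler_norml => /(_ hx); rewrite !peakE mulr0 cos0.
  have -> : cos (2 * pi * `|x|) = cos (2 * pi * x).
    by case: (ger0P x) => // _; rewrite mulrN cosN.
  by rewrite e1 ltxx.
by rewrite x0 y0.
Qed.

(* By theta_zero_mul, theta (p + a) / theta p is, up to a constant, given near
   every p by the auxiliary function h, which is therefore entire, 1-periodic and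
   multiplied by cexp (- 2 pi i a) under p |-> p + tau. Comparing a nonzero
   Fourier coefficient of h before and after the shift by tau locates a. *)
Lemma theta_zero_lattice a : theta a = 0 -> lattice tau a.
Proof.
move=> a0; have [hol _ th1 tht _] := theta_odd.
have [q _ hq] := @theta_generic [:: 0; a] 0 setT filterT.
have q0 : theta q != 0 by have := hq 0; rewrite addr0 mem_head => /(_ isT).
have qa : theta (q + a) != 0 by have := hq a; rewrite !inE eqxx orbT => /(_ isT).
pose good p t := theta (p + t) != 0 /\ theta (q - t) != 0.
have /choice[T hT] : forall p, exists t, good p t.
  move=> p; have [t _ ht] := @theta_generic [:: p; - q] 0 setT filterT.
  exists t; split; first by rewrite addrC ht// mem_head.
  by rewrite (thetaB theta_odd) oppr_eq0 ht// !inE eqxx orbT.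
(* By [theta_zero_mul] this is [theta (p + a) / theta p] wherever [theta p] is nonzero; the free
   parameter [t] moves the denominator away from zeros, so [X] also makes sense at zeros of
   [theta p]. *)
pose X p t := theta (p + t + a) * theta (q - t + a) * theta q
  / (theta (p + t) * theta (q - t) * theta (q + a)).
pose h p := X p (T p).
have XE p t t' : good p t -> good p t' -> X p t = X p t'.
  move=> [g1 g2] [g3 g4]; have := theta_zero_mul (p + t') (q - t') (t - t') a0.
  have -> : p + t' + (t - t') = p + t by ring.
  have -> : q - t' - (t - t') = q - t by ring.
  move=> e; rewrite /X; apply/eqP; rewrite eqr_div ?mulf_neq0//; apply/eqP.
  transitivity (theta (p + t + a) * theta (q - t + a) * (theta (p + t') * theta (q - t'))
    * (theta q * theta (q + a))); first by ring.
  by rewrite -e; ring.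
have hX p t : good p t -> h p = X p t by move=> g; exact: XE.
have hol_h : holomorphic h.
  move=> p; have [g1 g2] := hT p; set t := T p in g1 g2.
  have near_h : \forall w \near (p : R[i]^o), X w t = h w.
    apply: filterS (theta_near_neq0 theta_odd g1) => w hw.
    by apply/esym/hX.
  apply: (@near_eq_derivable _ R[i]^o R[i]^o (fun w => X w t) h p 1 near_h).
  have d1 := @holo_shift _ theta (t + a) hol p.
  have d2 := @holo_shift _ theta t hol p.
  have d3 := derivableV g1 d2.
  pose k := theta (q - t + a) * theta q / (theta (q - t) * theta (q + a)).
  have d4 := derivableM (derivableM d1 d3) (@holo_cst R k p).
  rewrite (_ : (fun p => X p t) = fun p => theta (p + (t + a)) * (theta (p + t))^-1 * k)//.
  apply/funext => w; rewrite /X /k !invfM addrA.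
  by move: (theta _)^-1 (theta _)^-1 (theta _)^-1 (theta _) (theta _) (theta _) => *; ring.
have h1 p : h (p + 1) = h p.
  have [g1 g2] := hT p; rewrite (hX (p + 1) (T p)); last first.
    by split=> //; rewrite addrAC th1 oppr_eq0.
  rewrite /h /X (addrAC p) th1 (addrAC _ 1) th1 !mulNr invrN.
  by rewrite mulrN opprK.
have ht p : h (p + tau) = cexp (- (2 * pii R * a)) * h p.
  have [g1 g2] := hT p; rewrite (hX (p + tau) (T p)); last first.
    by split=> //; rewrite addrAC tht mulf_neq0// oppr_eq0 cexp_neq0.
  rewrite /h /X (addrAC p) tht (addrAC _ tau) tht.
  have -> : - (2 * pii R * (p + T p + a)) - pii R * tau =
    - (2 * pii R * a) + (- (2 * pii R * (p + T p)) - pii R * tau) by ring.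
  rewrite cexpD; move: (cexp_neq0 (- (2 * pii R * (p + T p)) - pii R * tau)) g1 g2 qa.
  move: (cexp _) (cexp _) (theta (p + T p)) (theta (q - T p)) (theta (q + a)).
  move=> x1 x2 x3 x4 x5 n1 n2 n3 n4; field.
  by rewrite n1 n2 n3 n4.
have [k hk] : exists k, mean (fun z => h z * fexp k z) != 0.
  apply: contrapT => hno.
  have : annihilated h.
    split=> // k; apply/eqP/negPn/negP => hk; apply: hno; by exists k.
  move/annihilated_eq0 => /(_ q) /eqP; have [g1 g2] := hT q; apply/negP.
  have : theta (q + a) * theta (q + a) * (theta (q + T q) * theta (q - T q)) != 0.
    by rewrite !mulf_neq0.
  rewrite theta_zero_mul// !mulf_eq0 !negb_or => /andP[/andP[f1 f2] _].
  by rewrite f1 f2 q0 /= invr_eq0 !mulf_neq0.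
have hk0 : holomorphic (fun z => h z * fexp k z) by exact: holo_fexpM.
have : cexp (2 * pii R * (k%:~R * tau - a)) = 1.
  apply: (mulIf hk); rewrite mul1r -[RHS](mean_shift tau hk0); last first.
    by move=> z; rewrite h1 fexp_shift1.
  rewrite -(meanZ _ hk0); congr mean; apply/funext => z; rewrite ht fexpD /fexp.
  have -> : 2 * pii R * (k%:~R * tau - a) = 2 * pii R * k%:~R * tau + - (2 * pii R * a).
    by ring.
  rewrite cexpD; move: (cexp _) (cexp _) (cexp _) => *; ring.
move=> /cexp_eq1[m e]; exists (- m), k; by rewrite rmorphN/= -e; ring.
Qed.

(** A continuous function nonzero at [z] is nonzero on a neighbourhood, which contains a point where
    [theta (z + c)] is nonzero. *)
Lemma theta_extend f c : holomorphic f ->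
  (forall z, theta (z + c) != 0 -> f z = 0) -> forall z, f z = 0.
Proof.
move=> hf f0 z; apply/eqP/negPn/negP => fz.
have cf : {for z, continuous (f : R[i]^o -> R[i]^o)}.
  exact/differentiable_continuous/derivable1_diffP/hf.
have [t ft /(_ c)] := theta_generic [:: c] (cvgr_neq0 _ cf fz).
by rewrite mem_head => /(_ isT)/f0 e; rewrite e eqxx in ft.
Qed.

(* The left hand side, as a function of a, lies in a two-dimensional space and
   vanishes at a = - b and a = - b - t, for generic c and t. *)
Lemma theta_three_term a b c t :
  theta (a + 2 * b + c + t) * theta a * theta t * theta c
  - theta (a + b + c + t) * theta (a + b) * theta (b + t) * theta (b + c)
  + theta (a + b + t) * theta (a + b + c) * theta (b + c + t) * theta b = 0.
Proof.
have sp u y1 y2 : theta_space tau 2 (y1 + y2)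
    (fun u => theta (u - y1) * theta (u - y2)) by exact: theta_pair_space.
(* [theta t'] measures the difference of the two interpolation points and [theta c'] the defect of
   their sum, hence the two conditions. *)
have main c' t' : theta c' != 0 -> theta t' != 0 -> forall u,
  theta (u + 2 * b + c' + t') * theta u * theta t' * theta c'
  - theta (u + b + c' + t') * theta (u + b) * theta (b + t') * theta (b + c')
  + theta (u + b + t') * theta (u + b + c') * theta (b + c' + t') * theta b = 0.
  move=> cn tn; pose s := - (2 * b + c' + t').
  pose y (i j : bool) := match i, j with
    | false, _ => 0 | true, false => - b | true, true => - (b + t') end.
  pose C (i : 'I_3) := nth 0 [:: theta t' * theta c';
    - (theta (b + t') * theta (b + c')); theta (b + c' + t') * theta b] i.
  pose Y (i : 'I_3) := nth 0 [:: 0; - b; - (b + t')] i.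
  pose F (i : 'I_3) u := theta (u - (s - Y i)) * theta (u - Y i).
  have hF i : theta_space tau 2 s (F i).
    by rewrite -{1}[s](subrK (Y i)); exact: theta_pair_space.
  have fE u : \sum_i C i * F i u =
      theta (u + 2 * b + c' + t') * theta u * theta t' * theta c'
      - theta (u + b + c' + t') * theta (u + b) * theta (b + t') * theta (b + c')
      + theta (u + b + t') * theta (u + b + c') * theta (b + c' + t') * theta b.
    rewrite !big_ord_recl big_ord0 addr0 /C /F /Y /s /=.
    have -> : u - (- (2 * b + c' + t') - 0) = u + 2 * b + c' + t' by ring.
    have -> : u - (- (2 * b + c' + t') - - b) = u + b + c' + t' by ring.
    have -> : u - (- (2 * b + c' + t') - - (b + t')) = u + b + c' by ring.
    have -> : u - - (b + t') = u + b + t' by ring.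
    by rewrite subr0 opprK; ring.
  pose x (i : 'I_2) := if i == ord0 then - b else - (b + t').
  have sx : \sum_i x i = - b - (b + t') by rewrite big_ord_recl big_ord1.
  have d1 : - b - - (b + t') = t' by ring.
  have d2 : - (b + t') - - b = - t' by ring.
  have tN := thetaN theta_odd; have t0 := theta0 theta_odd.
  move=> u; rewrite -fE.
  apply: (theta_interpolation theta_odd (x := x) isT (theta_space_lin _ C hF)).
  - move=> [[|[|//]] ?] [[|[|//]] ?] //= _; rewrite /x /=; first by rewrite d1.
    by rewrite d2 tN oppr_eq0.
  - rewrite sx (_ : s - _ = - c') ?tN ?oppr_eq0// /s; by ring.
  - move=> i; rewrite fE /x; case: ifP => _.
      have -> : - b + 2 * b + c' + t' = b + c' + t' by ring.
      have -> : - b + b = 0 by ring.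
      by rewrite !add0r !t0 tN; ring.
    have -> : - (b + t') + 2 * b + c' + t' = b + c' by ring.
    have -> : - (b + t') + b + c' + t' = c' by ring.
    have -> : - (b + t') + b + t' = 0 by ring.
    have -> : - (b + t') + b = - t' by ring.
    by rewrite t0 !tN; ring.
have hs d : holomorphic (fun z => theta (z + d)) by exact: (holo_shift (c := d) (holo_theta theta_odd)).
have hh d d' k : holomorphic (fun z => theta (z + d) * theta (z + d') * k).
  exact: (holoM (holoM (hs d) (hs d')) (@holo_cst R k)).
(* The expression is holomorphic in [c] and in [t], so the two conditions are removed one after the
   other. *)
have main2 t' : theta t' != 0 -> 
  theta (a + 2 * b + c + t') * theta a * theta t' * theta c
  - theta (a + b + c + t') * theta (a + b) * theta (b + t') * theta (b + c)
  + theta (a + b + t') * theta (a + b + c) * theta (b + c + t') * theta b = 0.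
  move=> tn; pose f z :=
    theta (z + (a + 2 * b + t')) * theta (z + 0) * (theta a * theta t')
    + theta (z + (a + b + t')) * theta (z + b) * (- (theta (a + b) * theta (b + t')))
    + theta (z + (a + b)) * theta (z + (b + t')) * (theta (a + b + t') * theta b).
  have hf : holomorphic f.
    exact: (holoD (holoD (hh (a + 2 * b + t') 0 _) (hh (a + b + t') b _))
      (hh (a + b) (b + t') _)).
  have fE z : f z = theta (a + 2 * b + z + t') * theta a * theta t' * theta z
  - theta (a + b + z + t') * theta (a + b) * theta (b + t') * theta (b + z)
  + theta (a + b + t') * theta (a + b + z) * theta (b + z + t') * theta b.
    rewrite /f addr0.
    have -> : a + 2 * b + z + t' = z + (a + 2 * b + t') by ring.
    have -> : a + b + z + t' = z + (a + b + t') by ring.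
    have -> : a + b + z = z + (a + b) by ring.
    have -> : b + z + t' = z + (b + t') by ring.
    by rewrite (addrC b z); ring.
  rewrite -fE; apply: (theta_extend (c := 0) hf) => z; rewrite addr0 => zn.
  by rewrite fE; exact: main.
pose f z :=
    theta (z + (a + 2 * b + c)) * theta (z + 0) * (theta a * theta c)
    + theta (z + (a + b + c)) * theta (z + b) * (- (theta (a + b) * theta (b + c)))
    + theta (z + (a + b)) * theta (z + (b + c)) * (theta (a + b + c) * theta b).
have hf : holomorphic f.
  exact: (holoD (holoD (hh (a + 2 * b + c) 0 _) (hh (a + b + c) b _))
    (hh (a + b) (b + c) _)).
have fE z : f z = theta (a + 2 * b + c + z) * theta a * theta z * theta c
  - theta (a + b + c + z) * theta (a + b) * theta (b + z) * theta (b + c)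
  + theta (a + b + z) * theta (a + b + c) * theta (b + c + z) * theta b.
  by rewrite /f addr0 !(addrC _ z); ring.
rewrite -fE; apply: (theta_extend (c := 0) hf) => z; rewrite addr0 => zn.
by rewrite fE; exact: main2.
Qed.

End ThetaZeros.

(** * The star-triangle relation *)

Section VertexIdentities.
Variables (K : fieldType) (th : K -> K) (e : K).
Hypothesis th_odd : forall x, th (- x) = - th x.
Hypothesis th_three_term : forall a b c t,
  th (a + 2 * b + c + t) * th a * th t * th c
  - th (a + b + c + t) * th (a + b) * th (b + t) * th (b + c)
  + th (a + b + t) * th (a + b + c) * th (b + c + t) * th b = 0.

(** The equations on [x1], ..., [x8] are discharged by [ring], so that the arguments of [th] can be
    prescribed in whatever form the goal has them. *)
Lemma three_term_eq a b c t x1 x2 x3 x4 x5 x6 x7 x8 :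
  a + 2 * b + c + t = x1 -> a + b + c + t = x2 -> a + b = x3 -> b + t = x4 ->
  b + c = x5 -> a + b + t = x6 -> a + b + c = x7 -> b + c + t = x8 ->
  th x1 * th a * th t * th c = th x2 * th x3 * th x4 * th x5 - th x6 * th x7 * th x8 * th b.
Proof.
move=> <- <- <- <- <- <- <- <-; apply/eqP; rewrite -subr_eq0; apply/eqP.
by rewrite -[RHS](th_three_term a b c t); ring.
Qed.

(** With [z] equal to plus or minus [hbar * d], [wb] and [wc] each cover two of the Boltzmann
    weights, the oddness of theta absorbing the signs. *)
Definition wa x := th (x + e).
Definition wb x z := th x * th (z + e) / th z.
Definition wc x z := th (x + z) * th e / th z.

(* The suffixes list the types of the weights in a single-term side, or in one of
   the terms when both sides have two. *)
Lemma star_triangle_aaa A B : wa A * wa B * wa (A - B) = wa (A - B) * wa B * wa A.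
Proof. by ring. Qed.

Lemma star_triangle_aac A B z : th z != 0 -> th (z + e) != 0 ->
  wc A (- z) * wb B (z + e) * wb (A - B) (- (z + e))
    + wa A * wc B (- (z + e)) * wc (A - B) (- (z + e))
  = wa (A - B) * wa B * wc A (- (z + e)).
Proof.
move=> n0 n1; rewrite /wa /wb /wc.
have -> : - (z + e) + e = - z by ring.
rewrite !th_odd.
have := @three_term_eq B (- (z + e)) (z + e + e) (A - B) (A - z) (A + e) (B - (z + e))
  (A - B - (z + e)) e (A - (z + e)) (B + e) (A - B + e).
do 8![move/(_ ltac:(ring))]; rewrite th_odd => T.
apply/eqP; rewrite -subr_eq0; apply/eqP.
transitivity (- th e / th (z + e) ^+ 2 * (th (A - z) * th B * th (A - B) * th (z + e + e)
  - (th (A + e) * th (B - (z + e)) * th (A - B - (z + e)) * th e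
   - th (A - (z + e)) * th (B + e) * th (A - B + e) * - th (z + e)))).
  by field; rewrite ?oppr_eq0 ?n0 ?n1.
by rewrite T subrr mulr0.
Qed.

Lemma star_triangle_acb A B z : th z != 0 -> th (z + e) != 0 ->
  wc A (- z) * wb B (z + e) * wc (A - B) (z + e)
    + wa A * wc B (- (z + e)) * wb (A - B) (z + e)
  = wa (A - B) * wc B (- z) * wb A (z + e).
Proof.
move=> n0 n1; rewrite /wa /wb /wc !th_odd.
have := @three_term_eq B (- (z + e)) e (A - B + (z + e)) (A - z) (A + e) (B - (z + e))
  (A - B) (- z) A (B - z) (A - B + e).
do 8![move/(_ ltac:(ring))]; rewrite !th_odd => T.
apply/eqP; rewrite -subr_eq0; apply/eqP.
transitivity (- th (z + e + e) * th e / (th z * th (z + e) ^+ 2) *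
  (th (A - z) * th B * th (A - B + (z + e)) * th e
  - (th (A + e) * th (B - (z + e)) * th (A - B) * - th z
   - th A * th (B - z) * th (A - B + e) * - th (z + e)))).
  by field; rewrite ?oppr_eq0 ?n0 ?n1.
by rewrite T subrr mulr0.
Qed.

Lemma star_triangle_cab A B z : th z != 0 -> th (z + e) != 0 ->
  wc A (- z) * wc B (z + e) * wb (A - B) (- (z + e))
    + wa A * wb B (- (z + e)) * wc (A - B) (- (z + e))
  = wc (A - B) (- z) * wa B * wb A (- (z + e)).
Proof.
move=> n0 n1; rewrite /wa /wb /wc.
have -> : - (z + e) + e = - z by ring.
rewrite !th_odd.
have := @three_term_eq (B + (z + e)) (- (z + e)) e (A - B) (A - z) (A + e) B
  (A - B - (z + e)) (- z) A (B + e) (A - B - z).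
do 8![move/(_ ltac:(ring))]; rewrite !th_odd => T.
apply/eqP; rewrite -subr_eq0; apply/eqP.
transitivity (- th e / th (z + e) ^+ 2 *
  (th (A - z) * th (B + (z + e)) * th (A - B) * th e
  - (th (A + e) * th B * th (A - B - (z + e)) * - th z
   - th A * th (B + e) * th (A - B - z) * - th (z + e)))).
  by field; rewrite ?oppr_eq0 ?n0 ?n1.
by rewrite T subrr mulr0.
Qed.

(** Both sides contain a multiple of [th (A + e) * th B * th (A - B)]. [T1], an identity in [z]
    alone, evaluates the difference of the two coefficients as a multiple of [th (z + (z + e))], and
    [T2] turns the resulting product into the terms of type c. *)
Lemma star_triangle_abb A B z : th z != 0 -> th (z + e) != 0 ->
  wc A (- z) * wc B (z + e) * wc (A - B) (z + e)
    + wa A * wb B (- (z + e)) * wb (A - B) (z + e)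
  = wb (A - B) z * wb B (- z) * wa A + wc (A - B) (- z) * wc B (- z) * wc A (z + e).
Proof.
move=> n0 n1; rewrite /wa /wb /wc.
have -> : - (z + e) + e = - z by ring.
have -> : - z + e = - (z - e) by ring.
rewrite !th_odd.
have := @three_term_eq z (- (z + e)) (z + e + e) z z (z + (z + e)) (- e) (- e) e
  (z - e) (z + e) (z + e).
do 8![move/(_ ltac:(ring))]; rewrite !th_odd => T1.
have := @three_term_eq B (- z) (z + (z + e)) (A - B) (A + e) (A + (z + e)) (B - z)
  (A - B - z) (z + e) (A - z) (B + (z + e)) (A - B + (z + e)).
do 8![move/(_ ltac:(ring))]; rewrite !th_odd => T2.
apply/eqP; rewrite -subr_eq0; apply/eqP.
transitivity ((th (A + e) * th B * th (A - B) *
  (th z * th z * th z * th (z + e + e)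
   - (th (z + (z + e)) * - th e * - th e * th e
      - th (z - e) * th (z + e) * th (z + e) * - th (z + e)))
  + th e ^+ 3 * (th (A + e) * th B * th (A - B) * th (z + (z + e))
   - (th (A + (z + e)) * th (B - z) * th (A - B - z) * th (z + e)
      - th (A - z) * th (B + (z + e)) * th (A - B + (z + e)) * - th z)))
  / (th z ^+ 2 * th (z + e) ^+ 2)).
  by field; rewrite ?oppr_eq0 ?n0 ?n1.
by rewrite T1 T2 !subrr !mulr0 addr0 mul0r.
Qed.

Lemma star_triangle_caa A B z : th z != 0 -> th (z - e) != 0 ->
  wc A (- z) * wa B * wa (A - B)
  = wb (A - B) z * wb B (- z) * wc A (- (z - e)) + wc (A - B) (- z) * wc B (- z) * wa A.
Proof.
move=> n0 n1; rewrite /wa /wb /wc.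
have -> : - z + e = - (z - e) by ring.
rewrite !th_odd.
have := @three_term_eq (B + e) (- (z + e)) z (A - B + e) (A - z) (A + e) (B - z)
  (A - B - z) (- e) (A - (z - e)) B (A - B).
do 8![move/(_ ltac:(ring))]; rewrite !th_odd => T.
apply/eqP; rewrite -subr_eq0; apply/eqP.
transitivity (- th e / th z ^+ 2 *
  (th (A - z) * th (B + e) * th (A - B + e) * th z
  - (th (A + e) * th (B - z) * th (A - B - z) * - th e
   - th (A - (z - e)) * th B * th (A - B) * - th (z + e)))).
  by field; rewrite ?oppr_eq0 ?n0 ?n1.
by rewrite T subrr mulr0.
Qed.

Lemma star_triangle_bac A B z : th z != 0 -> th (z + e) != 0 ->
  wb A (- z) * wa B * wc (A - B) (z + e)
  = wc (A - B) z * wb B (- z) * wa A + wb (A - B) (- z) * wc B (- z) * wc A (z + e).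
Proof.
move=> n0 n1; rewrite /wa /wb /wc.
have -> : - z + e = - (z - e) by ring.
rewrite !th_odd.
have := @three_term_eq (B + e) (- (z + e)) z (A - B + (z + e)) A (A + (z + e)) (B - z)
  (A - B) (- e) (A + e) B (A - B + z).
do 8![move/(_ ltac:(ring))]; rewrite !th_odd => T.
apply/eqP; rewrite -subr_eq0; apply/eqP.
transitivity (th e * th (z - e) / (th z ^+ 2 * th (z + e)) *
  (th A * th (B + e) * th (A - B + (z + e)) * th z
  - (th (A + (z + e)) * th (B - z) * th (A - B) * - th e
   - th (A + e) * th B * th (A - B + z) * - th (z + e)))).
  by field; rewrite ?oppr_eq0 ?n0 ?n1.
by rewrite T subrr mulr0.
Qed.

Lemma star_triangle_bca A B z : th z != 0 -> th (z - e) != 0 ->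
  wb A (- z) * wc B (- (z - e)) * wa (A - B)
  = wc (A - B) z * wb B (- z) * wc A (- (z - e)) + wb (A - B) (- z) * wc B (- z) * wa A.
Proof.
move=> n0 n1; rewrite /wa /wb /wc.
have -> : - z + e = - (z - e) by ring.
rewrite !th_odd.
have := @three_term_eq (B - (z - e)) (- e) z (A - B + e) A (A + e) (B - z)
  (A - B) (z - e) (A - (z - e)) B (A - B + z).
do 8![move/(_ ltac:(ring))]; rewrite !th_odd => T.
apply/eqP; rewrite -subr_eq0; apply/eqP.
transitivity (- th e / th z ^+ 2 *
  (th A * th (B - (z - e)) * th (A - B + e) * th z
  - (th (A + e) * th (B - z) * th (A - B) * th (z - e)
   - th (A - (z - e)) * th B * th (A - B + z) * - th e))).
  by field; rewrite ?oppr_eq0 ?n0 ?n1.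
by rewrite T subrr mulr0.
Qed.

Lemma star_triangle_bab A B z :
  wb A (- z) * wa B * wb (A - B) (- (z + e)) = wb (A - B) (- z) * wa B * wb A (- (z + e)).
Proof. by rewrite /wa /wb; ring. Qed.

Lemma star_triangle_bba A B z :
  wb A (- z) * wb B (- (z - e)) * wa (A - B) = wa (A - B) * wb B (- z) * wb A (- (z - e)).
Proof. by rewrite /wa /wb; ring. Qed.

End VertexIdentities.

Section Weights.
Variables (K : fieldType) (th : K -> K) (e lam : K).
Local Notation wa := (wa th e).
Local Notation wb := (wb th e).
Local Notation wc := (wc th e).
Implicit Types (A B x : K) (a b c d p q g : int).

(* Heights are recorded as integers, relative to the height lam / e of the upper
   left face; [hz k] is e times the actual height. *)
Definition hz (k : int) : K := lam + k%:~R * e.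

Definition wt x a b c d : K :=
  if [&& a == d + 1, b == d + 2 & c == d + 1]
     || [&& a == d - 1, b == d - 2 & c == d - 1] then wa x
  else if [&& a == d - 1, b == d & c == d + 1] then wb x (hz d)
  else if [&& a == d + 1, b == d & c == d - 1] then wb x (- hz d)
  else if [&& a == d - 1, b == d & c == d - 1] then wc x (hz d)
  else if [&& a == d + 1, b == d & c == d + 1] then wc x (- hz d)
  else 0.

Definition adj a b := (a == b + 1) || (b == a + 1).

(** Heights that are not adjacent get weight 0, so sums may run over all heights without an
    adjacency constraint. *)
Lemma wt_adj x a b c d : wt x a b c d != 0 ->
  [&& adj a b, adj b c, adj c d & adj d a].
Proof.
rewrite /wt /adj; case: ifP => [h _|_]; first by lia.
case: ifP => [h _|_]; first by lia.
case: ifP => [h _|_]; first by lia.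
case: ifP => [h _|_]; first by lia.
case: ifP => [h _|_]; first by lia.
by rewrite eqxx.
Qed.

Lemma wt_eq0 x a b c d : ~~ [&& adj a b, adj b c, adj c d & adj d a] ->
  wt x a b c d = 0.
Proof. by apply: contraNeq; exact: wt_adj. Qed.

Lemma adjC a b : adj a b = adj b a.
Proof. exact: orbC. Qed.

Lemma adjE a b : adj a b -> b = a + 1 \/ b = a - 1.
Proof. by rewrite /adj; lia. Qed.

Lemma wt_a x a b c d : a = d + 1 -> b = d + 2 -> c = d + 1 -> wt x a b c d = wa x.
Proof. by move=> -> -> ->; rewrite /wt ifT//; lia. Qed.

Lemma wt_b x a c d : a = d - 1 -> c = d + 1 -> wt x a d c d = wb x (hz d).
Proof.
move=> -> ->; rewrite /wt ifF; last by lia.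
by rewrite ifT//; lia.
Qed.

Lemma wt_bN x a c d : a = d + 1 -> c = d - 1 -> wt x a d c d = wb x (- hz d).
Proof.
move=> -> ->; rewrite /wt ifF; last by lia.
rewrite ifF; last by lia.
by rewrite ifT//; lia.
Qed.

Lemma wt_cN x a c d : a = d + 1 -> c = d + 1 -> wt x a d c d = wc x (- hz d).
Proof.
move=> -> ->; rewrite /wt ifF; last by lia.
rewrite ifF; last by lia.
rewrite ifF; last by lia.
rewrite ifF; last by lia.
by rewrite ifT//; lia.
Qed.

End Weights.

Section StarTriangle.
Variables (K : fieldType) (th : K -> K) (e : K).
Hypothesis th_odd : forall x, th (- x) = - th x.
Hypothesis th_three_term : forall a b c t,
  th (a + 2 * b + c + t) * th a * th t * th c
  - th (a + b + c + t) * th (a + b) * th (b + t) * th (b + c)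
  + th (a + b + t) * th (a + b + c) * th (b + c + t) * th b = 0.
Local Notation wa := (wa th e).
Local Notation wb := (wb th e).
Local Notation wc := (wc th e).
Implicit Types (A B x lam : K) (a b c d p q g : int).

Lemma hz_shift lam p a : hz e lam (p + a) = hz e (hz e lam p) a.
Proof. by rewrite /hz intrD; ring. Qed.

Lemma wt_shift lam p x a b c d :
  wt th e lam x (p + a) (p + b) (p + c) (p + d) = wt th e (hz e lam p) x a b c d.
Proof.
have E k l m : (p + k == p + l + m) = (k == l + m) by rewrite -addrA (inj_eq (addrI p)).
by rewrite /wt !E !(inj_eq (addrI p)) !hz_shift.
Qed.

(** For closed integer heights the tests in [wt] are decided by computation. *)
Ltac wt_eval := rewrite /wt; repeat match goal with |- context [if ?b then _ else _] =>
   let v := eval vm_compute in b in change b with v; cbv iota end;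
   repeat match goal with |- context [hz ?e ?l ?k] =>
     let v := eval vm_compute in k in progress change (hz e l k) with (hz e l v) end.

(** Uses an identity at [z = - lam], which amounts to reversing the signs of all heights; this may
    permute the two terms of a side. *)
Ltac mirror L EN EN' :=
  let H := fresh in have H := L; rewrite ?EN ?EN' !opprK in H;
  first [ exact: H | rewrite [RHS]addrC; exact: H | rewrite addrC; exact: H
        | rewrite addrC [RHS]addrC; exact: H ].

(** A closed walk of six unit steps around the hexagon has three steps up and three down: twenty
    cases, paired by reversal of signs. The ten identities treat one case of each pair, and [mirror]
    the other. *)
Lemma star_triangle_at0 A B lam q0 g2 q2 p2 g :
  adj 0 q0 -> adj q0 g2 -> adj g2 q2 -> adj q2 p2 -> adj p2 g -> adj g 0 ->
  all (fun k => th (hz e lam k) != 0) [:: 0; q0; g2; q2; p2; g] ->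
  let F y := wt th e lam A q0 0 g y * wt th e lam B y g p2 q2
    * wt th e lam (A - B) g2 q0 y q2 in
  let G y := wt th e lam (A - B) y 0 g p2 * wt th e lam B q0 0 y g2
    * wt th e lam A g2 y p2 q2 in
  F (q0 - 1) + F (q0 + 1) = G (0 - 1) + G (0 + 1).
Proof.
have hz0 : hz e lam 0 = lam by rewrite /hz mul0r addr0.
have hz1 : hz e lam 1 = lam + e by rewrite /hz mul1r.
have hzN1 : hz e lam (Negz 0) = lam - e by rewrite /hz NegzE mulN1r.
move=> /adjE h1 /adjE h2 /adjE h3 /adjE h4 /adjE h5 h6.
rewrite /= andbT => /and5P[n0 n1 n2 n3 /andP[n4 n5]] /=.
case: h1 n1 h2 => -> n1 h2; case: h2 n2 h3 => -> n2 h3; case: h3 n3 h4 => -> n3 h4;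
case: h4 n4 h5 => -> n4 h5; case: h5 n5 h6 => -> n5 h6; try by [].
all: move: n0 n1 n2 n3 n4 n5 {h6}; wt_eval.
all: rewrite ?hz0 ?hz1 ?hzN1 ?mulr0 ?mul0r ?addr0 ?add0r ?opprK => n0 n1 n2 n3 n4 n5.
all: try solve [ exact: star_triangle_aaa | exact: star_triangle_aac | exact: star_triangle_acb
  | exact: star_triangle_cab | exact: star_triangle_abb | exact: star_triangle_caa
  | exact: star_triangle_bab | exact: star_triangle_bac | exact: star_triangle_bca
  | exact: star_triangle_bba ].
all: have m0 : th (- lam) != 0 by rewrite th_odd oppr_eq0.
all: have EN : - lam + e = - (lam - e) by rewrite opprB addrC.
all: have EN' : - lam - e = - (lam + e) by rewrite opprD.
all: try (have m1 : th (- lam + e) != 0 by rewrite EN th_odd oppr_eq0).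
all: try (have m2 : th (- lam - e) != 0 by rewrite EN' th_odd oppr_eq0).
all: first
  [ mirror (star_triangle_aac th_odd th_three_term A B m0 m1) EN EN'
  | mirror (star_triangle_acb th_odd th_three_term A B m0 m1) EN EN'
  | mirror (star_triangle_cab th_odd th_three_term A B m0 m1) EN EN'
  | mirror (star_triangle_abb th_odd th_three_term A B m0 m1) EN EN'
  | mirror (star_triangle_caa th_odd th_three_term A B m0 m2) EN EN'
  | mirror (@star_triangle_bab _ th e A B (- lam)) EN EN'
  | mirror (star_triangle_bac th_odd th_three_term A B m0 m1) EN EN'
  | mirror (star_triangle_bca th_odd th_three_term A B m0 m2) EN EN'
  | mirror (@star_triangle_bba _ th e A B (- lam)) EN EN' ].
Qed.

(* Both sides are sums over the two possible heights of the face in the middle of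
   a hexagon of faces. *)
Lemma star_triangle A B lam p0 q0 g2 q2 p2 g :
  adj p0 q0 -> adj q0 g2 -> adj g2 q2 -> adj q2 p2 -> adj p2 g -> adj g p0 ->
  all (fun k => th (hz e lam k) != 0) [:: p0; q0; g2; q2; p2; g] ->
  let F y := wt th e lam A q0 p0 g y * wt th e lam B y g p2 q2
    * wt th e lam (A - B) g2 q0 y q2 in
  let G y := wt th e lam (A - B) y p0 g p2 * wt th e lam B q0 p0 y g2
    * wt th e lam A g2 y p2 q2 in
  F (q0 - 1) + F (q0 + 1) = G (p0 - 1) + G (p0 + 1).
Proof.
have E k : k = p0 + (k - p0) by rewrite addrC subrK.
have adjB k l : adj k l = adj (k - p0) (l - p0) by rewrite /adj; lia.
move=> h1 h2 h3 h4 h5 h6 hall F G.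
have -> : q0 - 1 = p0 + (q0 - p0 - 1) by ring.
have -> : q0 + 1 = p0 + (q0 - p0 + 1) by ring.
have -> : p0 - 1 = p0 + (0 - 1) by ring.
have -> : p0 + 1 = p0 + (0 + 1) by ring.
have e0 : p0 = p0 + 0 by rewrite addr0.
have WE x a b c d : wt th e lam x a b c d =
    wt th e (hz e lam p0) x (a - p0) (b - p0) (c - p0) (d - p0).
  by rewrite -wt_shift -!E.
have ZE k : hz e lam k = hz e (hz e lam p0) (k - p0) by rewrite -hz_shift -E.
have PK k : p0 + k - p0 = k by rewrite addrC addKr.
rewrite /F /G !WE !PK subrr.
apply: star_triangle_at0; rewrite -?(subrr p0) -?adjB//.
by move: hall; rewrite /= {1}(ZE p0) subrr (ZE q0) (ZE g2) (ZE q2) (ZE p2) (ZE g).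
Qed.

End StarTriangle.

(** * Row-to-row transfer and symmetry in v *)

Section PathSum.
Variables (K : comNzRingType) (H : finType) (M : nat -> H -> H -> K) (x0 : H).

(** The entry [(x0, x)] of the product of [M 0], ..., [M n.-1]. It serves at two levels: for the
    lines of a configuration, and for the heights of one line along two adjacent rows. *)
Fixpoint pathsum n x : K :=
  if n is m.+1 then \sum_y pathsum m y * M m y x else (x == x0)%:R.

Lemma pathsumE n x :
  \sum_(f : {ffun 'I_n.+1 -> H} | (f ord0 == x0) && (f ord_max == x))
    \prod_(i < n) M i (f (inord i)) (f (inord i.+1)) = pathsum n x.
Proof.
elim: n x => [|n IH] x.
  under eq_bigr do rewrite big_ord0.
  have E : (@ord_max 0) = ord0 by apply/val_inj.
  rewrite /= E; have [->|xne] := eqVneq x x0.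
    rewrite (bigD1 [ffun=> x0]) /=; last by rewrite ffunE eqxx.
    rewrite big1 ?addr0// => f /andP[/andP[/eqP f0 _] /eqP[]].
    by apply/ffunP => i; rewrite ffunE (ord1 i).
  rewrite big_pred0// => f; apply/negP => /andP[/eqP-> /eqP e].
  by rewrite e eqxx in xne.
pose ext (p : {ffun 'I_n.+1 -> H} * H) : {ffun 'I_n.+2 -> H} :=
  [ffun i => if unlift ord_max i is Some j then p.1 j else p.2].
pose res (f : {ffun 'I_n.+2 -> H}) :=
  ([ffun i : 'I_n.+1 => f (lift ord_max i)], f ord_max).
have extK : cancel ext res.
  move=> [p h]; rewrite /res /ext /= ffunE unlift_none; congr pair.
  by apply/ffunP => i; rewrite !ffunE liftK.
have resK : cancel res ext.
  move=> f; apply/ffunP => i; rewrite /ext ffunE /=.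
  by case: (unliftP ord_max i) => [j ->|->]; rewrite ?ffunE.
rewrite (reindex ext) /=; last by exists res => ? _.
have ext_lt p h (i : nat) : (i < n.+1)%N -> ext (p, h) (inord i) = p (inord i).
  move=> hi; rewrite /ext ffunE /=.
  have -> : inord i = lift ord_max (inord i : 'I_n.+1) :> 'I_n.+2.
    apply/val_inj; rewrite /= /bump inordK ?inordK//; last exact: ltnW.
    by rewrite leqNgt hi add0n.
  by rewrite liftK.
have ext_max p h : ext (p, h) (inord n.+1) = h.
  rewrite /ext ffunE /=.
  have -> : inord n.+1 = ord_max :> 'I_n.+2 by apply/val_inj; rewrite /= inordK.
  by rewrite unlift_none.
have ord0E m : ord0 = inord 0 :> 'I_m.+1 by apply/val_inj; rewrite /= inordK.
have ordmE m : ord_max = inord m :> 'I_m.+1 by apply/val_inj; rewrite /= inordK.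
transitivity (\sum_(p : {ffun 'I_n.+1 -> H} * H | (p.1 ord0 == x0) && (p.2 == x))
    (\prod_(i < n) M i (p.1 (inord i)) (p.1 (inord i.+1))) * M n (p.1 ord_max) p.2).
  apply: eq_big => [[p h]|[p h] _] /=.
    by rewrite ord0E ordmE ext_lt// ext_max -ord0E.
  rewrite big_ord_recr /= ext_lt// ext_max -ordmE; congr (_ * _).
  by apply: eq_bigr => i _; rewrite !ext_lt ?ltnS ?ltn_ord ?(ltnW (ltn_ord i)).
rewrite -(pair_big_dep (fun p : {ffun 'I_n.+1 -> H} => p ord0 == x0) (fun _ h => h == x)
  (fun p h => (\prod_(i < n) M i (p (inord i)) (p (inord i.+1))) * M n (p ord_max) h)) /=.
under eq_bigr do rewrite big_pred1_eq.
rewrite (partition_big (fun p : {ffun 'I_n.+1 -> H} => p ord_max) predT) //=.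
apply: eq_bigr => y _; rewrite -IH mulr_suml.
by apply: eq_big => // p /andP[_ /eqP->].
Qed.

End PathSum.

Section RowSwap.
Variables (K : fieldType) (th : K -> K) (e lam : K) (N : nat).
Hypothesis th_odd : forall x, th (- x) = - th x.
Hypothesis th_three_term : forall a b c t,
  th (a + 2 * b + c + t) * th a * th t * th c
  - th (a + b + c + t) * th (a + b) * th (b + t) * th (b + c)
  + th (a + b + t) * th (a + b + c) * th (b + c + t) * th b = 0.
Hypothesis hz_neq0 : forall k : int, 0 <= k -> th (hz e lam k) != 0.
Local Notation wt := (wt th e lam).
Local Notation H := 'I_N.+1.
Implicit Types (g h : H).

(** For [q = 0] the lower neighbour - 1 is outside the index set, hence the last condition on
    [F]. *)
Lemma sum_adjacent (q : int) (F : int -> K) : 0 <= q -> q + 1 < N.+1%:Z ->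
  (forall y, F y != 0 -> adj q y) -> (q = 0 -> F (- 1) = 0) ->
  \sum_(y : H) F (y : nat)%:Z = F (q - 1) + F (q + 1).
Proof.
move=> q0 qN Fadj F0.
have hi : (`|q|%N.+1 < N.+1)%N by lia.
have iE : ((inord `|q|%N.+1 : H) : nat)%:Z = q + 1 by rewrite inordK//; lia.
rewrite (bigD1 (inord `|q|%N.+1))//= iE addrC; congr (_ + _).
have [qz|qnz] := eqVneq q 0.
  rewrite big1 => [|y yne]; first by rewrite {1}qz sub0r F0.
  apply/eqP/negPn/negP => /Fadj; rewrite /adj => ha.
  by move/eqP: yne; apply; apply/val_inj; rewrite /= inordK//; lia.
have hi' : (`|q|%N.-1 < N.+1)%N by lia.
have iE' : ((inord `|q|%N.-1 : H) : nat)%:Z = q - 1 by rewrite inordK//; lia.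
rewrite (bigD1 (inord `|q|%N.-1))/=; last first.
  by apply/eqP => /(congr1 val); rewrite /= !inordK//; lia.
rewrite iE' big1 ?addr0// => y /andP[y1 y2].
apply/eqP/negPn/negP => /Fadj; rewrite /adj => ha.
have [e1|e1] : (y : nat)%:Z = q + 1 \/ (y : nat)%:Z = q - 1 by lia.
  by move/eqP: y1; apply; apply/val_inj; rewrite /= inordK//; lia.
by move/eqP: y2; apply; apply/val_inj; rewrite /= inordK//; lia.
Qed.

(** The strict positivity of one height in each pair excludes - 1 as a middle height, and the upper
    bounds keep the other choice within ['I_N.+1]. *)
Lemma star_triangle_sum A B (p0 q0 p2 q2 : int) g h :
  0 <= p0 -> 0 <= q0 -> 0 <= p2 -> 0 <= q2 -> (0 < p0) || (0 < p2) ->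
  (0 < q0) || (0 < q2) -> p0 + 1 < N.+1%:Z -> q0 + 1 < N.+1%:Z ->
  \sum_(y : H) wt A q0 p0 (g : nat)%:Z (y : nat)%:Z * wt B (y : nat)%:Z (g : nat)%:Z p2 q2
    * wt (A - B) (h : nat)%:Z q0 (y : nat)%:Z q2 =
  \sum_(y : H) wt (A - B) (y : nat)%:Z p0 (g : nat)%:Z p2
    * (wt B q0 p0 (y : nat)%:Z (h : nat)%:Z * wt A (h : nat)%:Z (y : nat)%:Z p2 q2).
Proof.
move=> p00 q00 p20 q20 pp qq pN qN.
set gz := (g : nat)%:Z; set hh := (h : nat)%:Z.
have gz0 : 0 <= gz by []. have hh0 : 0 <= hh by [].
pose F (y : int) := wt A q0 p0 gz y * wt B y gz p2 q2 * wt (A - B) hh q0 y q2.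
pose G (y : int) := wt (A - B) y p0 gz p2 * wt B q0 p0 y hh * wt A hh y p2 q2.
have Fadj y : F y != 0 -> [&& adj p0 q0, adj q0 hh, adj hh q2, adj q2 p2, adj p2 gz,
    adj gz p0, adj q0 y & adj y q2].
  rewrite /F !mulf_eq0 !negb_or => /andP[/andP[/wt_adj h1 /wt_adj h2] /wt_adj h3].
  move: h1 h2 h3 => /and4P[? ? ? ?] /and4P[? ? ? ?] /and4P[? ? ? ?].
  by do ![apply/andP; split]; first [assumption | rewrite adjC; assumption].
have Gadj y : G y != 0 -> [&& adj p0 q0, adj q0 hh, adj hh q2, adj q2 p2, adj p2 gz,
    adj gz p0, adj p0 y & adj y p2].
  rewrite /G !mulf_eq0 !negb_or => /andP[/andP[/wt_adj h1 /wt_adj h2] /wt_adj h3].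
  move: h1 h2 h3 => /and4P[? ? ? ?] /and4P[? ? ? ?] /and4P[? ? ? ?].
  by do ![apply/andP; split]; first [assumption | rewrite adjC; assumption].
rewrite -[LHS]/(\sum_(y : H) F (y : nat)%:Z).
rewrite [RHS](_ : _ = \sum_(y : H) G (y : nat)%:Z); last first.
  by apply: eq_bigr => y _; rewrite /G mulrA.
rewrite (sum_adjacent (q := q0))//; last 2 first.
- by move=> y /Fadj/and5P[_ _ _ _ /and4P[]].
- move=> q0z; apply/eqP/negPn/negP => /Fadj; rewrite /adj; lia.
rewrite (sum_adjacent (q := p0))//; last 2 first.
- by move=> y /Gadj/and5P[_ _ _ _ /and4P[]].
- move=> q0z; apply/eqP/negPn/negP => /Gadj; rewrite /adj; lia.
have [hex|nhex] := boolP [&& adj p0 q0, adj q0 hh, adj hh q2, adj q2 p2, adj p2 gz & adj gz p0].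
  move: hex => /and5P[a1 a2 a3 a4 /andP[a5 a6]].
  by apply: star_triangle => //=; rewrite !hz_neq0.
have F0 y : F y = 0.
  by apply/eqP/negPn/negP => /Fadj h0; apply/negP: nhex; lia.
have G0 y : G y = 0.
  by apply/eqP/negPn/negP => /Gadj h0; apply/negP: nhex; lia.
by rewrite !F0 !G0.
Qed.

End RowSwap.

Section Lines.
Variables (K : fieldType) (th : K -> K) (e lam : K) (N : nat).
Local Notation wt := (wt th e lam).
Local Notation H := 'I_N.+1.
Implicit Types (n i j : nat) (u : nat -> K) (v : K) (g h : H).

Definition line n := {ffun 'I_n.+1 -> H}.

Definition lh n (r : line n) i : int := (r (inord i) : nat)%:Z.

(* The heights of a configuration with domain wall boundary conditions, taken
   relative to the height of the upper left face, satisfy these bounds on the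
   j-th horizontal line of faces; in particular they are nonnegative. *)
Definition allowed n j (r : line n) : bool :=
  [&& lh r 0 == j%:Z, lh r n == n%:Z - j%:Z &
   [forall i : 'I_n.+1, [&& (i : nat)%:Z - j%:Z <= lh r i,
     j%:Z - (i : nat)%:Z <= lh r i & lh r i <= (i : nat)%:Z + j%:Z]]].

Lemma allowed_bounds n j (r : line n) i : allowed j r -> (i <= n)%N ->
  [&& i%:Z - j%:Z <= lh r i, j%:Z - i%:Z <= lh r i & lh r i <= i%:Z + j%:Z].
Proof.
move=> /and3P[_ _ /forallP ha] hi.
by have := ha (inord i); rewrite inordK.
Qed.

Definition rowT n u v (r r' : line n) : K :=
  \prod_(i < n) wt (u i - v) (lh r i.+1) (lh r i) (lh r' i) (lh r' i.+1).

(** Restricting to allowed lines loses no configuration and supplies the bounds under which the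
    star-triangle relation holds for truncated heights. *)
Definition rowM n u j v (r r' : line n) : K :=
  if allowed j r && allowed j.+1 r' then rowT u v r r' else 0.

Definition bottom_line n : line n := [ffun i : 'I_n.+1 => inord i].
Definition top_line n : line n := [ffun i : 'I_n.+1 => inord (n - i)].

(* Partition function with domain wall boundary conditions, the j-th matrix of the
   path sum transferring between the horizontal lines j and j + 1 of faces. *)
Definition dwbc n u (v : nat -> K) : K :=
  pathsum (fun j => @rowM n u j (v j)) (bottom_line n) n (top_line n).

Lemma rowT_adj n u v (r r' : line n) : (0 < n)%N -> rowT u v r r' != 0 ->
  (forall i, (i <= n)%N -> adj (lh r i) (lh r' i)) /\
  (forall i, (i < n)%N -> adj (lh r i.+1) (lh r i) /\ adj (lh r' i) (lh r' i.+1)).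
Proof.
move=> n0; rewrite /rowT => /prodf_neq0 hp.
have hv i : (i < n)%N -> wt (u i - v) (lh r i.+1) (lh r i) (lh r' i) (lh r' i.+1) != 0.
  by move=> hi; exact: (hp (Ordinal hi)).
split=> i hi; last by have /wt_adj/and4P[] := hv i hi.
have [->|ne] := eqVneq i n.
  have := hv n.-1; rewrite prednK// leqnn => /(_ isT)/wt_adj/and4P[_ _ _].
  by rewrite adjC.
have : (i < n)%N by rewrite ltn_neqAle ne.
by move=> /hv/wt_adj/and4P[].
Qed.

Hypothesis th_odd : forall x, th (- x) = - th x.
Hypothesis th_three_term : forall a b c t,
  th (a + 2 * b + c + t) * th a * th t * th c
  - th (a + b + c + t) * th (a + b) * th (b + t) * th (b + c)
  + th (a + b + t) * th (a + b + c) * th (b + c + t) * th b = 0.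
Hypothesis hz_neq0 : forall k : int, 0 <= k -> th (hz e lam k) != 0.

(** Transfer across column [i] of two adjacent rows, the outer lines [rm] and [rp] being fixed; the
    state is the height on the line between them. *)
Definition two_rows n u v v' (rm rp : line n) i g g' : K :=
  wt (u i - v) (lh rm i.+1) (lh rm i) (g : nat)%:Z (g' : nat)%:Z *
  wt (u i - v') (g' : nat)%:Z (g : nat)%:Z (lh rp i) (lh rp i.+1).

(** Only the end values of the middle line need to be imposed: its other bounds follow from
    adjacency with the allowed lines below and above. *)
Lemma two_rows_pathsum n u j v v' (rm rp : line n) :
  (j.+2 <= n)%N -> (n.*2 < N)%N -> allowed j rm -> allowed j.+2 rp ->
  \sum_(r : line n) rowM u j v rm r * rowM u j.+1 v' r rp =
  pathsum (two_rows u v v' rm rp) (inord j.+1) n (inord (n - j.+1)).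
Proof.
move=> jn nN am ap; rewrite -pathsumE [RHS]big_mkcond; apply: eq_bigr => r _.
have n0 : (0 < n)%N by lia.
have ord0E : ord0 = inord 0 :> 'I_n.+1 by apply/val_inj; rewrite /= inordK.
have ordmE : ord_max = inord n :> 'I_n.+1 by apply/val_inj; rewrite /= inordK.
have prodE : \prod_(i < n) two_rows u v v' rm rp i (r (inord i)) (r (inord i.+1)) =
    rowT u v rm r * rowT u v' r rp by rewrite -big_split.
have endE : (r ord0 == inord j.+1) && (r ord_max == inord (n - j.+1)) =
    (lh r 0 == j.+1%:Z) && (lh r n == n%:Z - j.+1%:Z).
  rewrite ord0E ordmE /lh; congr (_ && _); apply/eqP/eqP.
  - by move=> ->; rewrite inordK//; lia.
  - by move=> h; apply/val_inj; rewrite /= inordK; lia.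
  - by move=> ->; rewrite inordK//; lia.
  - by move=> h; apply/val_inj; rewrite /= inordK; lia.
rewrite prodE endE /rowM am ap /= andbT.
have [ar|nar] := boolP (allowed j.+1 r).
  by move: ar => /and3P[-> -> _].
rewrite mul0r; case: ifP => // /andP[h1 h2].
apply/esym/eqP/negPn/negP; rewrite mulf_eq0 negb_or => /andP[t1 t2].
have [a1 _] := rowT_adj n0 t1; have [a2 _] := rowT_adj n0 t2.
move: nar; rewrite /allowed h1 h2 /= => /forallP; apply => i.
have hi : (i <= n)%N by rewrite -ltnS.
have := allowed_bounds am hi; have := allowed_bounds ap hi.
by have := a1 _ hi; have := a2 _ hi; rewrite /adj; lia.
Qed.

Definition crossing v v' (rm rp : int) g h : K :=
  wt (v' - v) (h : nat)%:Z rm (g : nat)%:Z rp.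

(* The usual train argument: a crossing of the two rows is inserted on the left
   and carried through all columns by the star-triangle relation; at both ends of
   the rows it can only take the weight th (v' - v + e). *)
Lemma row_swap n u j v v' (rm rp : line n) : (j.+2 <= n)%N -> (n.*2 < N)%N ->
  th (v' - v + e) != 0 ->
  \sum_(r : line n) rowM u j v rm r * rowM u j.+1 v' r rp =
  \sum_(r : line n) rowM u j v' rm r * rowM u j.+1 v r rp.
Proof.
move=> jn nN k0.
have [am|nam] := boolP (allowed j rm); last first.
  by rewrite !big1// => r _; rewrite /rowM (negPf nam) mul0r.
have [ap|nap] := boolP (allowed j.+2 rp); last first.
  by rewrite !big1// => r _; rewrite /rowM (negPf nap) andbF mulr0.
rewrite !two_rows_pathsum//.
pose R i := crossing v v' (lh rm i) (lh rp i).
(* Between heights [a] and [a + 2] both remaining faces must have height [a + 1], so the crossing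
   has a weight of type a. *)
have forced (a : int) g h : a + 1 <= N%:Z -> crossing v v' a (a + 2) g h =
    (((g : nat)%:Z == a + 1) && ((h : nat)%:Z == a + 1))%:R * th (v' - v + e).
  move=> aN; case: (boolP (_ && _)) => [/andP[/eqP gE /eqP hE]|ne].
    by rewrite /crossing gE hE /wt mul1r ifT//; lia.
  rewrite mul0r; apply/eqP; apply: contraNT ne => /wt_adj; rewrite /adj; lia.
have main i : (i <= n)%N -> forall h,
    \sum_g pathsum (two_rows u v v' rm rp) (inord j.+1) i g * R i g h =
    th (v' - v + e) * pathsum (two_rows u v' v rm rp) (inord j.+1) i h.
  elim: i => [_|i IH hi] h /=.
    have rm0 : lh rm 0 = j%:Z by case/and3P: am => /eqP.
    have rp0 : lh rp 0 = j%:Z + 2 by case/and3P: ap => /eqP-> _ _; lia.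
    have E0 g : R 0%N g h = (((g : nat)%:Z == j%:Z + 1) && ((h : nat)%:Z == j%:Z + 1))%:R
        * th (v' - v + e) by rewrite /R rm0 rp0 forced//; lia.
    under eq_bigr do rewrite E0.
    rewrite (bigD1 (inord j.+1))//= big1 => [|g /negPf->]; last by rewrite mul0r.
    rewrite eqxx mul1r addr0 mulrC inordK; last by lia.
    have -> : (j.+1%:Z == j%:Z + 1) by lia.
    congr (_ * (nat_of_bool _)%:R); apply/eqP/eqP => [hE|->].
      by apply/val_inj; rewrite /= inordK; lia.
    by rewrite inordK; lia.
  under eq_bigr do rewrite mulr_suml.
  rewrite exchange_big /=.
  transitivity (\sum_g pathsum (two_rows u v v' rm rp) (inord j.+1) i g *
    \sum_y R i g y * two_rows u v' v rm rp i y h).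
    apply: eq_bigr => g _; under eq_bigr do rewrite -mulrA.
    rewrite -mulr_sumr; congr (_ * _).
    have B1 := allowed_bounds am hi; have B2 := allowed_bounds ap hi.
    have B3 := allowed_bounds am (ltnW hi); have B4 := allowed_bounds ap (ltnW hi).
    have E : u i - v - (u i - v') = v' - v by ring.
    rewrite /R /crossing /two_rows -E.
    apply: star_triangle_sum => //; lia.
  under [LHS]eq_bigr do rewrite mulr_sumr.
  rewrite exchange_big mulr_sumr /=; apply: eq_bigr => y _.
  under eq_bigr do rewrite mulrA.
  by rewrite -mulr_suml IH ?mulrA// ltnW.
apply: (mulfI k0); rewrite -main//.
have rmn : lh rm n = (n - j.+1)%N%:Z + 1 by case/and3P: am => _ /eqP-> _; lia.
have rpn : lh rp n = (n - j.+1)%N%:Z - 1 by case/and3P: ap => _ /eqP-> _; lia.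
have E g : R n g (inord (n - j.+1)) = (g == inord (n - j.+1))%:R * th (v' - v + e).
  rewrite /R /crossing rmn rpn inordK; last by lia.
  have [->|ne] := eqVneq g (inord (n - j.+1)).
    by rewrite inordK /wt ?mul1r ?ifT//; lia.
  rewrite mul0r; apply/eqP; apply: contraNT ne => /wt_adj; rewrite /adj => ha.
  by apply/eqP/val_inj; rewrite /= inordK; lia.
under [RHS]eq_bigr do rewrite E.
rewrite (bigD1 (inord (n - j.+1)))//= eqxx mul1r big1 => [|g /negPf->]; last by rewrite mul0r mulr0.
by rewrite addr0 mulrC.
Qed.

End Lines.

Lemma pathsum_ext (K : comNzRingType) (H : finType) (M M' : nat -> H -> H -> K) x0 n :
  (forall l, (l < n)%N -> M l =2 M' l) -> pathsum M x0 n =1 pathsum M' x0 n.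
Proof.
elim: n => [//|n IH] h x /=; apply: eq_bigr => y _.
by rewrite h// IH// => l hl; apply: h; exact: ltnW.
Qed.

(** Only the product of the matrices [j] and [j + 1] enters a path sum that runs past both. *)
Lemma pathsum_local (K : comNzRingType) (H : finType) (M M' : nat -> H -> H -> K) x0 j n :
  (forall l, l != j -> l != j.+1 -> M l =2 M' l) ->
  (forall x z, \sum_y M j x y * M j.+1 y z = \sum_y M' j x y * M' j.+1 y z) ->
  (j.+1 < n)%N -> pathsum M x0 n =1 pathsum M' x0 n.
Proof.
move=> hl hj; elim: n => [//|n IH]; rewrite ltnS leq_eqVlt => /orP[/eqP<-|jn] x.
  have two (L : nat -> H -> H -> K) : pathsum L x0 j.+2 x =
      \sum_z pathsum L x0 j z * \sum_y L j z y * L j.+1 y x.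
    rewrite /=; under eq_bigr do rewrite mulr_suml.
    rewrite exchange_big; apply: eq_bigr => z _; rewrite mulr_sumr.
    by apply: eq_bigr => y _; rewrite mulrA.
  rewrite !two; apply: eq_bigr => z _; rewrite hj; congr (_ * _).
  apply: pathsum_ext => l lj; apply: hl; first by rewrite ltn_eqF.
  by rewrite ltn_eqF// ltnW.
by rewrite /=; apply: eq_bigr => y _; rewrite IH// hl// gtn_eqF//; lia.
Qed.

(** * Holomorphy and symmetry of the path sum in the variables [v] *)

Section PartitionPathsum.
Variables (R : realType) (tau : R[i]) (theta : R[i] -> R[i]) (hbar lam : R[i]) (N : nat).
Hypothesis tau_gt0 : 0 < complex.Im tau.
Hypothesis theta_odd : odd_theta tau theta.
Hypothesis theta_neq0 : forall k : nat, theta (lam + k%:R * hbar) != 0.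
Local Notation wt := (wt theta hbar lam).
Local Notation hz := (hz hbar lam).
Local Notation rowM := (@rowM R[i] theta hbar lam N).
Local Notation dwbc := (dwbc theta hbar lam N).
Local Notation bottom_line := (bottom_line N).
Local Notation top_line := (top_line N).
Implicit Types (n i j : nat) (u v : nat -> R[i]).

Lemma hz_neq0 (k : int) : 0 <= k -> theta (hz k) != 0.
Proof. by case: k => // k _; exact: theta_neq0. Qed.

Lemma holo_theta_affine a b : holomorphic (fun z => theta (a * z + b)).
Proof.
exact: (@holo_scale _ (fun z => theta (z + b)) a (holo_shift (c := b) (holo_theta theta_odd))).
Qed.

Lemma wt_theta (k l m p : int) : exists y c, forall x, wt x k l m p = theta (x + y) * c.
Proof.
rewrite /wt /wa /wb /wc.
case: ([&& k == p + 1, l == p + 2 & m == p + 1]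
     || [&& k == p - 1, l == p - 2 & m == p - 1]).
  by exists hbar, 1 => x; rewrite mulr1.
case: [&& k == p - 1, l == p & m == p + 1].
  by exists 0, (theta (hz p + hbar) / theta (hz p)) => x; rewrite addr0 mulrA.
case: [&& k == p + 1, l == p & m == p - 1].
  by exists 0, (theta (- hz p + hbar) / theta (- hz p)) => x; rewrite addr0 mulrA.
case: [&& k == p - 1, l == p & m == p - 1].
  by exists (hz p), (theta hbar / theta (hz p)) => x; rewrite mulrA.
case: [&& k == p + 1, l == p & m == p + 1].
  by exists (- hz p), (theta hbar / theta (- hz p)) => x; rewrite mulrA.
by exists 0, 0 => x; rewrite mulr0.
Qed.

Lemma holo_wt_affine a b c (k l m p : int) :
  holomorphic (fun z => wt (c - (a * z + b)) k l m p).
Proof.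
have [y [d E]] := wt_theta k l m p; under eq_fun => z.
  rewrite E (_ : c - (a * z + b) + y = - a * z + (c - b + y)); last by ring.
  over.
exact: (holoM (@holo_theta_affine (- a) (c - b + y)) (@holo_cst R d)).
Qed.

(** Affine dependence of all [v_j] on [z] covers both the variation of a single [v_j] and the line
    along which general [v] are approached. *)
Lemma holo_dwbc n u (a b : nat -> R[i]) :
  holomorphic (fun z => dwbc n u (fun j => a j * z + b j)).
Proof.
suff H m x : holomorphic (fun z =>
    pathsum (fun j => @rowM n u j (a j * z + b j)) (bottom_line n) m x) by exact: H.
elim: m x => [|m IH] x; first exact: holo_cst.
apply: holo_sum => y; apply: (holoM (IH y)); rewrite /rowM.
case: (allowed m y && allowed m.+1 x); last exact: holo_cst.
apply: holo_prod => i.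
exact: holo_wt_affine.
Qed.

Lemma rowM_swap n u v j : (j.+2 <= n)%N -> (n.*2 < N)%N ->
  theta (v j.+1 - v j + hbar) != 0 ->
  dwbc n u v = dwbc n u (fun k => if k == j then v j.+1 else if k == j.+1 then v j else v k).
Proof.
move=> jn nN k0; pose w k := if k == j then v j.+1 else if k == j.+1 then v j else v k.
pose M k := @rowM n u k (v k); pose M' k := @rowM n u k (w k).
have hl l : l != j -> l != j.+1 -> M l =2 M' l.
  by rewrite /M /M' /w => /negPf-> /negPf->.
have hj x z : \sum_y M j x y * M j.+1 y z = \sum_y M' j x y * M' j.+1 y z.
  have th := thetaN theta_odd; have t3 := theta_three_term tau_gt0 theta_odd.
  have wj : w j = v j.+1 by rewrite /w eqxx.
  have wjS : w j.+1 = v j by rewrite /w eqxx gtn_eqF.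
  rewrite /M /M' wj wjS.
  exact: (row_swap th t3 hz_neq0 u x z jn nN k0).
exact: (pathsum_local (bottom_line n) hl hj jn (top_line n)).
Qed.

(* The vanishing crossing weights excluded in rowM_swap are reached by analytic
   continuation in v j.+1. *)
Lemma dwbc_swap n u v j : (j.+2 <= n)%N -> (n.*2 < N)%N ->
  dwbc n u v = dwbc n u (fun k => if k == j then v j.+1 else if k == j.+1 then v j else v k).
Proof.
move=> jn nN.
(* [v] with its entry [j.+1] replaced by [z], and below the same with the two entries exchanged,
   both in the affine form of [holo_dwbc]. *)
pose w z k := (k == j.+1)%:R * z + (if k == j.+1 then 0 else v k).
pose w' z k := (k == j)%:R * z + (if k == j then 0 else if k == j.+1 then v j else v k).
have jS : (j == j.+1) = false by rewrite ltn_eqF.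
have wE z k : w z k = if k == j.+1 then z else v k.
  by rewrite /w; case: eqP; rewrite ?mul1r ?mul0r ?addr0 ?add0r.
have w'E z k : w' z k = if k == j then w z j.+1 else if k == j.+1 then w z j else w z k.
  rewrite /w' !wE eqxx jS; case: (k == j); first by rewrite mul1r addr0.
  by rewrite mul0r add0r; case: ifP => // ->.
pose f z := dwbc n u (w z) + (- 1) * dwbc n u (w' z).
have hf : holomorphic f by apply: holoD; [|apply: holoZ]; exact: holo_dwbc.
have f0 : forall z, f z = 0.
  apply: (theta_extend tau_gt0 theta_odd (c := hbar - v j) hf) => z hz.
  rewrite /f mulN1r; apply/eqP; rewrite subr_eq0; apply/eqP.
  have k0 : theta (w z j.+1 - w z j + hbar) != 0.
    by rewrite !wE eqxx jS -addrA (addrC (- v j)).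
  rewrite (rowM_swap u jn nN k0); congr (dwbc n u _).
  by apply/funext => k; rewrite w'E.
have := f0 (v j.+1); rewrite /f mulN1r => /eqP; rewrite subr_eq0 => /eqP.
have -> : w (v j.+1) = v by apply/funext => k; rewrite wE; case: eqP => [->|].
move=> ->; congr dwbc; apply/funext => k; rewrite w'E !wE eqxx jS.
by case: (k == j) => //; case: eqP => // ->.
Qed.

End PartitionPathsum.

(** * Ellipticity and recursion of the partition function *)


Section ThetaSpaceAlgebra.
Variables (R : realType) (tau : R[i]).
Implicit Types (f g : R[i] -> R[i]) (s t c : R[i]).

Lemma theta_space_mul m n s t f g : theta_space tau m s f -> theta_space tau n t g ->
  theta_space tau (m + n) (s + t) (fun u => f u * g u).
Proof.
move=> [hf f1 ft] [hg g1 gt]; split; first exact: holoM.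
- by move=> u; rewrite f1 g1 exprD mulrACA.
- move=> u; rewrite ft gt exprD natrD.
  have -> : 2 * pii R * (s + t) = 2 * pii R * s + 2 * pii R * t by ring.
  have -> : - (2 * pii R * (m%:R + n%:R) * u) - pii R * (m%:R + n%:R) * tau =
    (- (2 * pii R * m%:R * u) - pii R * m%:R * tau) +
    (- (2 * pii R * n%:R * u) - pii R * n%:R * tau) by ring.
  rewrite !cexpD; move: (cexp _) (cexp _) (cexp _) (cexp _) (f u) (g u) (_ ^+ m) (_ ^+ n).
  by move=> *; ring.
Qed.

Lemma theta_space_0 n s : theta_space tau n s (fun=> 0).
Proof. by split=> [|u|u]; [exact: holo_cst|rewrite mulr0|rewrite mulr0]. Qed.

Lemma theta_space_cst c : theta_space tau 0 0 (fun=> c).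
Proof.
split=> [|u|u]; first exact: holo_cst; first by rewrite mul1r.
by rewrite !mulr0 !mul0r oppr0 addr0 cexp0 !mul1r.
Qed.

Lemma theta_space_sum n s (I : Type) (r : seq I) (F : I -> R[i] -> R[i]) :
  (forall i, theta_space tau n s (F i)) ->
  theta_space tau n s (fun u => \sum_(i <- r) F i u).
Proof.
move=> hF; have := theta_space_lin r (fun=> 1) hF.
by congr theta_space; apply/funext => u; apply: eq_bigr => i _; rewrite mul1r.
Qed.

End ThetaSpaceAlgebra.

Section Ellipticity.
Variables (R : realType) (tau : R[i]) (theta : R[i] -> R[i]) (hbar lam : R[i]) (N : nat).
Hypothesis theta_odd : odd_theta tau theta.
Local Notation wt := (wt theta hbar lam).
Local Notation hz := (hz hbar lam).
Implicit Types (n i j : nat) (u v : nat -> R[i]).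

Lemma theta_space_shift y c : theta_space tau 1 y (fun x => theta (x - y) * c).
Proof.
have := theta_space_mul (theta_prod_space theta_odd (fun _ : 'I_1 => y)) (theta_space_cst tau c).
by rewrite big_ord1 addr0 addn0; under eq_fun do rewrite big_ord1.
Qed.

(* The weight in the last column and the j-th row vanishes, as a function of u_n,
   at v_j plus an amount that telescopes along the column. *)
Definition zero_shift n (r : line N n.+1) : R[i] :=
  if lh r n == lh r n.+1 + 1 then hz (lh r n.+1) else 0.

(** As the height drops by 1 along the left boundary, only three types of weight occur, with zeros
    at [v - hbar], [v + hz d] and [v], where [d] is the upper left height; each zero is [v] plus the
    increment of [zero_shift]. *)
Lemma corner_space n (v : R[i]) (r r' : line N n.+1) : lh r n.+1 = lh r' n.+1 + 1 ->
  theta_space tau 1 (v + (zero_shift r' - zero_shift r))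
    (fun x => wt (x - v) (lh r n.+1) (lh r n) (lh r' n) (lh r' n.+1)).
Proof.
rewrite /zero_shift; move: (lh r n.+1) (lh r n) (lh r' n) (lh r' n.+1) => a b c d ad.
have [hadj|nadj] := boolP [&& adj a b, adj b c, adj c d & adj d a]; last first.
  under eq_fun do rewrite (wt_eq0 _ _ _ _ nadj).
  exact: theta_space_0.
have sh y w : (forall x, wt (x - v) a b c d = theta (x - (v + y)) * w) ->
    theta_space tau 1 (v + y) (fun x => wt (x - v) a b c d).
  by move=> h; under eq_fun do rewrite h; exact: theta_space_shift.
have hS : hz (d + 1) = hz d + hbar by rewrite /hz intrD; ring.
have [bE|bE] : b = d + 2 \/ b = d by move: hadj; rewrite /adj; lia.
  have cE : c = d + 1 by move: hadj; rewrite /adj; lia.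
  rewrite ifT; last by lia.
  rewrite ifT; last by lia.
  apply: (sh _ 1) => x; rewrite wt_a//.
  by rewrite /wa mulr1 ad hS; congr theta; ring.
have [cE|cE] : c = d + 1 \/ c = d - 1 by move: hadj; rewrite /adj; lia.
  rewrite ifT; last by lia.
  rewrite ifF; last by lia.
  apply: (sh _ (theta hbar / theta (- hz d))) => x; rewrite bE wt_cN//.
  by rewrite /wc -mulrA; congr (theta _ * _); ring.
rewrite ifF; last by lia.
rewrite ifF; last by lia.
apply: (sh _ (theta (- hz d + hbar) / theta (- hz d))) => x; rewrite bE wt_bN//.
by rewrite /wb -mulrA; congr (theta _ * _); ring.
Qed.

Definition set_last n u x i : R[i] := if i == n then x else u i.

Lemma lh_bot n i : (n <= N)%N -> (i <= n)%N -> lh (bottom_line N n) i = i%:Z.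
Proof. by move=> nN hi; rewrite /lh /bottom_line ffunE !inordK//; lia. Qed.

Lemma lh_top n i : (n <= N)%N -> (i <= n)%N -> lh (top_line N n) i = n%:Z - i%:Z.
Proof. by move=> nN hi; rewrite /lh /top_line ffunE !inordK//; lia. Qed.

Lemma pathsum_space n u v m (r : line N n.+1) : (n < N)%N ->
  theta_space tau m (\sum_(l < m) v l + zero_shift r)
   (fun x => pathsum (fun j => @rowM _ theta hbar lam N n.+1 (set_last n u x) j (v j))
     (bottom_line N n.+1) m r).
Proof.
move=> nN; elim: m r => [|m IH] r /=.
  have [->|_] := eqVneq r (bottom_line N n.+1); last exact: theta_space_0.
  rewrite big_ord0 add0r /zero_shift !lh_bot// ifF; last by lia.
  exact: theta_space_cst.
apply: theta_space_sum => y.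
have RM x : @rowM _ theta hbar lam N n.+1 (set_last n u x) m (v m) y r =
  if allowed m y && allowed m.+1 r then rowT theta hbar lam (set_last n u x) (v m) y r
  else 0 by [].
under [X in theta_space _ _ _ X]eq_fun do rewrite RM.
case E : (allowed m y && allowed m.+1 r); last first.
  by under [X in theta_space _ _ _ X]eq_fun do rewrite mulr0; exact: theta_space_0.
move/andP: E => [ay ar]; have e1 : lh y n.+1 = lh r n.+1 + 1.
  by case/and3P: ay => _ /eqP-> _; case/and3P: ar => _ /eqP-> _; lia.
pose c := \prod_(i < n) wt (u i - v m) (lh y i.+1) (lh y i) (lh r i) (lh r i.+1).
have TE x : rowT theta hbar lam (set_last n u x) (v m) y r =
    c * wt (x - v m) (lh y n.+1) (lh y n) (lh r n) (lh r n.+1).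
  have s1 : set_last n u x n = x by rewrite /set_last eqxx.
  have s2 (i : 'I_n) : set_last n u x i = u i by rewrite /set_last ltn_eqF.
  rewrite /rowT big_ord_recr /= s1.
  rewrite (eq_bigr (fun i : 'I_n =>
    wt (u i - v m) (lh y i.+1) (lh y i) (lh r i) (lh r i.+1))).
    reflexivity.
  by move=> i _; rewrite s2.
under [X in theta_space _ _ _ X]eq_fun do rewrite TE.
have := theta_space_mul (IH y) (theta_space_mul (theta_space_cst tau c) (corner_space (v m) e1)).
rewrite add0r add0n addn1 big_ord_recr /=.
by rewrite (_ : _ + (v m + _) = \sum_(l < m) v l + v m + zero_shift r); last by ring.
Qed.

(** The shift is 0 on the bottom line. The top line ends with heights 1 and 0, so its shift is
    [hz 0 = lam]: this is where [lambda] enters the character. *)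
Lemma dwbc_space n u v : (n < N)%N ->
  theta_space tau n.+1 (lam + \sum_(l < n.+1) v l)
    (fun x => dwbc theta hbar lam N n.+1 (set_last n u x) v).
Proof.
move=> nN; have := pathsum_space u v n.+1 (top_line N n.+1) nN.
rewrite /zero_shift !lh_top// ifT; last by lia.
by rewrite subrr /hz mul0r addr0 addrC.
Qed.

End Ellipticity.

(** * Freezing at [u_n = v_n - hbar] *)

Section Recursion.
Variables (K : fieldType) (th : K -> K) (e lam : K) (N : nat).
Hypothesis th_odd : forall x, th (- x) = - th x.
Hypothesis th0 : th 0 = 0.
Hypothesis hz_neq0 : forall k : int, 0 <= k -> th (hz e lam k) != 0.
Local Notation wt := (wt th e lam).
Local Notation wb := (wb th e).
Local Notation wc := (wc th e).
Local Notation hz := (hz e lam).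
Local Notation line := (line N).
Local Notation rowM := (@rowM K th e lam N).
Local Notation bottom_line := (bottom_line N).
Local Notation top_line := (top_line N).
Implicit Types (n i j : nat) (u v : nat -> K).

Lemma hzS (k : int) : hz (k + 1) = hz k + e.
Proof. by rewrite /hz intrD; ring. Qed.

Lemma hzP (k : int) : hz (k - 1) = hz k - e.
Proof. by rewrite /hz intrD; ring. Qed.

Lemma eq_line n (r r' : line n) : (forall i, (i <= n)%N -> lh r i = lh r' i) -> r = r'.
Proof.
move=> h; apply/ffunP => i; apply/val_inj.
by have := h i; rewrite -ltnS ltn_ord /lh inord_val => /(_ isT) [].
Qed.

(** Adds the boundary face on the left, whose height on line [j] of the larger lattice is forced to
    be [n.+1 - j]. The upper left faces of both lattices have relative height 0, so [lam] is
    unchanged. *)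
Definition line_ext n j (r : line n) : line n.+1 :=
  [ffun i : 'I_n.+2 => if (i <= n)%N then r (inord i) else inord (n.+1 - j)].

Definition line_res n (r : line n.+1) : line n := [ffun i : 'I_n.+1 => r (inord i)].

Lemma lh_ext n j (r : line n) i : (i <= n)%N -> lh (line_ext j r) i = lh r i.
Proof. by move=> hi; rewrite /lh /line_ext ffunE inordK ?hi//; lia. Qed.

Lemma lh_ext_last n j (r : line n) : (n < N)%N -> (j <= n.+1)%N ->
  lh (line_ext j r) n.+1 = n.+1%:Z - j%:Z.
Proof. by move=> nN jn; rewrite /lh /line_ext ffunE inordK// ltnn inordK; lia. Qed.

Lemma lh_res n (r : line n.+1) i : (i <= n)%N -> lh (line_res r) i = lh r i.
Proof. by move=> hi; rewrite /lh /line_res ffunE inordK ?hi//; lia. Qed.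

Lemma extK n j : cancel (@line_ext n j) (@line_res n).
Proof. by move=> r; apply: eq_line => i hi; rewrite lh_res// lh_ext. Qed.

Lemma allowed_ext n j (r : line n) : (n < N)%N -> (j <= n)%N -> allowed j r ->
  allowed j (line_ext j r).
Proof.
move=> nN jn ar; have /and3P[h0 hn _] := ar; rewrite /allowed lh_ext// h0.
rewrite lh_ext_last//; last exact: leqW.
rewrite eqxx /=; apply/forallP => i; case: (leqP i n) => hi.
  by rewrite lh_ext//; exact: allowed_bounds.
have -> : (i : nat) = n.+1 by have := ltn_ord i; lia.
by rewrite lh_ext_last; lia.
Qed.

Lemma allowed_res n j (r : line n.+1) : (j <= n)%N -> allowed j r ->
  lh r n = n%:Z - j%:Z -> allowed j (line_res r).
Proof.
move=> jn ar hn; have /and3P[h0 _ _] := ar; rewrite /allowed !lh_res// h0 hn eqxx /=.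
apply/forallP => i; rewrite lh_res; last by rewrite -ltnS.
by apply: allowed_bounds => //; have := ltn_ord i; lia.
Qed.

Lemma res_ext n j (r : line n.+1) : (n < N)%N -> (j <= n)%N -> allowed j r ->
  line_ext j (line_res r) = r.
Proof.
move=> nN jn /and3P[_ /eqP hn _]; apply: eq_line => i hi; case: (leqP i n) => hi'.
  by rewrite lh_ext// lh_res.
have -> : i = n.+1 by lia.
by rewrite lh_ext_last// ?hn// leqW.
Qed.

Lemma ext_bot n : (n < N)%N -> line_ext 0 (bottom_line n) = bottom_line n.+1.
Proof.
move=> nN; apply: eq_line => i hi; rewrite lh_bot//; case: (leqP i n) => hi'.
  by rewrite lh_ext// lh_bot// ltnW.
have -> : i = n.+1 by lia.
by rewrite lh_ext_last//; lia.
Qed.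

Lemma allowed_top n : (n <= N)%N -> allowed n (top_line n).
Proof.
move=> nN; rewrite /allowed !lh_top//; apply/and3P; split; [lia|lia|].
by apply/forallP => i; have hi := ltn_ord i; rewrite lh_top; lia.
Qed.

Lemma rowM_ext n u j (x : K) (r r' : line n) : (n < N)%N -> (j < n)%N ->
  allowed j r -> allowed j.+1 r' ->
  rowM u j x (line_ext j r) (line_ext j.+1 r') =
  rowM u j x r r' * wb (u n - x) (- hz (n%:Z - j%:Z)).
Proof.
move=> nN jn ar ar'; have jn' := ltnW jn.
rewrite /rowM ar ar' !allowed_ext//= /rowT big_ord_recr /=.
have hn : lh r n = n%:Z - j%:Z by case/and3P: ar => _ /eqP.
have hn' : lh r' n = n%:Z - j%:Z - 1 by case/and3P: ar' => _ /eqP-> _; lia.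
have hl : lh (line_ext j r) n.+1 = n%:Z - j%:Z + 1 by rewrite lh_ext_last//; lia.
have hl' : lh (line_ext j.+1 r') n.+1 = n%:Z - j%:Z by rewrite lh_ext_last//; lia.
rewrite hl hl' !lh_ext// hn hn' wt_bN//.
rewrite (eq_bigr (fun i : 'I_n => wt (u i - x) (lh r i.+1) (lh r i) (lh r' i) (lh r' i.+1))).
  reflexivity.
by move=> i _; have hi := ltn_ord i; rewrite !lh_ext// ltnW.
Qed.

Lemma rowT_last n u (x : K) (r r' : line n.+1) : rowT th e lam u x r r' != 0 ->
  wt (u n - x) (lh r n.+1) (lh r n) (lh r' n) (lh r' n.+1) != 0.
Proof. by rewrite /rowT big_ord_recr /= mulf_eq0 negb_or => /andP[]. Qed.

(** Freezing propagates downwards: below an extended line, the boundary height and adjacency force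
    the height [n - j] in the last face but one of line [j], so that line is again an extension, and
    each frozen vertex contributes a weight of type b. *)
Lemma pathsum_ext_line n u v j (r : line n) : (n < N)%N -> (j <= n)%N -> allowed j r ->
  pathsum (fun k => @rowM n.+1 u k (v k)) (bottom_line n.+1) j (line_ext j r) =
  pathsum (fun k => @rowM n u k (v k)) (bottom_line n) j r
    * \prod_(l < j) wb (u n - v l) (- hz (n%:Z - l%:Z)).
Proof.
move=> nN; elim: j r => [|j IH] r' jn ar' /=.
  rewrite big_ord0 mulr1 -ext_bot//; congr (nat_of_bool _)%:R.
  exact: (inj_eq (can_inj (@extK n 0))).
pose G y := pathsum (fun k => @rowM n.+1 u k (v k)) (bottom_line n.+1) j y
  * rowM u j (v j) y (line_ext j.+1 r').
rewrite -[LHS]/(\sum_y G y) (bigID (fun y => (line_ext j (line_res y) == y) && allowed j (line_res y))) /=.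
rewrite [X in _ + X]big1 ?addr0; last first.
  move=> y; apply: contraNeq; rewrite /G mulf_eq0 negb_or => /andP[_].
  rewrite /rowM; case: ifP => [/andP[ay ae]|]; last by rewrite eqxx.
  move=> /rowT_last/wt_adj; rewrite /adj lh_ext// lh_ext_last//; last exact: leqW.
  have /and3P[_ /eqP hy _] := ay.
  have /and3P[_ /eqP hr _] := ar'; rewrite hy hr => hh.
  rewrite res_ext// ?eqxx /=; last by lia.
  by apply: allowed_res => //; lia.
rewrite (reindex_onto (@line_ext n j) (@line_res n)) /=; last by move=> y /andP[/eqP].
rewrite big_ord_recr /=.
rewrite [RHS]mulr_suml [RHS](bigID (@allowed N n j)) /= [X in _ = _ + X]big1 ?addr0; last first.
  by move=> y /negPf ny; rewrite /rowM ny mulr0 !mul0r.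
apply: eq_big => [y|y]; first by rewrite extK !eqxx /= andbT.
rewrite extK !eqxx andbT /= => ay; rewrite /G IH// ?rowM_ext//; last exact: ltnW.
by ring.
Qed.

Lemma prod_ratio_down (f : nat -> K) n : (forall k, f k != 0) ->
  \prod_(l < n) (f (n - l.+1)%N / f (n - l)%N) = f 0%N / f n.
Proof.
move=> f0; elim: n => [|n IH]; first by rewrite big_ord0 divff.
rewrite big_ord_recl /= subn0 subSS subn0.
rewrite (eq_bigr (fun l : 'I_n => f (n - l.+1)%N / f (n - l)%N)) => [|l _].
  by rewrite IH; field; rewrite !f0.
by rewrite /bump /= add1n !subSS.
Qed.

Lemma prod_ratio_up (f : nat -> K) n : (forall k, f k != 0) ->
  \prod_(l < n) (f (n - l).+1 / f (n - l)%N) = f n.+1 / f 1%N.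
Proof.
move=> f0; elim: n => [|n IH]; first by rewrite big_ord0 divff.
rewrite big_ord_recl /= subn0.
rewrite (eq_bigr (fun l : 'I_n => f (n - l).+1 / f (n - l)%N)) => [|l _].
  by rewrite IH; field; rewrite !f0.
by rewrite /bump /= add1n !subSS.
Qed.

(* The weight of the upper left vertex vanishes unless the height just inside it
   is 0, which freezes the last row; the last column is then frozen as well. *)
Lemma dwbc_forced n u (x : K) (y : line n.+1) : (n < N)%N -> u n = x - e ->
  rowM u n x y (top_line n.+1) != 0 -> y = line_ext n (top_line n).
Proof.
move=> nN ue; rewrite /rowM; case: ifP => [/andP[ay _]|]; last by rewrite eqxx.
move=> t0; have hl := rowT_last t0.
have [_ adjs] := rowT_adj (ltn0Sn n) t0.
have /and3P[_ /eqP hy _] := ay.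
have hyn : lh y n = 0.
  move: hl; rewrite hy !lh_top// ue => hl.
  have := wt_adj hl; rewrite /adj => ha.
  have [//|y2] : lh y n = 0 \/ lh y n = 2 by lia.
  move: hl; rewrite y2 wt_a; [|lia..].
  by rewrite /wa (_ : x - e - x + e = 0) ?th0 ?eqxx//; ring.
(* Moving right from the height 0, each step goes up, because the bound [n - i] for allowed lines
   excludes going down. *)
have up k : (k <= n)%N -> lh y (n - k)%N = k%:Z.
  elim: k => [|k IH] kn; first by rewrite subn0.
  have := IH (ltnW kn); have := (adjs (n - k.+1)%N _).1.
  have -> : (n - k.+1).+1 = (n - k)%N by lia.
  move=> /(_ ltac:(lia)); have := allowed_bounds ay (_ : (n - k.+1) <= n.+1)%N.
  by move=> /(_ ltac:(lia)); rewrite /adj; lia.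
apply: eq_line => i hi; case: (leqP i n) => hi'.
  rewrite lh_ext// lh_top//; last exact: ltnW.
  by have := up (n - i)%N (leq_subr _ _); rewrite subKn// => ->; lia.
have -> : i = n.+1 by lia.
by rewrite lh_ext_last// hy.
Qed.

Lemma dwbc_rec n u v : (n < N)%N -> u n = v n - e ->
  dwbc th e lam N n.+1 u v =
  th (lam + n.+1%:R * e) * th e / th (lam + n%:R * e)
  * (\prod_(m < n) (th (v n - v m - e) * th (u m - v n)))
  * dwbc th e lam N n u v.
Proof.
move=> nN ue; rewrite /dwbc /=.
rewrite (bigD1 (line_ext n (top_line n)))//= big1 ?addr0; last first.
  move=> y ny; apply/eqP; rewrite mulf_eq0; apply/orP; right.
  by apply: contraNT ny => /(dwbc_forced nN ue)->.
have nN' := ltnW nN.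
have at' : allowed n (top_line n) by exact: allowed_top.
rewrite pathsum_ext_line// mulrAC [RHS]mulrC -mulrA; congr (_ * _).
pose f k := th (hz k%:Z).
have f0 k : f k != 0 by exact: hz_neq0.
rewrite /rowM allowed_ext// allowed_top//= /rowT big_ord_recr /=.
rewrite lh_ext_last// lh_ext// !lh_top//.
rewrite (_ : wt (u n - v n) _ _ _ _ = wc (- e) (- hz 0)); last first.
  rewrite ue (_ : v n - e - v n = - e); last by ring.
  by rewrite (_ : n%:Z - n%:Z = n.+1%:Z - n.+1%:Z) ?wt_cN//; try lia; congr wc; congr (- hz _); lia.
rewrite (eq_bigr (fun i : 'I_n => th (u i - v n) * (f (n - i).+1 / f (n - i)%N))); last first.
  move=> i _; have hi := ltn_ord i.
  rewrite !lh_ext ?lh_top//; try lia.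
  have -> : n%:Z - i%:Z = n.+1%:Z - i.+1%:Z by lia.
  rewrite wt_b; [|lia..]; rewrite /wb /f -mulrA; congr (_ * (th _ / th (hz _))); last by lia.
  by rewrite -hzS; congr hz; lia.
rewrite [X in _ * X](eq_bigr (fun l : 'I_n => th (v n - v l - e) * (f (n - l.+1)%N / f (n - l)%N))); last first.
  move=> l _; have hl := ltn_ord l.
  rewrite /wb ue -mulrA; congr (th _ * _); first by ring.
  have -> : - hz (n%:Z - l%:Z) + e = - hz (n - l.+1)%N%:Z.
    rewrite (_ : (n - l.+1)%N%:Z = n%:Z - l%:Z - 1) ?hzP; [by ring|by lia].
  rewrite !th_odd invrN mulrNN /f; congr (_ / th (hz _)); lia.
rewrite [X in X * _ * _ = _]big_split [X in _ * X = _]big_split [X in _ = _ * X]big_split /=.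
rewrite (prod_ratio_up n f0) (prod_ratio_down n f0).
have -> : lam + n.+1%:R * e = hz n.+1%:Z by [].
have -> : lam + n%:R * e = hz n%:Z by [].
rewrite -/(f n.+1) -/(f n) /wc.
have -> : - e + - hz 0 = - hz 1 by rewrite /hz; ring.
rewrite !th_odd -/(f 0%N) -/(f 1%N).
by field; rewrite ?oppr_eq0 !f0.
Qed.

Lemma dwbc1 u v : (0 < N)%N ->
  dwbc th e lam N 1 u v = th (u 0%N - v 0%N - lam) * th e / th (- lam).
Proof.
move=> N0; rewrite /dwbc /= (bigD1 (bottom_line 1))//= big1 ?addr0; last first.
  by move=> y /negPf->; rewrite mul0r.
rewrite eqxx mul1r /rowM allowed_top//.
have -> : allowed 0 (bottom_line 1).
  rewrite /allowed !lh_bot//=; apply/forallP => i; have hi := ltn_ord i.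
  by rewrite lh_bot; lia.
rewrite /= /rowT big_ord1 !lh_bot// !lh_top// wt_cN//.
by rewrite /wc /hz (_ : (ord0 : nat)%:~R = 0 :> K) ?mul0r ?addr0.
Qed.

End Recursion.

(** * Configurations *)

Lemma face_beforeE n (i : 'I_n) : face_before i = inord i.
Proof. by apply/val_inj; rewrite /= inordK// ltnW// ltnS. Qed.

Lemma face_afterE n (i : 'I_n) : face_after i = inord i.+1.
Proof. by apply/val_inj; rewrite /= inordK// ltnS. Qed.

Lemma ord0_inord n : ord0 = inord 0 :> 'I_n.+1.
Proof. by apply/val_inj; rewrite /= inordK. Qed.

Lemma ord_max_inord n : ord_max = inord n :> 'I_n.+1.
Proof. by apply/val_inj; rewrite /= inordK. Qed.

Section Configurations.
Variables (R : realType) (hbar lam : R[i]) (n : nat).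
Local Notation h0 := (lam / hbar).
Implicit Types (D : nat -> nat -> R[i]) (i j : nat).

Definition unit_step (x : R[i]) := x = 1 \/ x = -1.

(** The conditions with natural numbers as indices, suited to inductions along the boundary. *)
Record dw_heights D : Prop := DwHeights {
  dw_stepl : forall i j, (i < n)%N -> (j <= n)%N -> unit_step (D i.+1 j - D i j);
  dw_stepr : forall i j, (i <= n)%N -> (j < n)%N -> unit_step (D i j.+1 - D i j);
  dw_top : forall i, (i < n)%N -> D i n - D i.+1 n = 1;
  dw_bot : forall i, (i < n)%N -> D i 0%N - D i.+1 0%N = -1;
  dw_right : forall j, (j < n)%N -> D 0%N j - D 0%N j.+1 = -1;
  dw_left : forall j, (j < n)%N -> D n j - D n j.+1 = 1;
  dw_corner : D n n = h0 }.

Lemma dw_heightsP (d : 'M[R[i]]_n.+1) : hbar != 0 ->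
  (configuration d /\ DWBC hbar lam d) <->
  dw_heights (fun i j => d (inord i) (inord j)).
Proof.
move=> hbar_neq0; have cornerE : hbar * d ord_max ord_max = lam <-> d (inord n) (inord n) = h0.
  by rewrite ord_max_inord; split=> [<-|->]; field.
split=> [[[c1 c2] [t b r l c]]|[c1 c2 t b r l c]].
  rewrite ord0_inord in b r; rewrite ord_max_inord in t l.
  split; last exact/cornerE.
  - by move=> i j hi _; have := c1 (Ordinal hi) (inord j); rewrite face_afterE face_beforeE.
  - by move=> i j _ hj; have := c2 (inord i) (Ordinal hj); rewrite face_afterE face_beforeE.
  - by move=> i hi; have := t (Ordinal hi); rewrite face_afterE face_beforeE.
  - by move=> i hi; have := b (Ordinal hi); rewrite face_afterE face_beforeE.
  - by move=> i hi; have := r (Ordinal hi); rewrite face_afterE face_beforeE.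
  - by move=> i hi; have := l (Ordinal hi); rewrite face_afterE face_beforeE.
split; [split|split; last exact/cornerE].
- by move=> i j; rewrite face_afterE face_beforeE -(inord_val j); apply: c1; rewrite // -ltnS.
- by move=> i j; rewrite face_afterE face_beforeE -(inord_val i); apply: c2; rewrite // -ltnS.
- by move=> i; rewrite face_afterE face_beforeE ord_max_inord; exact: t.
- by move=> i; rewrite face_afterE face_beforeE ord0_inord; exact: b.
- by move=> i; rewrite face_afterE face_beforeE ord0_inord; exact: r.
- by move=> i; rewrite face_afterE face_beforeE ord_max_inord; exact: l.
Qed.

Lemma int_heights_inj (k l : int) : h0 + k%:~R = h0 + l%:~R -> k = l.
Proof. by move/addrI/intr_inj. Qed.

Section Bounds.
Variable D : nat -> nat -> R[i].
Hypothesis hD : dw_heights D.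

Let subE (x y c : R[i]) : x - y = c -> y = x - c.
Proof. by move=> <-; rewrite opprB addrC subrK. Qed.

Lemma dw_rightE j : (j <= n)%N -> D 0%N j = h0 + j%:R.
Proof.
have up i : (i <= n)%N -> D 0%N i = D 0%N 0%N + i%:R.
  elim: i => [|i IH] hi; first by rewrite addr0.
  by rewrite (subE (dw_right hD hi)) (IH (ltnW hi)) -natr1; ring.
have across i : (i <= n)%N -> D i n = D 0%N n - i%:R.
  elim: i => [|i IH] hi; first by rewrite subr0.
  by rewrite (subE (dw_top hD hi)) (IH (ltnW hi)) -natr1; ring.
move=> hj; rewrite up//; congr (_ + _).
by rewrite -(dw_corner hD) across// (up n)//; ring.
Qed.

Lemma dw_topE i : (i <= n)%N -> D i n = h0 + (n%:R - i%:R).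
Proof.
elim: i => [|i IH] hi; first by rewrite subr0 dw_rightE.
by rewrite (subE (dw_top hD hi)) (IH (ltnW hi)) -natr1; ring.
Qed.

Lemma dw_botE i : (i <= n)%N -> D i 0%N = h0 + i%:R.
Proof.
elim: i => [|i IH] hi; first by rewrite dw_rightE.
by rewrite (subE (dw_bot hD hi)) (IH (ltnW hi)) -natr1; ring.
Qed.

Lemma dw_leftE j : (j <= n)%N -> D n j = h0 + (n%:R - j%:R).
Proof.
elim: j => [|j IH] hj; first by rewrite subr0 dw_botE.
by rewrite (subE (dw_left hD hj)) (IH (ltnW hj)) -natr1; ring.
Qed.

(** Unit steps from the right boundary, where the height is [j], give two of the bounds; unit steps
    from the bottom, where it is [i], give the third. Both routes yield the same integer. *)
Lemma dw_bounds i j : (i <= n)%N -> (j <= n)%N -> exists k : int,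
  D i j = h0 + k%:~R /\ [&& i%:Z - j%:Z <= k, j%:Z - i%:Z <= k & k <= i%:Z + j%:Z].
Proof.
move=> hi hj.
have step (x y : R[i]) (k : int) : unit_step (y - x) -> x = h0 + k%:~R ->
    exists l : int, y = h0 + l%:~R /\ (l = k + 1 \/ l = k - 1).
  move=> [/eqP|/eqP]; rewrite subr_eq => /eqP-> ->.
    by exists (k + 1); split; [rewrite intrD; ring|left].
  by exists (k - 1); split; [rewrite intrD; ring|right].
have [k [kE kb]] : exists k : int, D i j = h0 + k%:~R /\ (j%:Z - i%:Z <= k) && (k <= i%:Z + j%:Z).
  elim: i hi => [|i IH] hi; first by exists j; rewrite dw_rightE//; split=> //; lia.
  have [k [kE kb]] := IH (ltnW hi).
  have [l [lE lk]] := step _ _ _ (dw_stepl hD hi hj) kE.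
  by exists l; split=> //; lia.
have [l [lE lb]] : exists k : int, D i j = h0 + k%:~R /\ (i%:Z - j%:Z <= k) && (k <= i%:Z + j%:Z).
  elim: j hj {k kE kb} => [|j IH] hj; first by exists i; rewrite dw_botE//; split=> //; lia.
  have [k [kE kb]] := IH (ltnW hj).
  have [l [lE lk]] := step _ _ _ (dw_stepr hD hi hj) kE.
  by exists l; split=> //; lia.
have kl : k = l by apply: int_heights_inj; rewrite -kE -lE.
by exists k; split=> //; lia.
Qed.

End Bounds.

End Configurations.

Section PartitionFunction.
Variables (R : realType) (theta : R[i] -> R[i]) (hbar lam : R[i]) (N n : nat).
Hypothesis theta_odd : forall x, theta (- x) = - theta x.
Hypothesis hbar_neq0 : hbar != 0.
Hypothesis n_gt0 : (0 < n)%N.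
Hypothesis n_le : (n.*2 <= N)%N.
Local Notation h0 := (lam / hbar).
Local Notation conf := {ffun 'I_n.+1 -> line N n}.
Implicit Types (f : conf) (i j : nat).

(** [f] lists the horizontal lines from bottom to top, hence the exchange of indices. *)
Definition heights f : 'M[R[i]]_n.+1 :=
  \matrix_(i, j) (h0 + (lh (f j) i)%:~R).

Lemma heightsE f i j : (i <= n)%N ->
  heights f (inord i) (inord j) = h0 + (lh (f (inord j)) i)%:~R.
Proof. by move=> hi; rewrite mxE inordK. Qed.

Lemma heights_inj : injective heights.
Proof.
move=> f g /matrixP fg; apply/ffunP => j; apply: eq_line => i hi.
by have := fg (inord i) j; rewrite !mxE inordK// => /int_heights_inj.
Qed.

Lemma weight_heights x (a b c d : int) :
  weight theta hbar x (h0 + a%:~R) (h0 + b%:~R) (h0 + c%:~R) (h0 + d%:~R) =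
  wt theta hbar lam x a b c d.
Proof.
have E (k l m : int) : (h0 + k%:~R == h0 + l%:~R + m%:~R) = (k == l + m).
  by rewrite -addrA -intrD (inj_eq (addrI _)) eqr_int.
have E0 (k l : int) : (h0 + k%:~R == h0 + l%:~R) = (k == l).
  by rewrite (inj_eq (addrI _)) eqr_int.
have EN (k l : int) (m : nat) : (h0 + k%:~R == h0 + l%:~R - m%:R) = (k == l - m%:Z).
  by rewrite -E intrN.
have zE : hbar * (h0 + d%:~R) = hz hbar lam d by rewrite /hz; field.
have e1 : 1 = 1%:~R :> R[i] by [].
have e2 : 2 = 2%:~R :> R[i] by [].
have bN : theta x * theta (- hz hbar lam d + hbar) / theta (- hz hbar lam d) =
    theta x * theta (hz hbar lam d - hbar) / theta (hz hbar lam d).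
  rewrite (_ : - hz hbar lam d + hbar = - (hz hbar lam d - hbar)); last by ring.
  by rewrite !theta_odd mulrN invrN mulrNN.
rewrite /weight /wt !zE /wa /wb /wc.
rewrite !(EN _ _ 1%N) !(EN _ _ 2%N) !(E _ _ 1) !(E _ _ 2) !E0.
by rewrite bN.
Qed.

Lemma weights_rowT f (u v : 'rV[R[i]]_n) (U V : nat -> R[i]) :
  (forall i : 'I_n, u 0 i = U i) -> (forall i : 'I_n, v 0 i = V i) ->
  \prod_(i < n) \prod_(j < n)
      weight theta hbar (u 0 i - v 0 j)
        (heights f (face_after i) (face_before j)) (heights f (face_before i) (face_before j))
        (heights f (face_before i) (face_after j)) (heights f (face_after i) (face_after j)) =
  \prod_(j < n) rowT theta hbar lam U (V j) (f (inord j)) (f (inord j.+1)).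
Proof.
move=> uE vE; rewrite exchange_big /=; apply: eq_bigr => j _; apply: eq_bigr => i _.
have hi := ltn_ord i.
by rewrite !face_beforeE !face_afterE uE vE !heightsE ?(ltnW hi)// weight_heights.
Qed.

(** By [dw_bounds] the relative heights lie between 0 and [2 * n], hence fit into ['I_N.+1]. *)
Lemma configurations_heights (d : 'M[R[i]]_n.+1) :
  configuration d /\ DWBC hbar lam d -> exists f, d = heights f.
Proof.
move/(dw_heightsP _ _ hbar_neq0) => hd.
have ex (p : 'I_n.+1 * 'I_n.+1) : exists k : nat, d p.1 p.2 = h0 + k%:R /\ (k <= N)%N.
  case: p => i j /=.
  have [k [kE kb]] := dw_bounds hd (ltn_ord i : (i <= n)%N) (ltn_ord j : (j <= n)%N).
  rewrite !inord_val in kE.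
  have hi := ltn_ord i; have hj := ltn_ord j.
  exists `|k|%N; split; last by lia.
  by rewrite kE; congr (_ + _); rewrite -[RHS]/((`|k|%N)%:Z%:~R) gez0_abs//; lia.
have [k hk] := choice ex.
exists [ffun j => [ffun i => inord (k (i, j))]]; apply/matrixP => i j.
by rewrite !mxE /lh !ffunE inord_val; have [-> kN] := hk (i, j); rewrite inordK.
Qed.

Lemma heights_dw f : dw_heights hbar lam n
    (fun i j => heights f (inord i) (inord j)) ->
  [/\ f ord0 = bottom_line N n, f ord_max = top_line N n &
      forall j, (j <= n)%N -> allowed j (f (inord j))].
Proof.
move=> hd; have nN : (n <= N)%N by lia.
have bd i j (hi : (i <= n)%N) (hj : (j <= n)%N) : [&& i%:Z - j%:Z <= lh (f (inord j)) i,
    j%:Z - i%:Z <= lh (f (inord j)) i & lh (f (inord j)) i <= i%:Z + j%:Z].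
  by have [k [kE kb]] := dw_bounds hd hi hj; move: kE; rewrite heightsE// => /int_heights_inj->.
split.
- apply: eq_line => i hi; rewrite lh_bot// ord0_inord.
  by have := bd i 0%N hi isT; lia.
- apply: eq_line => i hi; rewrite lh_top// ord_max_inord.
  have := dw_topE hd hi; rewrite heightsE// (_ : n%:R - i%:R = (n%:Z - i%:Z)%:~R) => [/int_heights_inj//|].
  by rewrite intrB.
move=> j hj; rewrite /allowed; apply/and3P; split.
- by have := bd 0%N j isT hj; lia.
- have := dw_leftE hd hj; rewrite heightsE// (_ : n%:R - j%:R = (n%:Z - j%:Z)%:~R) => [/int_heights_inj->//|].
  by rewrite intrB.
- by apply/forallP => i; apply: bd => //; rewrite -ltnS.
Qed.

(** A path whose transfer entries are all nonzero comes from a configuration, so the other terms of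
    the path sum vanish. *)
Lemma dw_heights_conf f (U V : nat -> R[i]) :
  f ord0 = bottom_line N n -> f ord_max = top_line N n ->
  (forall j, (j < n)%N -> rowM theta hbar lam U j (V j) (f (inord j)) (f (inord j.+1)) != 0) ->
  dw_heights hbar lam n (fun i j => heights f (inord i) (inord j)).
Proof.
move=> f0 fn fM; have nN : (n <= N)%N by lia.
have fb i : (i <= n)%N -> lh (f (inord 0)) i = i%:Z by move=> hi; rewrite -ord0_inord f0 lh_bot.
have ft i : (i <= n)%N -> lh (f (inord n)) i = n%:Z - i%:Z.
  by move=> hi; rewrite -ord_max_inord fn lh_top.
have rowP j : (j < n)%N -> [/\ allowed j (f (inord j)), allowed j.+1 (f (inord j.+1)) &
    rowT theta hbar lam U (V j) (f (inord j)) (f (inord j.+1)) != 0].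
  by move=> /fM; rewrite /rowM; case: ifP => [/andP[]|]; rewrite ?eqxx.
have ad j : (j <= n)%N -> allowed j (f (inord j)).
  move=> hj; case: (ltnP j n) => [/rowP[]//|nj].
  have -> : j = n.-1.+1 by lia.
  by have [] := rowP n.-1 (ltac:(lia)).
have du (k l : int) : unit_step (h0 + k%:~R - (h0 + l%:~R)) <-> adj k l.
  rewrite /unit_step /adj (_ : h0 + k%:~R - (h0 + l%:~R) = (k - l)%:~R); last by rewrite intrB; ring.
  split=> [[/(@intr_inj _ _ 1)|/(@intr_inj _ _ (-1))]|].
  - by lia.
  - by lia.
  - move=> h; have [->|->] : k - l = 1 \/ k - l = -1 by lia.
      by left.
    by right.
have adjl i j : (i < n)%N -> (j <= n)%N -> adj (lh (f (inord j)) i.+1) (lh (f (inord j)) i).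
  move=> hi; rewrite leq_eqVlt => /orP[/eqP->|hj].
    by rewrite !ft//; rewrite /adj; lia.
  by have [_ _ /(rowT_adj n_gt0)[_ /(_ _ hi)[]]] := rowP j hj.
split.
- by move=> i j hi hj; rewrite !heightsE ?(ltnW hi)//; apply/du; exact: adjl.
- move=> i j hi hj; rewrite !heightsE//; apply/du; rewrite adjC.
  by have [_ _ /(rowT_adj n_gt0)[/(_ _ hi)]] := rowP j hj.
- by move=> i hi; rewrite !heightsE ?(ltnW hi)// !ft ?(ltnW hi)// !intrB intS intrD; ring.
- by move=> i hi; rewrite !heightsE ?(ltnW hi)// !fb ?(ltnW hi)// intS intrD; ring.
- move=> j hj; rewrite !heightsE//.
  have /and3P[/eqP-> _ _] := ad j (ltnW hj); have /and3P[/eqP-> _ _] := ad j.+1 hj.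
  by rewrite intS intrD; ring.
- move=> j hj; rewrite !heightsE//.
  have /and3P[_ /eqP-> _] := ad j (ltnW hj); have /and3P[_ /eqP-> _] := ad j.+1 hj.
  by rewrite !intrB intS intrD; ring.
- by rewrite heightsE// ft// subrr addr0.
Qed.

(* N is any bound for the relative heights. *)
Lemma partition_function_dwbc (u v : 'rV[R[i]]_n) (U V : nat -> R[i]) :
  (forall i : 'I_n, u 0 i = U i) -> (forall i : 'I_n, v 0 i = V i) ->
  partition_function theta hbar u v lam = dwbc theta hbar lam N n U V.
Proof.
move=> uE vE.
pose good f := `[< configuration (heights f) /\ DWBC hbar lam (heights f) >].
have goodP f : good f <-> dw_heights hbar lam n (fun i j => heights f (inord i) (inord j)).
  by split=> [/asboolP/(dw_heightsP _ _ hbar_neq0)|/(dw_heightsP _ _ hbar_neq0)/asboolP].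
pose r := [seq heights f | f <- enum good].
have r_uniq : uniq r by rewrite map_inj_uniq ?enum_uniq//; exact: heights_inj.
rewrite /partition_function (fsbigE r)//; last 2 first.
- by move=> d /= /mapP[f]; rewrite mem_enum => /asboolP h ->.
- move=> d /= hd /negP[]; have [f fE] := configurations_heights hd.
  by apply/mapP; exists f => //; rewrite mem_enum; apply/asboolP; rewrite -fE.
rewrite big_map big_enum_cond /= /dwbc -pathsumE.
rewrite (eq_bigr (fun f : conf => \prod_(j < n) rowT theta hbar lam U (V j) (f (inord j)) (f (inord j.+1)))); last first.
  by move=> f _; exact: weights_rowT.
rewrite [RHS](bigID good) /= [X in _ = _ + X]big1 ?addr0; last first.
  move=> f /andP[/andP[/eqP f0 /eqP fn]]; apply: contraNeq => /prodf_neq0 fM.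
  apply/goodP; apply: (dw_heights_conf (U := U) (V := V)) => // j hj.
  exact: (fM (Ordinal hj)).
apply: eq_big => f.
  rewrite -[_ && _]/(good f && good f) andbb; case E : (good f); last by rewrite andbF.
  have [-> -> _] := heights_dw (proj1 (goodP f) E).
  by rewrite !eqxx.
move=> /andP[_ hf]; have [_ _ ha] := heights_dw (proj1 (goodP f) hf).
by apply: eq_bigr => j _; have hj := ltn_ord j; rewrite /rowM !ha// ltnW.
Qed.

End PartitionFunction.

(** * Uniqueness *)

Section Perturbation.
Variables (R : realType) (tau : R[i]) (theta : R[i] -> R[i]).
Hypothesis tau_gt0 : 0 < complex.Im tau.
Hypothesis theta_odd : odd_theta tau theta.

(** Zeros of theta are isolated: each is a lattice vector, and translating by it leads back to the
    simple zero at 0. *)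
Lemma theta_near_affine_neq0 c k : k != 0 ->
  \forall t \near (0 : R[i]^o)^', theta (k * t + c) != 0.
Proof.
move=> k0.
have [r r0 hr] : exists2 r : R[i], 0 < r &
    forall w, `|w| < r -> w != 0 -> theta (w + c) != 0.
  have [cz|cnz] := eqVneq (theta c) 0.
    have [r /= r0 hr] := theta_near0_neq0 theta_odd; exists r => // w wr w0.
    rewrite (theta_lattice theta_odd w (theta_zero_lattice tau_gt0 theta_odd cz)).
    by apply: hr => //=; rewrite sub0r normrN.
  have /nbhs_ballP[r /= r0 hr] : \forall w \near (0 : R[i]^o), theta (w + c) != 0.
    by apply: (theta_near_neq0 theta_odd); rewrite add0r.
  by exists r => // w wr _; apply: hr; rewrite /ball/= sub0r normrN.
exists (r / `|k|) => /=; first by rewrite divr_gt0// normr_gt0.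
move=> t /=; rewrite sub0r normrN ltr_pdivlMr ?normr_gt0// => tr t0.
by apply: hr; rewrite ?mulf_neq0// normrM mulrC.
Qed.

End Perturbation.

Section Symmetry.
Variables (R : realType) (tau : R[i]) (theta : R[i] -> R[i]) (hbar lam : R[i]) (N : nat).
Hypothesis tau_gt0 : 0 < complex.Im tau.
Hypothesis theta_odd : odd_theta tau theta.
Hypothesis theta_neq0 : forall k : nat, theta (lam + k%:R * hbar) != 0.
Local Notation dwbc := (dwbc theta hbar lam N).
Implicit Types (n i j : nat) (u v : nat -> R[i]).

(** Adjacent transpositions carry [v j] to the last row. The permutation is recorded so that the
    symmetry of [Z] can undo it. *)
Lemma dwbc_move_last n u v j : (n.+1.*2 < N)%N -> (j <= n)%N ->
  exists (v' : nat -> R[i]) (t : {perm 'I_n.+1}),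
    [/\ dwbc n.+1 u v = dwbc n.+1 u v', v' n = v j &
        forall i : 'I_n.+1, v' i = v (t i)].
Proof.
move=> nN; move Ed : (n - j)%N => d; elim: d j v Ed => [|d IH] j v Ed jn.
  have -> : j = n by lia.
  by exists v, 1%g; split=> // i; rewrite perm1.
have jn' : (j < n)%N by lia.
have [|//|v' [t [e1 e2 e3]]] := IH j.+1
    (fun k => if k == j then v j.+1 else if k == j.+1 then v j else v k); first by lia.
exists v', (t * tperm (inord j) (inord j.+1))%g; split.
- exact: (etrans (dwbc_swap tau_gt0 theta_odd theta_neq0 u v (jn' : (j.+2 <= n.+1)%N) nN) e1).
- by rewrite e2 eqxx gtn_eqF.
move=> i; rewrite e3 permM.
have neqE (a : 'I_n.+1) (b : nat) : a <> inord b -> (b <= n)%N -> ((a : nat) == b) = false.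
  by move=> ab hb; apply/eqP => e; apply: ab; apply/val_inj; rewrite /= inordK.
have jK : ((inord j : 'I_n.+1) : nat) = j by rewrite inordK// ltnW.
have jSK : ((inord j.+1 : 'I_n.+1) : nat) = j.+1 by rewrite inordK.
case: tpermP => [->|->|h1 h2]; first by rewrite jK jSK eqxx.
  have jj : (j.+1 == j) = false by rewrite gtn_eqF.
  by rewrite jK jSK jj eqxx.
by rewrite (neqE _ _ h1 jn) (neqE _ _ h2 jn').
Qed.

End Symmetry.

Section Uniqueness.
Variables (R : realType) (tau : R[i]) (theta : R[i] -> R[i]) (hbar lambda : R[i]).
Variable Z : forall n : nat, 'rV[R[i]]_n -> 'rV[R[i]]_n -> R[i].
Hypothesis tau_gt0 : 0 < complex.Im tau.
Hypothesis theta_odd : odd_theta tau theta.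
Hypothesis denominators_neq0 : forall k : nat, theta (lambda + k%:R * hbar) != 0.
Hypothesis Z_sym : forall n : nat, (0 < n)%N ->
  forall (s t : {perm 'I_n}) (u v : 'rV[R[i]]_n),
  Z (col_perm s u) (col_perm t v) = Z u v.
Hypothesis Z_elliptic : forall n : nat, (0 < n)%N ->
  forall (u v : 'rV[R[i]]_n) (i : 'I_n),
  exists chi : R[i] -> R[i],
    [/\ character tau chi,
        chi 1 = (-1) ^+ n,
        chi tau
          = (-1) ^+ n * cexp (2 * pii R * (lambda + \sum_(j < n) v 0 j))
      & elliptic_poly tau n%:Z chi (fun x => Z (set_var u i x) v)].
Hypothesis Z_rec : forall n : nat, (0 < n)%N ->
  forall u v : 'rV[R[i]]_n.+1,
  u 0 ord_max = v 0 ord_max - hbar ->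
  Z u v
    = theta (lambda + n.+1%:R * hbar) * theta hbar
        / theta (lambda + n%:R * hbar)
      * (\prod_(m < n)
           (theta (v 0 ord_max - v 0 (widen_ord (leqnSn n) m) - hbar)
            * theta (u 0 (widen_ord (leqnSn n) m) - v 0 ord_max)))
      * Z (\row_m u 0 (widen_ord (leqnSn n) m))
          (\row_m v 0 (widen_ord (leqnSn n) m)).
Hypothesis Z_init : forall u v : 'rV[R[i]]_1,
  Z u v = theta (u 0 0 - v 0 0 - lambda) * theta hbar / theta (- lambda).

Local Notation rowf n u := (\row_(i < n) u (i : nat)).
Implicit Types (u v : nat -> R[i]).

Lemma Z_space n u v : (0 < n)%N ->
  theta_space tau n.+1 (lambda + \sum_(l < n.+1) v l)
    (fun x => Z (rowf n.+1 (set_last n u x)) (rowf n.+1 v)).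
Proof.
move=> n0; have [chi [_ c1 ct [hf f1 ft]]] :=
  Z_elliptic (ltn0Sn n) (rowf n.+1 u) (rowf n.+1 v) ord_max.
have sumE : \sum_(j < n.+1) (rowf n.+1 v) 0 j = \sum_(l < n.+1) v l.
  by apply: eq_bigr => j _; rewrite mxE.
rewrite sumE in ct.
have rowE x : set_var (rowf n.+1 u) ord_max x = rowf n.+1 (set_last n u x).
  by apply/rowP => i; rewrite !mxE /set_last -val_eqE.
rewrite (_ : (fun x => Z (set_var (rowf n.+1 u) ord_max x) (rowf n.+1 v)) =
  (fun x => Z (rowf n.+1 (set_last n u x)) (rowf n.+1 v))) in hf; last first.
  by apply/funext => x; rewrite rowE.
split=> // x; first by have := f1 x; rewrite !rowE c1.
by have := ft x; rewrite !rowE ct.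
Qed.

Lemma dwbc_unique N n u v : (0 < n)%N -> (n.*2 < N)%N ->
  (forall i j, (i < n)%N -> (j < n)%N -> i != j -> theta (v i - v j) != 0) ->
  dwbc theta hbar lambda N n u v = Z (rowf n u) (rowf n v).
Proof.
have th_odd := thetaN theta_odd; have th0 := theta0 theta_odd.
have hz0 := hz_neq0 denominators_neq0.
(* [N] stays fixed, so that the recursion relates path sums over one and the same set of heights;
   [v] varies, since the induction hypothesis is used for permuted variables. *)
elim: n u v => [//|n IH] u v _ nN vg.
have [->|n0] := posnP n.
  by rewrite dwbc1//; [rewrite Z_init !mxE|lia].
have nN1 : (n < N)%N by lia.
pose s := lambda + \sum_(l < n.+1) v l.
pose D x := dwbc theta hbar lambda N n.+1 (set_last n u x) v.
pose E x := Z (rowf n.+1 (set_last n u x)) (rowf n.+1 v).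
pose x (i : 'I_n.+1) := v i - hbar.
have hD : theta_space tau n.+1 s D by exact: dwbc_space.
have hE : theta_space tau n.+1 s E by exact: Z_space.
pose F (b : bool) := if b then D else E.
have hDE : theta_space tau n.+1 s (fun y => D y - E y).
  have hF b : theta_space tau n.+1 s (F b) by case: b.
  have := theta_space_lin [:: true; false] (fun b : bool => if b then 1 else -1) hF.
  congr theta_space; apply/funext => y.
  by rewrite !big_cons big_nil /F mul1r mulN1r addr0.
have DE0 i : D (x i) - E (x i) = 0.
  have ilen : (i <= n)%N by rewrite -ltnS.
  have [v' [t [e1 e2 e3]]] := dwbc_move_last tau_gt0 theta_odd denominators_neq0
    (set_last n u (x i)) v nN ilen.
  have lastE : set_last n u (x i) n = v' n - hbar by rewrite /set_last eqxx e2.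
  have rowv : rowf n.+1 v' = col_perm t (rowf n.+1 v).
    by apply/rowP => k; rewrite !mxE e3.
  have EE : E (x i) = Z (rowf n.+1 (set_last n u (x i))) (rowf n.+1 v').
    by rewrite rowv -[in RHS](col_perm1 (rowf n.+1 (set_last n u (x i)))) Z_sym.
  have hW : (rowf n.+1 (set_last n u (x i))) 0 ord_max = (rowf n.+1 v') 0 ord_max - hbar.
    by rewrite !mxE.
  have vg' a b : (a < n)%N -> (b < n)%N -> a != b -> theta (v' a - v' b) != 0.
    move=> an bn ab; have := vg _ _ (ltn_ord (t (Ordinal (ltnW an : (a < n.+1)%N))))
      (ltn_ord (t (Ordinal (ltnW bn : (b < n.+1)%N)))).
    rewrite -!e3; apply; apply: contra ab => /eqP/val_inj/perm_inj/(congr1 val)/= ->.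
    exact: eqxx.
  have rowW (w : nat -> R[i]) : (\row_(m < n) (rowf n.+1 w) 0 (widen_ord (leqnSn n) m)) = rowf n w.
    by apply/rowP => k; rewrite !mxE.
  rewrite EE /D e1 (Z_rec n0 hW) (dwbc_rec th_odd th0 hz0 nN1 lastE) !rowW.
  have nN2 : (n.*2 < N)%N by lia.
  rewrite (IH _ _ n0 nN2 vg').
  rewrite [X in _ - _ * X * _](eq_bigr (fun m : 'I_n =>
    theta (v' n - v' m - hbar) * theta (set_last n u (x i) m - v' n))).
    exact: subrr.
  by move=> m _; rewrite !mxE.
have xne i j : i != j -> theta (x i - x j) != 0.
  move=> ij; rewrite /x (_ : v i - hbar - (v j - hbar) = v i - v j); last by ring.
  by apply: vg; rewrite ?ltn_ord.
(* Here [s - \sum_i x i] is [lambda + n.+1 * hbar], the [v_i] cancelling. *)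
have sne : theta (s - \sum_i x i) != 0.
  rewrite /s /x sumrB sumr_const card_ord -mulr_natl.
  rewrite (_ : _ - _ = lambda + n.+1%:R * hbar); last by ring.
  exact: denominators_neq0.
have := theta_interpolation theta_odd (ltn0Sn n) hDE xne sne DE0 (u n).
have lastE : set_last n u (u n) = u.
  by apply/funext => k; rewrite /set_last; case: eqP => [->|].
by rewrite /D /E lastE => /eqP; rewrite subr_eq0 => /eqP.
Qed.

End Uniqueness.

Theorem lemma1 (R : realType) (tau : R[i]) (theta : R[i] -> R[i])
    (hbar lambda : R[i])
    (Z : forall n : nat, 'rV[R[i]]_n -> 'rV[R[i]]_n -> R[i])
    (tau_gt0 : 0 < complex.Im tau)
    (theta_odd : odd_theta tau theta)
    (hbar_neq0 : hbar != 0)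
    (denominators_neq0 : forall k : nat, theta (lambda + k%:R * hbar) != 0)
    (Z_sym : forall n : nat, (0 < n)%N ->
       forall (s t : {perm 'I_n}) (u v : 'rV[R[i]]_n),
       Z n (col_perm s u) (col_perm t v) = Z n u v)
    (Z_elliptic : forall n : nat, (0 < n)%N ->
       forall (u v : 'rV[R[i]]_n) (i : 'I_n),
       exists chi : R[i] -> R[i],
         [/\ character tau chi,
             chi 1 = (-1) ^+ n,
             chi tau
               = (-1) ^+ n * cexp (2 * pii R * (lambda + \sum_(j < n) v 0 j))
           & elliptic_poly tau n%:Z chi (fun x => Z n (set_var u i x) v)])
    (Z_rec : forall n : nat, (0 < n)%N ->
       forall u v : 'rV[R[i]]_n.+1,
       u 0 ord_max = v 0 ord_max - hbar ->
       Z n.+1 u v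
         = theta (lambda + n.+1%:R * hbar) * theta hbar
             / theta (lambda + n%:R * hbar)
           * (\prod_(m < n)
                (theta (v 0 ord_max - v 0 (widen_ord (leqnSn n) m) - hbar)
                 * theta (u 0 (widen_ord (leqnSn n) m) - v 0 ord_max)))
           * Z n (\row_m u 0 (widen_ord (leqnSn n) m))
                 (\row_m v 0 (widen_ord (leqnSn n) m)))
    (Z_init : forall u v : 'rV[R[i]]_1,
       Z 1%N u v
         = theta (u 0 0 - v 0 0 - lambda) * theta hbar / theta (- lambda)) :
  forall (n : nat) (u v : 'rV[R[i]]_n), (0 < n)%N ->
    (forall i j : 'I_n, i != j -> ~ lattice tau (v 0 i - v 0 j))
      \/ {for (v : 'rV[R[i]^o]_n),
            continuous (Z n u : 'rV[R[i]^o]_n -> R[i]^o)} ->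
    partition_function theta hbar u v lambda = Z n u v.
Proof.
(* Relative heights reach [n.+1.*2], and exchanging rows requires this to be strictly below [N]. *)
move=> [//|n] u v _ hv; pose N := n.+1.*2.+1.
pose U (i : nat) : R[i] := u 0 (inord i); pose V (i : nat) : R[i] := v 0 (inord i).
have uE (i : 'I_n.+1) : u 0 i = U i by rewrite /U inord_val.
have vE (i : 'I_n.+1) : v 0 i = V i by rewrite /V inord_val.
have rowu : \row_(i < n.+1) U (i : nat) = u by apply/rowP => i; rewrite mxE -uE.
have nN : (n.+1.*2 < N)%N by exact: ltnSn.
rewrite (partition_function_dwbc lambda (thetaN theta_odd) hbar_neq0 (ltn0Sn n) (ltnW nN) uE vE).
have unique W := @dwbc_unique R tau theta hbar lambda Z tau_gt0 theta_odd
  denominators_neq0 Z_sym Z_elliptic Z_rec Z_init N n.+1 U W (ltn0Sn n) nN.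
case: hv => [vg|cZ].
  have rowv : \row_(i < n.+1) V (i : nat) = v by apply/rowP => i; rewrite mxE -vE.
  rewrite unique ?rowu ?rowv// => i j hi hj ij; apply/eqP => z.
  apply: (vg (inord i) (inord j)); last exact: theta_zero_lattice z.
  by apply: contra ij => /eqP/(congr1 val)/=; rewrite !inordK// => ->.
pose W (t : R[i]) (k : nat) : R[i] := k%:R * t + V k.
pose w : 'rV[R[i]^o]_n.+1 := \row_i (i : nat)%:R.
have rowW t : \row_(i < n.+1) W t (i : nat) = t *: (w : 'rV[R[i]]_n.+1) + v.
  by apply/rowP => i; rewrite !mxE vE /W mulrC.
pose f (t : R[i]^o) : R[i]^o := dwbc theta hbar lambda N n.+1 U (W t)
  - Z n.+1 u (t *: (w : 'rV[R[i]]_n.+1) + v).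
have cD : {for (0 : R[i]^o), continuous
    (fun t : R[i]^o => dwbc theta hbar lambda N n.+1 U (W t) : R[i]^o)}.
  apply/differentiable_continuous/derivable1_diffP.
  have hD : holomorphic (fun t => dwbc theta hbar lambda N n.+1 U (fun k => k%:R * t + V k)).
    exact: (@holo_dwbc R tau theta hbar lambda N theta_odd).
  exact: hD.
have cE : {for (0 : R[i]^o), continuous
    (fun t : R[i]^o => Z n.+1 u (t *: (w : 'rV[R[i]]_n.+1) + v) : R[i]^o)}.
  pose M (t : R[i]^o) : 'rV[R[i]^o]_n.+1 := t *: w + (v : 'rV[R[i]^o]_n.+1).
  have cM : {for (0 : R[i]^o), continuous M}.
    have c1 : {for (0 : R[i]^o), continuous (fun t : R[i]^o => t *: w)}.
      exact: (@scalel_continuous R[i] 'rV[R[i]^o]_n.+1 w 0).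
    have c2 : {for (0 : R[i]^o), continuous (fun t : R[i]^o => v : 'rV[R[i]^o]_n.+1)}.
      exact: cst_continuous.
    exact: (continuousD c1 c2).
  have M0 : v = M 0 by rewrite /M scale0r add0r.
  have cZM : {for M 0, continuous (Z n.+1 u : 'rV[R[i]^o]_n.+1 -> R[i]^o)}.
    by rewrite -M0; exact: cZ.
  exact: (continuous_comp (f := M) cM cZM).
have cf : {for 0, continuous f} by exact: (continuousB cD cE).
(* If [f 0] were nonzero, so would be [f t] for small [t]; but for small nonzero [t] the entries
   [W t] are generic and [unique] gives [f t = 0]. *)
have f0 : f 0 = 0.
  apply/eqP/negPn/negP => fz.
  have near_f : \forall t \near (0 : R[i]^o)^', f t != 0.
    exact: (cvg_within _ (cvgr_neq0 _ cf fz)).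
  have near_V : \forall t \near (0 : R[i]^o)^', forall p : 'I_n.+1 * 'I_n.+1,
      p.1 != p.2 -> theta (W t p.1 - W t p.2) != 0.
    apply: filter_forall => -[i j] /=.
    have [_|ij] := boolP (i == j); first by apply: filterE.
    have k0 : (i : nat)%:R - (j : nat)%:R != 0 :> R[i].
      by rewrite subr_eq0 eqr_nat -val_eqE in ij *.
    apply: filterS (theta_near_affine_neq0 tau_gt0 theta_odd (V i - V j) k0) => t ht _.
    by rewrite (_ : W t i - W t j = ((i : nat)%:R - (j : nat)%:R) * t + (V i - V j))// /W; ring.
  have [t [ft tV]] := filter_ex (filterI near_f near_V).
  move/eqP: ft; apply; rewrite /f unique ?rowu ?rowW ?subrr// => i j hi hj ij.
  exact: (tV (Ordinal hi, Ordinal hj)).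
move: f0; rewrite /f scale0r add0r => /eqP; rewrite subr_eq0 => /eqP <-.
by congr dwbc; apply/funext => k; rewrite /W mulr0 add0r.
Qed.
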